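(* Let $\mathcal{H}eis_k$ be the Heisenberg category of central charge $k\in\mathbb Z$ over the commutative ring $\Bbbk$ (defined in the context). There exist unique morphisms $c':\mathbf 1\to\uparrow\otimes\downarrow$ and $d':\downarrow\otimes\uparrow\to\mathbf 1$ in $\mathcal{H}eis_k$ such that, with $t'$ and the dotted bubbles $\circlearrowleft_n,\circlearrowright_n$ ($n\in\mathbb Z$) defined from $c',d'$ as in the context, the following relations hold: (P1) $t'\circ t=1_{\uparrow\otimes\downarrow}+\sum_{r,s\ge 0}\big((x^r\otimes 1_\downarrow)\circ c'\circ d\circ(x^s\otimes 1_\downarrow)\big)\otimes\circlearrowleft_{-r-s-2}$; (P2) $t\circ t'=1_{\downarrow\otimes\uparrow}+\sum_{r,s\ge 0}\circlearrowright_{-r-s-2}\otimes\big((1_\downarrow\otimes x^s)\circ c\circ d'\circ(1_\downarrow\otimes x^r)\big)$; (P3) if $k\ge 0$: $(1_\uparrow\otimes d)\circ(s\otimes 1_\downarrow)\circ(1_\uparrow\otimes c')=\delta_{k,0}1_\uparrow$, and $\circlearrowright_r=-\delta_{r,k-1}1_{\mathbf 1}$ for $0\le r<k$; (P4) if $k\le 0$: $(d'\otimes 1_\uparrow)\circ(1_\downarrow\otimes s)\circ(c\otimes 1_\uparrow)=\delta_{k,0}1_\uparrow$, and $\circlearrowleft_r=\delta_{r,-k-1}1_{\mathbf 1}$ for $0\le r<-k$. (In particular, $t'\circ t=1_{\uparrow\otimes\downarrow}+\delta_{k,1}\,c'\circ d$ if $k\le 1$, and $t\circ t'=1_{\downarrow\otimes\uparrow}-\delta_{k,-1}\,c\circ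 d'$ if $k\ge -1$.) Moreover, $\mathcal{H}eis_k$ can be presented equivalently as the strict $\Bbbk$-linear monoidal category generated by objects $\uparrow,\downarrow$ and morphisms $x,s,c,d,c',d'$ (with the sources and targets above) subject only to the relations (H), (A) of the context and (P1)–(P4) (with $t$, $t'$ and the bubbles given by the same formulas); that is, the strict $\Bbbk$-linear monoidal functor from this category to $\mathcal{H}eis_k$ sending each generator to the morphism of the same name is an isomorphism.
   Context: Fix a commutative ring $\Bbbk$ and an integer $k$. In a strict monoidal category write $\mathbf 1$ for the unit object, $1_X$ for the identity of $X$, $a\circ b$ for composition ($a$ after $b$), $a\otimes b$ for the tensor product, and $x^n$ for the $n$-fold composite of an endomorphism ($x^0$ the identity); $\delta$ is the Kronecker delta. The Heisenberg category $\mathcal{H}eis_k$ is the strict $\Bbbk$-linear monoidal category generated by objects $\uparrow,\downarrow$ and morphisms $x:\uparrow\to\uparrow$, $s:\uparrow\otimes\uparrow\to\uparrow\otimes\uparrow$, $c:\mathbf 1\to\downarrow\otimes\uparrow$, $d:\uparrow\otimes\downarrow\to\mathbf 1$, subject to the following relations, where $t:=(1_\downarrow\otimes 1_\uparrow\otimes d)\circ(1_\downarrow\otimes s\otimes 1_\downarrow)\circ(c\otimes 1_\uparrow\otimes 1_\downarrow):\uparrow\otimes\downarrow\to\downarrow\otimes\uparrow$: (H) $s\circ s=1_{\uparrow\otimes\uparrow}$; $(s\otimes 1_\uparrow)\circ(1_\uparrow\otimes s)\circ(s\otimes 1_\uparrow)=(1_\uparrow\otimes s)\circ(s\otimes 1_\uparrow)\circ(1_\uparrow\otimes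 s)$; $(x\otimes 1_\uparrow)\circ s-s\circ(1_\uparrow\otimes x)=1_{\uparrow\otimes\uparrow}$. (A) $(d\otimes 1_\uparrow)\circ(1_\uparrow\otimes c)=1_\uparrow$ and $(1_\downarrow\otimes d)\circ(c\otimes 1_\downarrow)=1_\downarrow$. (I) If $k\ge0$, the morphism $\uparrow\otimes\downarrow\to(\downarrow\otimes\uparrow)\oplus\mathbf 1^{\oplus k}$ with components $t$ and $d\circ(x^r\otimes 1_\downarrow)$, $r=0,\dots,k-1$, is an isomorphism in the additive envelope; if $k<0$, the morphism $(\uparrow\otimes\downarrow)\oplus\mathbf 1^{\oplus(-k)}\to\downarrow\otimes\uparrow$ with components $t$ and $(1_\downarrow\otimes x^r)\circ c$, $r=0,\dots,-k-1$, is an isomorphism in the additive envelope. (Formally, one adjoins as further generators the matrix entries of a two-sided inverse, with relations saying both matrix products are identity matrices.) Given morphisms $c':\mathbf 1\to\uparrow\otimes\downarrow$ and $d':\downarrow\otimes\uparrow\to\mathbf 1$, define $t':=(d'\otimes 1_\uparrow\otimes 1_\downarrow)\circ(1_\downarrow\otimes s\otimes 1_\downarrow)\circ(1_\downarrow\otimes 1_\uparrow\otimes c'):\downarrow\otimes\uparrow\to\uparrow\otimes\downarrow$, and for $n\ge0$ define the endomorphisms of $\mathbf 1$ (these form a commutative ring, in which product equals composition equals tensor product) $\circlearrowleft_n:=d'\circ(1_\downarrow\otimes x^n)\circ c$ and $\circlearrowright_n:=d\circ(x^n\otimes 1_\downarrow)\circ c'$. For $n<0$ define $\circlearrowleft_n:=\det(\circlearrowright_{i-j+k})_{i,j=1,\dots,r}$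 where $r:=n+k+1$ (so $r\le k$), and $\circlearrowright_n:=-\det(-\circlearrowleft_{i-j-k})_{i,j=1,\dots,r}$ where $r:=n-k+1$ (so $r\le -k$); the determinants are interpreted as $1$ if $r=0$ and as $0$ if $r<0$ (all matrix entries occurring have nonnegative index). With these definitions only finitely many terms in the sums in (P1), (P2) are nonzero. *)

(* Defs.v *)
(* Presentation of strict R-linear monoidal categories by
   generators and relations, as well-typed formal terms modulo the smallest
   congruence containing the axioms of a strict R-linear monoidal category and
   the given relations.  Objects are words in {up = true, down = false}. *)
From HB Require Import structures.
From mathcomp Require Import all_boot all_order all_algebra all_fingroup.
Set Implicit Arguments. Unset Strict Implicit. Unset Printing Implicit Defensive.
Import Order.TTheory GRing.Theory Num.Theory.
Local Open Scope ring_scope.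

Definition word := seq bool.
Definition up : word := [:: true].
Definition dn : word := [:: false].
Definition uu : word := [:: true; true].
Definition ud : word := [:: true; false].
Definition du : word := [:: false; true].
Definition w1 : word := [::].

Section Terms.
Variables (R : comPzRingType) (G : Type).

Inductive tm : Type :=
| Gen of G
| Id of word
| Comp of tm & tm        (* Comp f g = f o g *)
| Tens of tm & tm
| Zero of word & word
| Add of tm & tm
| Scal of R & tm.

Variable gty : G -> word * word.  (* (source, target) of generators *)

Fixpoint ty (f : tm) : option (word * word) :=
  match f with
  | Gen g => Some (gty g)
  | Id w => Some (w, w)
  | Comp f g => match ty f, ty g with
                | Some (a, b), Some (c, d) => if d == a then Some (c, b) else None
                | _, _ => None end
  | Tens f g => match ty f, ty g with
                | Some (a, b), Some (c, d) => Some (a ++ c, b ++ d)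
                | _, _ => None end
  | Zero a b => Some (a, b)
  | Add f g => match ty f, ty g with
               | Some p, Some q => if p == q then Some p else None
               | _, _ => None end
  | Scal _ f => ty f
  end.

Definition wt (f : tm) : bool := ty f != None.

Variable rels : tm -> tm -> Prop.

Inductive eqv : tm -> tm -> Prop :=
| e_refl f : eqv f f
| e_sym f g : eqv f g -> eqv g f
| e_trans f g h : eqv f g -> eqv g h -> eqv f h
| e_rel f g : rels f g -> eqv f g
| e_comp f f' g g' : eqv f f' -> eqv g g' -> eqv (Comp f g) (Comp f' g')
| e_tens f f' g g' : eqv f f' -> eqv g g' -> eqv (Tens f g) (Tens f' g')
| e_add f f' g g' : eqv f f' -> eqv g g' -> eqv (Add f g) (Add f' g')
| e_scal a f f' : eqv f f' -> eqv (Scal a f) (Scal a f')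
| e_comp_assoc f g h : wt (Comp f (Comp g h)) ->
    eqv (Comp f (Comp g h)) (Comp (Comp f g) h)
| e_comp_idl f a b : ty f = Some (a, b) -> eqv (Comp (Id b) f) f
| e_comp_idr f a b : ty f = Some (a, b) -> eqv (Comp f (Id a)) f
| e_tens_assoc f g h : wt f -> wt g -> wt h ->
    eqv (Tens (Tens f g) h) (Tens f (Tens g h))
| e_tens_idl f : wt f -> eqv (Tens (Id w1) f) f
| e_tens_idr f : wt f -> eqv (Tens f (Id w1)) f
| e_tens_id v w : eqv (Tens (Id v) (Id w)) (Id (v ++ w))
| e_interchange f g f' g' : wt (Comp f f') -> wt (Comp g g') ->
    eqv (Comp (Tens f g) (Tens f' g')) (Tens (Comp f f') (Comp g g'))
| e_add_assoc f g h : wt (Add f (Add g h)) -> eqv (Add f (Add g h)) (Add (Add f g) h)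
| e_add_comm f g : wt (Add f g) -> eqv (Add f g) (Add g f)
| e_add0 f a b : ty f = Some (a, b) -> eqv (Add f (Zero a b)) f
| e_scal1 f : wt f -> eqv (Scal 1 f) f
| e_scal0 f a b : ty f = Some (a, b) -> eqv (Scal 0 f) (Zero a b)
| e_scalM a b f : wt f -> eqv (Scal a (Scal b f)) (Scal (a * b) f)
| e_scalDl a b f : wt f -> eqv (Scal (a + b) f) (Add (Scal a f) (Scal b f))
| e_scalDr a f g : wt (Add f g) -> eqv (Scal a (Add f g)) (Add (Scal a f) (Scal a g))
| e_compDl f g h : wt (Comp (Add f g) h) ->
    eqv (Comp (Add f g) h) (Add (Comp f h) (Comp g h))
| e_compDr f g h : wt (Comp h (Add f g)) ->
    eqv (Comp h (Add f g)) (Add (Comp h f) (Comp h g))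
| e_compZl a f g : wt (Comp f g) -> eqv (Comp (Scal a f) g) (Scal a (Comp f g))
| e_compZr a f g : wt (Comp f g) -> eqv (Comp f (Scal a g)) (Scal a (Comp f g))
| e_tensDl f g h : wt (Tens (Add f g) h) ->
    eqv (Tens (Add f g) h) (Add (Tens f h) (Tens g h))
| e_tensDr f g h : wt (Tens h (Add f g)) ->
    eqv (Tens h (Add f g)) (Add (Tens h f) (Tens h g))
| e_tensZl a f g : wt (Tens f g) -> eqv (Tens (Scal a f) g) (Scal a (Tens f g))
| e_tensZr a f g : wt (Tens f g) -> eqv (Tens f (Scal a g)) (Scal a (Tens f g)).

Definition tsum (a b : word) (l : seq tm) : tm := foldr Add (Zero a b) l.
Definition tprod (l : seq tm) : tm := foldr Comp (Id w1) l.

Definition tdet (r : nat) (M : 'I_r -> 'I_r -> tm) : tm :=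
  tsum w1 w1 [seq Scal ((-1) ^+ odd_perm sg) (tprod [seq M i (sg i) | i : 'I_r])
               | sg : {perm 'I_r}].

Section Diagrams.
Variables (k : int) (x s c d c' d' : tm).

Definition xpow (n : nat) : tm := iter n (Comp x) (Id up).

Definition tcr : tm :=
  Comp (Tens (Id du) d) (Comp (Tens (Tens (Id dn) s) (Id dn)) (Tens c (Id ud))).
Definition tcr' : tm :=
  Comp (Tens d' (Id ud)) (Comp (Tens (Tens (Id dn) s) (Id dn)) (Tens (Id du) c')).

Definition bubL (n : nat) : tm := Comp d' (Comp (Tens (Id dn) (xpow n)) c).
Definition bubR (n : nat) : tm := Comp d (Comp (Tens (xpow n) (Id dn)) c').

Definition bubLZ (n : int) : tm :=
  match n with
  | Posz m => bubL m
  | Negz _ => let r := n + k + 1 in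
      if r < 0 then Zero w1 w1
      else @tdet (absz r) (fun i j => bubR (absz (i%:Z - j%:Z + k)))
  end.
Definition bubRZ (n : int) : tm :=
  match n with
  | Posz m => bubR m
  | Negz _ => let r := n - k + 1 in
      if r < 0 then Zero w1 w1
      else Scal (-1)%R (@tdet (absz r) (fun i j => Scal (-1)%R (bubL (absz ((i%:Z - j%:Z - k)%R)))))
  end.

(* range of summation indices containing all nonzero terms of (P1),(P2) *)
Definition prange : seq nat := iota 0 `|k|.+1.

Inductive HA_rel : tm -> tm -> Prop :=
| hH1 : HA_rel (Comp s s) (Id uu)
| hH2 : HA_rel (Comp (Tens s (Id up)) (Comp (Tens (Id up) s) (Tens s (Id up))))
               (Comp (Tens (Id up) s) (Comp (Tens s (Id up)) (Tens (Id up) s)))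
| hH3 : HA_rel (Add (Comp (Tens x (Id up)) s) (Scal (-1) (Comp s (Tens (Id up) x))))
               (Id uu)
| hA1 : HA_rel (Comp (Tens d (Id up)) (Tens (Id up) c)) (Id up)
| hA2 : HA_rel (Comp (Tens (Id dn) d) (Tens c (Id dn))) (Id dn).

Inductive P_rel : tm -> tm -> Prop :=
| pP1 : P_rel (Comp tcr' tcr)
    (Add (Id ud) (tsum ud ud
       [seq Tens (Comp (Tens (xpow i) (Id dn)) (Comp c' (Comp d (Tens (xpow j) (Id dn)))))
                 (bubLZ (- i%:Z - j%:Z - 2))
       | i <- prange, j <- prange]))
| pP2 : P_rel (Comp tcr tcr')
    (Add (Id du) (tsum du du
       [seq Tens (bubRZ (- i%:Z - j%:Z - 2))
                 (Comp (Tens (Id dn) (xpow j)) (Comp c (Comp d' (Tens (Id dn) (xpow i)))))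
       | i <- prange, j <- prange]))
| pP3a : 0 <= k ->
    P_rel (Comp (Tens (Id up) d) (Comp (Tens s (Id dn)) (Tens (Id up) c')))
          (if k == 0 then Id up else Zero up up)
| pP3b (r : nat) : 0 <= k -> r%:Z < k ->
    P_rel (bubR r) (if r%:Z == k - 1 then Scal (-1) (Id w1) else Zero w1 w1)
| pP4a : k <= 0 ->
    P_rel (Comp (Tens d' (Id up)) (Comp (Tens (Id dn) s) (Tens c (Id up))))
          (if k == 0 then Id up else Zero up up)
| pP4b (r : nat) : k <= 0 -> r%:Z < - k ->
    P_rel (bubL r) (if r%:Z == - k - 1 then Id w1 else Zero w1 w1).

End Diagrams.
End Terms.

Arguments Gen {R G}. Arguments Id {R G}. Arguments Zero {R G}.

Fixpoint fmap (R : comPzRingType) (G1 G2 : Type) (phi : G1 -> tm R G2) (u : tm R G1)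
  : tm R G2 :=
  match u with
  | Gen g => phi g
  | Id w => Id w
  | Comp f g => Comp (fmap phi f) (fmap phi g)
  | Tens f g => Tens (fmap phi f) (fmap phi g)
  | Zero a b => Zero a b
  | Add f g => Add (fmap phi f) (fmap phi g)
  | Scal a f => Scal a (fmap phi f)
  end.

(* generators x, s, c, d and the entries a, b_r (r < |k|) of the inverse in (I) *)
Inductive hgen (n : nat) : Type := HX | HS | HC | HD | HA | HB of 'I_n.
Arguments HX {n}. Arguments HS {n}. Arguments HC {n}. Arguments HD {n}.
Arguments HA {n}.

Definition hgty (k : int) (g : hgen `|k|) : word * word :=
  match g with
  | HX => (up, up) | HS => (uu, uu) | HC => (w1, du) | HD => (ud, w1)
  | HA => (du, ud)
  | HB _ => if 0 <= k then (w1, ud) else (du, w1)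
  end.

Section Heis.
Variables (R : comPzRingType) (k : int).
Local Notation htm := (tm R (hgen `|k|)).
Definition hX : htm := Gen HX.
Definition hS : htm := Gen HS.
Definition hC : htm := Gen HC.
Definition hD : htm := Gen HD.
Definition ht : htm := tcr hS hC hD.
Definition hdr (r : nat) : htm := Comp hD (Tens (xpow hX r) (Id dn)).
Definition hcr (r : nat) : htm := Comp (Tens (Id dn) (xpow hX r)) hC.

(* relations (I): both matrix products are identity matrices *)
Inductive inv_rel : htm -> htm -> Prop :=
| iP1 : 0 <= k -> inv_rel
    (Add (Comp (Gen HA) ht) (tsum ud ud [seq Comp (Gen (HB r)) (hdr r) | r : 'I_`|k|]))
    (Id ud)
| iP2 : 0 <= k -> inv_rel (Comp ht (Gen HA)) (Id du)
| iP3 (r : 'I_`|k|) : 0 <= k -> inv_rel (Comp ht (Gen (HB r))) (Zero w1 du)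
| iP4 (r : 'I_`|k|) : 0 <= k -> inv_rel (Comp (hdr r) (Gen HA)) (Zero du w1)
| iP5 (r r' : 'I_`|k|) : 0 <= k -> inv_rel (Comp (hdr r) (Gen (HB r')))
                                (if r == r' then Id w1 else Zero w1 w1)
| iN1 : k < 0 -> inv_rel
    (Add (Comp ht (Gen HA)) (tsum du du [seq Comp (hcr r) (Gen (HB r)) | r : 'I_`|k|]))
    (Id du)
| iN2 : k < 0 -> inv_rel (Comp (Gen HA) ht) (Id ud)
| iN3 (r : 'I_`|k|) : k < 0 -> inv_rel (Comp (Gen HA) (hcr r)) (Zero w1 ud)
| iN4 (r : 'I_`|k|) : k < 0 -> inv_rel (Comp (Gen (HB r)) ht) (Zero ud w1)
| iN5 (r r' : 'I_`|k|) : k < 0 -> inv_rel (Comp (Gen (HB r)) (hcr r'))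
                               (if r == r' then Id w1 else Zero w1 w1).

Definition heis_rel (u v : htm) : Prop := HA_rel hX hS hC hD u v \/ inv_rel u v.

Definition tyH : htm -> option (word * word) := ty (@hgty k).
Definition eqvH : htm -> htm -> Prop := eqv (@hgty k) heis_rel.
End Heis.

Inductive agen : Type := AX | AS | AC | AD | AC' | AD'.
Definition agty (g : agen) : word * word :=
  match g with
  | AX => (up, up) | AS => (uu, uu) | AC => (w1, du) | AD => (ud, w1)
  | AC' => (w1, ud) | AD' => (du, w1)
  end.

Section Alt.
Variables (R : comPzRingType) (k : int).
Local Notation atm := (tm R agen).
Definition alt_rel (u v : atm) : Prop :=
  HA_rel (Gen AX) (Gen AS) (Gen AC) (Gen AD) u v \/
  P_rel k (Gen AX) (Gen AS) (Gen AC) (Gen AD) (Gen AC') (Gen AD') u v.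
Definition tyA : atm -> option (word * word) := ty agty.
Definition eqvA : atm -> atm -> Prop := eqv agty alt_rel.
End Alt.

Definition altF (R : comPzRingType) (k : int) (c' d' : tm R (hgen `|k|)) (g : agen)
  : tm R (hgen `|k|) :=
  match g with
  | AX => Gen HX | AS => Gen HS | AC => Gen HC | AD => Gen HD
  | AC' => c' | AD' => d'
  end.

Definition satisfies_P (R : comPzRingType) (k : int) (c' d' : tm R (hgen `|k|)) : Prop :=
  forall u v, P_rel k (hX R k) (hS R k) (hC R k) (hD R k) c' d' u v -> eqvH u v.

(* the functor is a well-defined strict linear monoidal functor (identity on
   objects) which is bijective on every Hom space, i.e. an isomorphism *)
Definition altF_iso (R : comPzRingType) (k : int) (c' d' : tm R (hgen `|k|)) : Prop :=
  let F := fmap (altF c' d') in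
  [/\ (forall u v, eqvA k u v -> eqvH (F u) (F v)),
      (forall u a b, tyA u = Some (a, b) -> tyH (F u) = Some (a, b)),
      (forall f a b, tyH f = Some (a, b) ->
         exists2 u, tyA u = Some (a, b) & eqvH (F u) f)
    & (forall u v a b, tyA u = Some (a, b) -> tyA v = Some (a, b) ->
         eqvH (F u) (F v) -> eqvA k u v)].

(* Main.v *)
(** Reversing both composition and tensor product and
    sending x, s, c, d, c', d' to x, -s, d, c, -d', -c' exchanges the
    central charges k and -k, so one may assume k >= 0.

    Then (P3) is a curl computation which gives t x^r c' = 0 and
    d x^r t' = 0 for r < k and d x^k t' = d'.  Expanding the Hessenberg-Toeplitz
    determinants defining the bubbles of negative index yields
    sum_i (d x^(r'+i) c') bubL_(-i-r-2) = - delta_(r,r') ("infinite Grassmannian"),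
    so (P1), (P2) say that t' and b_r := - sum_i x^i c' (x) bubL_(-i-r-2) form a
    two-sided inverse of the column (t, d x^r); conversely d' = d x^k t' and c' = - b_(k-1)
    (or t^-1 c if k = 0) are determined by the inverse.

    Starting from an inverse (a, b_r) with c', d' defined by these formulas, the
    point is that t' = a.  As (t, d x^r) is jointly monic, strands
    slide over the cup c', and c', d' satisfy one zigzag identity; together these give
    t t' = 1, which with d x^r t' = 0 forces t' = a.

    Diagrams are encoded as lists of layers: a generator together with the number
    of strands to its left. *)
Require Import Defs.
From mathcomp Require Import all_boot all_order all_algebra all_fingroup.
From HB Require Import structures.
From mathcomp Require Import boolp zify.
From Stdlib Require Import Setoid Morphisms.
Set Implicit Arguments. Unset Strict Implicit. Unset Printing Implicit Defensive.
Import Order.TTheory GRing.Theory Num.Theory.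
Local Open Scope ring_scope.

(** Terms are equal only up to an inductive congruence with typing side conditions, so diagrammatic
    arguments would drown in bookkeeping. Two devices avoid this. Hom spaces become modules with
    Leibniz equality, through chosen representatives. In lists of layers, associativity and units
    disappear, only the interchange of distant layers remains, and the side conditions of a
    rewriting step are decided by computation.

    The calculus is carried out over an arbitrary presentation in which (H) and (A) hold, because
    both categories need it: from an inverse to (P1)-(P4) in one, and back in the other.

    The mathematical obstacle is that (A) supplies one adjunction only, while [t'] is built from the
    other cup and cap, known only through the inverse. The key identities for the new cup are
    therefore tested against [t] and all [d x^r]. Computing [t' t] directly would involve the whole
    sum over bubbles, whereas [t t' = 1] has no correction term for [k >= 0].

    In the duality, the sign on [s] is forced by the dot relation, whose two terms are exchanged by
    reversal; the signs on [c'] and [d'] reflect the opposite signs in (P3) and (P4). *)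

Record presentation (R : comPzRingType) := Presentation {
  gen : Type;
  gen_ty : gen -> word * word;
  rel_of : tm R gen -> tm R gen -> Prop;
  rel_ty : forall f g, rel_of f g -> ty gen_ty f = ty gen_ty g }.

(** Generators form an arbitrary type, so equality and choice on terms come from classical axioms;
    choice is what provides canonical representatives of classes. *)
HB.instance Definition _ (R : comPzRingType) (G : Type) := gen_eqMixin (tm R G).
HB.instance Definition _ (R : comPzRingType) (G : Type) := gen_choiceMixin (tm R G).

(** * Terms modulo the congruence: typing, and Hom spaces as modules *)

Section Equivalence.
Variables (R : comPzRingType) (P : presentation R).
Local Notation T := (tm R (gen P)).
Local Notation ty := (@Defs.ty R (gen P) (@gen_ty R P)).
Local Notation wt := (@Defs.wt R (gen P) (@gen_ty R P)).
Definition peqv : T -> T -> Prop := eqv (@gen_ty R P) (@rel_of R P).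
Local Notation "f ~~~ g" := (peqv f g) (at level 70).

Lemma ty_Comp f g a b c : ty f = Some (b, c) -> ty g = Some (a, b) ->
  ty (Comp f g) = Some (a, c).
Proof. by move=> /= -> ->; rewrite eqxx. Qed.

Lemma ty_Tens f g a b c d : ty f = Some (a, b) -> ty g = Some (c, d) ->
  ty (Tens f g) = Some (a ++ c, b ++ d).
Proof. by move=> /= -> ->. Qed.

Lemma ty_Add f g a b : ty f = Some (a, b) -> ty g = Some (a, b) ->
  ty (Add f g) = Some (a, b).
Proof. by move=> /= -> ->; rewrite eqxx. Qed.

Lemma ty_wt f a b : ty f = Some (a, b) -> wt f.
Proof. by rewrite /Defs.wt => ->. Qed.

Lemma ty_CompI f g a c : ty (Comp f g) = Some (a, c) ->
  exists b, ty f = Some (b, c) /\ ty g = Some (a, b).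
Proof.
move=> /=; case: (ty f) => [[b e]|//]; case: (ty g) => [[a' d]|//].
by case: (d =P b) => [->|//] -[-> ->]; exists b.
Qed.

Lemma ty_AddI f g p : ty (Add f g) = Some p -> ty f = Some p /\ ty g = Some p.
Proof.
move=> /=; case: (ty f) => [q|//]; case: (ty g) => [q'|//].
by case: (q =P q') => [->|//] [->].
Qed.

Lemma wtE f : wt f -> exists a b, ty f = Some (a, b).
Proof. by rewrite /Defs.wt; case: (ty f) => [[a b]|//] _; exists a, b. Qed.

Lemma wt_Comp f g : wt (Comp f g) ->
  exists a b c, ty f = Some (b, c) /\ ty g = Some (a, b).
Proof. by move=> /wtE[a [c /ty_CompI[b tfg]]]; exists a, b, c. Qed.

Lemma wt_Add f g : wt (Add f g) ->
  exists a b, ty f = Some (a, b) /\ ty g = Some (a, b).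
Proof. by move=> /wtE[a [b /ty_AddI tfg]]; exists a, b. Qed.

Lemma wt_Tens f g : wt (Tens f g) ->
  exists a b c d, ty f = Some (a, b) /\ ty g = Some (c, d).
Proof.
rewrite /Defs.wt /=; case: (ty f) => [[a b]|//]; case: (ty g) => [[c d]|//] _.
by exists a, b, c, d.
Qed.

(** The structural axioms preserve types by their side conditions; for the given relations this is
    the field [rel_ty] of a presentation. *)
Lemma peqv_ty f g : f ~~~ g -> ty f = ty g.
Proof.
elim=> {f g} //=.
- by move=> f g h _ -> _ ->.
- exact: rel_ty.
- by move=> f f' g g' _ -> _ ->.
- by move=> f f' g g' _ -> _ ->.
- by move=> f f' g g' _ -> _ ->.
- by move=> f g h /wt_Comp[a [b [c [-> /ty_CompI[d [-> ->]]]]]]; rewrite ?eqxx /= ?eqxx.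
- by move=> f a b ->; rewrite eqxx.
- by move=> f a b ->; rewrite eqxx.
- by move=> f g h /wtE[a [b ->]] /wtE[a' [b' ->]] /wtE[a'' [b'' ->]]; rewrite !catA.
- by move=> f /wtE[a [b ->]].
- by move=> f /wtE[a [b ->]]; rewrite !cats0.
- move=> f g f' g' /wt_Comp[a [b [c [-> ->]]]] /wt_Comp[a' [b' [c' [-> ->]]]].
  by rewrite !eqxx.
- by move=> f g h /wt_Add[a [b [-> /ty_AddI[-> ->]]]]; rewrite ?eqxx /= ?eqxx.
- by move=> f g /wt_Add[a [b [-> ->]]]; rewrite eqxx.
- by move=> f a b ->; rewrite eqxx.
- by move=> a b f /wtE[? [? ->]]; rewrite eqxx.
- by move=> f g h /wt_Comp[a [b [c [/ty_AddI[-> ->] ->]]]]; rewrite ?eqxx /= ?eqxx.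
- by move=> f g h /wt_Comp[a [b [c [-> /ty_AddI[-> ->]]]]]; rewrite ?eqxx /= ?eqxx.
- by move=> f g h /wt_Tens[a [b [c [d [/ty_AddI[-> ->] ->]]]]]; rewrite !eqxx.
- by move=> f g h /wt_Tens[a [b [c [d [-> /ty_AddI[-> ->]]]]]]; rewrite !eqxx.
Qed.

#[global] Instance peqv_equiv : Equivalence peqv.
Proof. by split=> [f|f g|f g h]; [apply: e_refl|apply: e_sym|apply: e_trans]. Qed.
Lemma peqvv f : f ~~~ f. Proof. exact: e_refl. Qed.
#[local] Hint Resolve peqvv : core.
#[global] Instance Comp_peqv : Proper (peqv ==> peqv ==> peqv) (@Comp R (gen P)).
Proof. by move=> f f' ff g g' gg; apply: e_comp. Qed.
#[global] Instance Tens_peqv : Proper (peqv ==> peqv ==> peqv) (@Tens R (gen P)).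
Proof. by move=> f f' ff g g' gg; apply: e_tens. Qed.
#[global] Instance Add_peqv : Proper (peqv ==> peqv ==> peqv) (@Add R (gen P)).
Proof. by move=> f f' ff g g' gg; apply: e_add. Qed.
#[global] Instance Scal_peqv a : Proper (peqv ==> peqv) (@Scal R (gen P) a).
Proof. by move=> f f' ff; apply: e_scal. Qed.

Lemma tcompA f g h a b c d : ty h = Some (a, b) -> ty g = Some (b, c) ->
  ty f = Some (c, d) -> Comp f (Comp g h) ~~~ Comp (Comp f g) h.
Proof.
by move=> th tg tf; apply: e_comp_assoc; apply: ty_wt; apply: ty_Comp tf (ty_Comp tg th).
Qed.

Lemma tinterchange f g f' g' a b c a' b' c' :
  ty f = Some (b, c) -> ty f' = Some (a, b) ->
  ty g = Some (b', c') -> ty g' = Some (a', b') ->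
  Comp (Tens f g) (Tens f' g') ~~~ Tens (Comp f f') (Comp g g').
Proof.
move=> tf tf' tg tg'; apply: e_interchange; apply: ty_wt.
  exact: ty_Comp tf tf'.
exact: ty_Comp tg tg'.
Qed.

(** [f] acts before [g] here and after it in [tens_rl]; comparing the two gives both the exchange of
    distant layers and the commutativity of endomorphisms of the unit. *)
Lemma tens_lr f g a b c d : ty f = Some (a, b) -> ty g = Some (c, d) ->
  Comp (Tens (Id b) g) (Tens f (Id c)) ~~~ Tens f g.
Proof.
move=> tf tg; rewrite (tinterchange (b := b) (b' := c) (a := a) (c := b) (a' := c) (c' := d)) //.
by apply: e_tens; [apply: e_comp_idl tf | apply: e_comp_idr tg].
Qed.

Lemma tens_rl f g a b c d : ty f = Some (a, b) -> ty g = Some (c, d) ->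
  Comp (Tens f (Id d)) (Tens (Id a) g) ~~~ Tens f g.
Proof.
move=> tf tg; rewrite (tinterchange (b := a) (b' := d) (a := a) (c := b) (a' := c) (c' := d)) //.
by apply: e_tens; [apply: e_comp_idr tf | apply: e_comp_idl tg].
Qed.

Lemma comp_id w : Comp (Id w) (Id w) ~~~ Id w.
Proof. exact: e_comp_idl. Qed.

Lemma comp_idl f a b : ty f = Some (a, b) -> Comp (Id b) f ~~~ f.
Proof. exact: e_comp_idl. Qed.

Lemma comp_idr f a b : ty f = Some (a, b) -> Comp f (Id a) ~~~ f.
Proof. exact: e_comp_idr. Qed.

Lemma tens_idl f : wt f -> Tens (Id [::]) f ~~~ f.
Proof. exact: e_tens_idl. Qed.

Lemma tens_idr f : wt f -> Tens f (Id [::]) ~~~ f.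
Proof. exact: e_tens_idr. Qed.

Lemma scal1 f : wt f -> Scal 1 f ~~~ f.
Proof. exact: e_scal1. Qed.

Lemma tensA f g h : wt f -> wt g -> wt h ->
  Tens (Tens f g) h ~~~ Tens f (Tens g h).
Proof. exact: e_tens_assoc. Qed.

Lemma tens_id v w : Tens (Id v) (Id w) ~~~ Id (v ++ w).
Proof. exact: e_tens_id. Qed.

(* Hom spaces are subtypes of canonical representatives, so that equality is Leibniz. *)
Fact canon_ex (f : T) : exists g, `[< f ~~~ g >].
Proof. by exists f; apply/asboolP; apply: e_refl. Qed.
Definition canon f := xchoose (canon_ex f).

Lemma canonE f : f ~~~ canon f.
Proof. exact/asboolP/(xchooseP (canon_ex f)). Qed.

(** Equivalent terms define extensionally equal predicates, and [xchoose] depends on nothing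
    else. *)
Lemma canonP f g : f ~~~ g <-> canon f = canon g.
Proof.
split=> [fg|e]; last by rewrite (canonE f) e -(canonE g).
apply: eq_xchoose => h; apply/asboolP/asboolP => [<-|<-] //.
by symmetry.
Qed.

Lemma canonK f : canon (canon f) = canon f.
Proof. by apply/esym/canonP/canonE. Qed.

Section Hom.
Variables a b : word.

Definition hom_pred (f : T) := (ty f == Some (a, b)) && (canon f == f).
Definition mor : Type := {f : T | hom_pred f}.
HB.instance Definition _ := SubType.copy mor {f : T | hom_pred f}.
HB.instance Definition _ := Choice.copy mor {f : T | hom_pred f}.

Fact zero_hom_subproof : hom_pred (canon (Zero a b)).
Proof. by rewrite /hom_pred -(peqv_ty (canonE _)) /= canonK !eqxx. Qed.
Definition zero_hom : mor := Sub (canon (Zero a b)) zero_hom_subproof.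
(** Total by sending terms of any other type to [zero_hom]; an equality of classes can therefore be
    read back only for terms of type [(a, b)], as in [cls_inj]. *)
Definition cls (f : T) : mor := insubd zero_hom (canon f).

Lemma ty_val (h : mor) : ty (val h) = Some (a, b).
Proof. by case: h => f /= /andP[/eqP]. Qed.

Lemma val_cls f : ty f = Some (a, b) -> val (cls f) ~~~ f.
Proof.
move=> tf; rewrite /cls val_insubd /hom_pred -(peqv_ty (canonE _)) tf canonK !eqxx.
by symmetry; apply: canonE.
Qed.

Lemma cls_val h : cls (val h) = h.
Proof.
apply: val_inj; rewrite /cls val_insubd.
by case: h => f /= /andP[tf /eqP e]; rewrite /hom_pred !e tf eqxx.
Qed.

Lemma eq_cls f g : f ~~~ g -> cls f = cls g.
Proof. by rewrite /cls => /canonP->. Qed.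

Lemma cls_inj f g : ty f = Some (a, b) -> ty g = Some (a, b) -> cls f = cls g -> f ~~~ g.
Proof. by move=> tf tg e; rewrite -(val_cls tf) e (val_cls tg). Qed.

Definition addh (g h : mor) := cls (Add (val g) (val h)).
Definition scaleh x (h : mor) := cls (Scal x (val h)).
Let wtv (h : mor) : wt (val h). Proof. exact: ty_wt (ty_val h). Qed.
Let wtadd (g h : mor) : wt (Add (val g) (val h)).
Proof. exact: ty_wt (ty_Add (ty_val g) (ty_val h)). Qed.
Let wtadd3 (f g h : mor) : wt (Add (val f) (Add (val g) (val h))).
Proof. exact: ty_wt (ty_Add (ty_val f) (ty_Add (ty_val g) (ty_val h))). Qed.
Let valD g h : val (addh g h) ~~~ Add (val g) (val h).
Proof. exact: val_cls (ty_Add (ty_val g) (ty_val h)). Qed.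
Let valZ x h : val (scaleh x h) ~~~ Scal x (val h).
Proof. by apply: val_cls; rewrite /= ty_val. Qed.
Let val0 : val zero_hom ~~~ Zero a b. Proof. by symmetry; apply: canonE. Qed.

Let hom_eq (g h : mor) : val g ~~~ val h -> g = h.
Proof. by move=> e; rewrite -(cls_val g) -(cls_val h); apply: eq_cls. Qed.

Fact addhA : associative addh.
Proof. by move=> f g h; apply: hom_eq; rewrite !valD; apply: e_add_assoc. Qed.
Fact addhC : commutative addh.
Proof. by move=> g h; apply: hom_eq; rewrite !valD; apply: e_add_comm. Qed.
Fact add0h : left_id zero_hom addh.
Proof.
by move=> h; rewrite addhC; apply: hom_eq; rewrite valD val0; apply: e_add0; apply: ty_val.
Qed.
Fact scaleh1 : left_id 1 scaleh.
Proof. by move=> h; apply: hom_eq; rewrite valZ; apply: e_scal1. Qed.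
Fact scalehA x y h : scaleh x (scaleh y h) = scaleh (x * y) h.
Proof. by apply: hom_eq; rewrite !valZ; apply: e_scalM. Qed.
Fact scalehDr : right_distributive scaleh addh.
Proof. by move=> x g h; apply: hom_eq; rewrite !(valZ, valD); apply: e_scalDr. Qed.
Fact scalehDl h : {morph scaleh^~ h : x y / x + y >-> addh x y}.
Proof. by move=> x y; apply: hom_eq; rewrite !(valZ, valD); apply: e_scalDl. Qed.
Fact addNh : left_inverse zero_hom (scaleh (-1)) addh.
Proof.
move=> h; rewrite -{2}(scaleh1 h) -scalehDl addNr; apply: hom_eq.
by rewrite valZ val0; apply: e_scal0; apply: ty_val.
Qed.

HB.instance Definition _ := GRing.isZmodule.Build mor addhA addhC add0h addNh.
HB.instance Definition _ := GRing.Zmodule_isLmodule.Build R mor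
  scalehA scaleh1 scalehDr scalehDl.

Lemma val_lin x (g h : mor) : val (x *: g + h) ~~~ Add (Scal x (val g)) (val h).
Proof. by change (val (addh (scaleh x g) h) ~~~ Add (Scal x (val g)) (val h)); rewrite valD valZ. Qed.

Lemma cls0 : cls (Zero a b) = 0.
Proof. by apply: hom_eq; rewrite val0 val_cls. Qed.

Lemma clsD f g : ty f = Some (a, b) -> ty g = Some (a, b) ->
  cls (Add f g) = cls f + cls g.
Proof.
by move=> tf tg; apply: eq_cls; rewrite (val_cls tf) (val_cls tg).
Qed.

Lemma clsZ x f : ty f = Some (a, b) -> cls (Scal x f) = x *: cls f.
Proof. by move=> tf; apply: eq_cls; rewrite (val_cls tf). Qed.

Lemma ty_tsum (l : seq T) : all (fun f => ty f == Some (a, b)) l ->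
  ty (tsum a b l) = Some (a, b).
Proof.
by elim: l => //= f l IH /andP[/eqP tf /IH tl]; rewrite tf tl eqxx.
Qed.

Lemma cls_tsum (l : seq T) : all (fun f => ty f == Some (a, b)) l ->
  cls (tsum a b l) = \sum_(f <- l) cls f.
Proof.
elim: l => [_|f l IH] /=; first by rewrite big_nil cls0.
by move=> /andP[/eqP tf tl]; rewrite big_cons -IH // clsD ?ty_tsum.
Qed.

End Hom.
End Equivalence.
#[local] Hint Resolve peqvv : core.

(** Used to locate two successive layers in one word: the overlap [drop (size a) c] is the block of
    strands between their generators. *)
Lemma eq_cat_le (T : Type) (a b c d : seq T) : a ++ b = c ++ d -> (size a <= size c)%N ->
  c = a ++ drop (size a) c /\ b = drop (size a) c ++ d.
Proof.
move=> e le; have := congr1 (take (size a)) e; have := congr1 (drop (size a)) e.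
rewrite drop_size_cat // take_size_cat // drop_cat take_cat.
case: ltngtP le => // [_|->] _ -> eb; first by split=> //; rewrite {1}eb cat_take_drop.
by move: eb; rewrite subnn take0 cats0 drop0 drop_size cats0 => ->.
Qed.

(** * String diagrams as lists of layers *)

Section Layers.
Variables (R : comPzRingType) (P : presentation R).
Local Notation T := (tm R (gen P)).
Variables (N : Type) (nty : N -> word * word) (itp : N -> T).
Definition asrc g := (nty g).1.
Definition atgt g := (nty g).2.

Definition okl (w : word) (x : nat * N) :=
  (x.1 + size (asrc x.2) <= size w)%N && (take (size (asrc x.2)) (drop x.1 w) == asrc x.2).
Definition nxt (w : word) (x : nat * N) :=
  take x.1 w ++ atgt x.2 ++ drop (x.1 + size (asrc x.2)) w.
Definition lay (w : word) (x : nat * N) : T :=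
  Tens (Id (take x.1 w)) (Tens (itp x.2) (Id (drop (x.1 + size (asrc x.2)) w))).

Fixpoint okd w L := if L is x :: L' then okl w x && okd (nxt w x) L' else true.
Fixpoint outd w L := if L is x :: L' then outd (nxt w x) L' else w.
(** Layers are listed in the order in which they act, from the source on, hence opposite to the
    order of [Comp]. *)
Fixpoint ev w L : T := if L is x :: L' then Comp (ev (nxt w x) L') (lay w x) else Id w.

(* [Nat.add] and [Nat.sub] are used because, unlike [addn] and [subn], they reduce under [simpl]. *)
Definition shift n (L : seq (nat * N)) := [seq (Nat.add n x.1, x.2) | x <- L].

End Layers.
Arguments lay : simpl never.

(* Locked, since conversion would otherwise unfold quotients and choice of representatives. *)
HB.lock Definition diagram (R : comPzRingType) (P : presentation R) (N : Type)
  (nty : N -> word * word) (itp : N -> tm R (gen P)) (w w' : word) (L : seq (nat * N)) :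
  mor P w w' := cls w w' (ev nty itp w L).

Section Diagram.
Variables (R : comPzRingType) (P : presentation R).
Local Notation T := (tm R (gen P)).
Local Notation ty := (@Defs.ty R (gen P) (@gen_ty R P)).
Local Notation wt := (@Defs.wt R (gen P) (@gen_ty R P)).
Local Notation "f ~~~ g" := (peqv f g) (at level 70).
Local Notation mor := (@mor R P).
Local Notation cls := (@cls R P).

Variables (N : Type) (nty : N -> word * word) (itp : N -> T).
Hypothesis itp_ty : forall g, ty (itp g) = Some (nty g).

Local Notation asrc := (asrc nty).
Local Notation atgt := (atgt nty).
Local Notation okl := (okl nty).
Local Notation nxt := (nxt nty).
Local Notation okd := (okd nty).
Local Notation outd := (outd nty).
Local Notation lay := (lay nty itp).
Local Notation ev := (ev nty itp).
Local Notation D := (@diagram R P N nty itp).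

Lemma oklP w p g : okl w (p, g) ->
  exists l r, w = l ++ asrc g ++ r /\ p = size l.
Proof.
move=> /andP[/= le /eqP e]; exists (take p w), (drop (p + size (asrc g)) w).
by rewrite -{1}e addnC -drop_drop !cat_take_drop size_takel // (leq_trans _ le) ?leq_addr.
Qed.

Lemma okl_cat l g r : okl (l ++ asrc g ++ r) (size l, g).
Proof. by rewrite /okl /= drop_size_cat // take_size_cat // !size_cat eqxx; lia. Qed.

Lemma nxt_cat l g r : nxt (l ++ asrc g ++ r) (size l, g) = l ++ atgt g ++ r.
Proof. by rewrite /nxt /= take_size_cat // addnC -drop_drop !drop_size_cat. Qed.

Lemma lay_cat l g r : lay (l ++ asrc g ++ r) (size l, g) = Tens (Id l) (Tens (itp g) (Id r)).
Proof. by rewrite /lay /= take_size_cat // addnC -drop_drop !drop_size_cat. Qed.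

Lemma ty_itp g : ty (itp g) = Some (asrc g, atgt g).
Proof. by rewrite itp_ty /asrc /atgt; case: nty. Qed.

Lemma ty_lay w x : okl w x -> ty (lay w x) = Some (w, nxt w x).
Proof. by case: x => p g /oklP[l [r [-> ->]]]; rewrite lay_cat nxt_cat /= ty_itp. Qed.

Lemma ty_ev w L : okd w L -> ty (ev w L) = Some (w, outd w L).
Proof.
elim: L w => [//|x L IH] w /andP[ok1 ok2].
exact: ty_Comp (IH _ ok2) (ty_lay ok1).
Qed.

Lemma okd_cat w A B : okd w (A ++ B) = okd w A && okd (outd w A) B.
Proof. by elim: A w => //= x A IH w; rewrite IH andbA. Qed.

Lemma outd_cat w A B : outd w (A ++ B) = outd (outd w A) B.
Proof. by elim: A w => /=. Qed.

Lemma ev_cat w A B : okd w (A ++ B) -> ev w (A ++ B) ~~~ Comp (ev (outd w A) B) (ev w A).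
Proof.
elim: A w => [|x A IH] w /=.
  by move=> ok; symmetry; apply: e_comp_idr (ty_ev ok).
move=> /andP[ok1 /[dup] ok /IH ->]; move: ok; rewrite okd_cat => /andP[ok2 ok3].
by symmetry; apply: tcompA (ty_lay ok1) (ty_ev ok2) (ty_ev ok3).
Qed.

Lemma pad_lay l v r x : okl v x ->
  [/\ okl (l ++ v ++ r) (size l + x.1, x.2)%N,
      nxt (l ++ v ++ r) (size l + x.1, x.2)%N = l ++ nxt v x ++ r &
      lay (l ++ v ++ r) (size l + x.1, x.2)%N ~~~ Tens (Id l) (Tens (lay v x) (Id r))].
Proof.
case: x => p g /oklP[l' [r' [-> ->]]] /=; rewrite lay_cat nxt_cat.
have -> : l ++ (l' ++ asrc g ++ r') ++ r = (l ++ l') ++ asrc g ++ (r' ++ r).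
  by rewrite !catA.
rewrite -size_cat okl_cat nxt_cat lay_cat; split=> //; first by rewrite !catA.
have wti f : wt (itp f) by apply: ty_wt (ty_itp _).
have wtT f g' : wt f -> wt g' -> wt (Tens f g').
  by move=> /wtE[? [? tf]] /wtE[? [? tg]]; apply: ty_wt (ty_Tens tf tg).
rewrite -(tens_id P l l') -(tens_id P r' r) !tensA //; repeat (first [exact: wti | done | apply: (@wtT)]).
Qed.

(** Tensoring with identities only shifts positions: strands to the right of a generator are never
    recorded. This is what makes a relation applicable inside a wider diagram. *)
Lemma pad_ev l v r L : okd v L ->
  [/\ okd (l ++ v ++ r) (shift (size l) L),
      outd (l ++ v ++ r) (shift (size l) L) = l ++ outd v L ++ r &
      ev (l ++ v ++ r) (shift (size l) L) ~~~ Tens (Id l) (Tens (ev v L) (Id r))].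
Proof.
elim: L v => [|x L IH] v /=; first by split=> //; rewrite !tens_id.
move=> /andP[ok1 ok2]; rewrite plusE.
have [o1 n1 l1] := pad_lay l r ok1; have [o2 n2 l2] := IH _ ok2.
rewrite n1 o1 o2 n2; split=> //; rewrite l1 l2.
have tv := ty_ev ok2; have tl := ty_lay ok1.
rewrite (tinterchange (a := l) (b := l) (c := l) (a' := v ++ r) (b' := nxt v x ++ r)
  (c' := outd (nxt v x) L ++ r)) //.
- rewrite (tinterchange (a := v) (b := nxt v x) (c := outd (nxt v x) L) (a' := r) (b' := r)
    (c' := r)) //.
  by rewrite !comp_id.
- by apply: ty_Tens tv _.
- by apply: ty_Tens tl _.
Qed.

(** Both composites are the tensor product of [g] and [h] with the idle strands in between, by
    [tens_lr] and [tens_rl]. *)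
Lemma swap_lay l g m h r :
  Comp (lay (l ++ atgt g ++ m ++ asrc h ++ r) (size (l ++ atgt g ++ m), h))
       (lay (l ++ asrc g ++ m ++ asrc h ++ r) (size l, g)) ~~~
  Comp (lay (l ++ asrc g ++ m ++ atgt h ++ r) (size l, g))
       (lay (l ++ asrc g ++ m ++ asrc h ++ r) (size (l ++ asrc g ++ m), h)).
Proof.
rewrite !lay_cat.
have assoc a b c d e : a ++ b ++ c ++ d ++ e = (a ++ b ++ c) ++ d ++ e :> word by rewrite !catA.
rewrite (assoc l (atgt g)) (assoc l (asrc g)) !lay_cat.
have wti f : wt (itp f) by apply: ty_wt (ty_itp _).
have wtT f g' : wt f -> wt g' -> wt (Tens f g').
  by move=> /wtE[? [? tf]] /wtE[? [? tg]]; apply: ty_wt (ty_Tens tf tg).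
rewrite -!tens_id.
set G := Tens (Id l) (itp g); set H := Tens (Id m) (Tens (itp h) (Id r)).
have tG : ty G = Some (l ++ asrc g, l ++ atgt g) by rewrite /= ty_itp.
have tH : ty H = Some (m ++ asrc h ++ r, m ++ atgt h ++ r) by rewrite /= ty_itp.
transitivity (Tens G H).
  rewrite -(tens_lr tG tH) -!tens_id /G /H.
  rewrite !tensA //; repeat (first [exact: wti | done | apply: (@wtT)]).
rewrite -(tens_rl tG tH) -!tens_id /G /H.
rewrite !tensA //; repeat (first [exact: wti | done | apply: (@wtT)]).
Qed.


Lemma D_cat w v w' A B : [&& okd w A, outd w A == v & okd v B] ->
  outd v B == w' -> D w w' (A ++ B) = cls w w' (Comp (val (D v w' B)) (val (D w v A))).
Proof.
move=> /and3P[okA /eqP oA okB] /eqP oB; have tA := ty_ev okA; have tB := ty_ev okB.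
rewrite oA in tA; rewrite oB in tB; rewrite diagram.unlock; apply: eq_cls.
by rewrite (val_cls tA) (val_cls tB) ev_cat ?oA // okd_cat okA oA.
Qed.

(** Lets layer [i+1] act before layer [i], when it acts to the right of it; its position is
    corrected by the strands that [g] creates or absorbs. In [swL] it acts to the left, and it is
    the position of [g] that changes. *)
Definition swR (i : nat) M := if drop i M is (p, g) :: (q, h) :: B then
  take i M ++ (Nat.add (Nat.sub q (size (atgt g))) (size (asrc g)), h) :: (p, g) :: B else M.
Definition swRc (i : nat) M := if drop i M is (p, g) :: (q, h) :: B then
  (p + size (atgt g) <= q)%N else true.
Definition swL (i : nat) M := if drop i M is (p, g) :: (q, h) :: B then
  take i M ++ (q, h) :: (Nat.add (Nat.sub p (size (asrc h))) (size (atgt h)), g) :: B else M.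
Definition swLc (i : nat) M := if drop i M is (p, g) :: (q, h) :: B then
  (q + size (asrc h) <= p)%N else true.

Lemma ev_subst w A L1 L2 B (v := outd w A) : okd w (A ++ L1 ++ B) ->
  okd v L2 -> outd v L2 = outd v L1 -> ev v L2 ~~~ ev v L1 ->
  [/\ okd w (A ++ L2 ++ B), outd w (A ++ L2 ++ B) = outd w (A ++ L1 ++ B) &
      ev w (A ++ L2 ++ B) ~~~ ev w (A ++ L1 ++ B)].
Proof.
move=> ok ok2 o12 e12; have /and3P[okA ok1 okB] : [&& okd w A, okd v L1 & okd (outd v L1) B].
  by move: ok; rewrite !okd_cat.
have ok' : okd w (A ++ L2 ++ B) by rewrite !okd_cat okA ok2 o12.
split; [exact: ok' | by rewrite !outd_cat -/v o12 |].
rewrite (ev_cat ok) (ev_cat ok') !ev_cat ?okd_cat ?ok2 ?ok1 -/v ?o12 //.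
by rewrite e12.
Qed.

Lemma swap_ev l g m h r (w := l ++ asrc g ++ m ++ asrc h ++ r)
    (L1 := [:: (size l, g); (size (l ++ atgt g ++ m), h)])
    (L2 := [:: (size (l ++ asrc g ++ m), h); (size l, g)]) :
  [/\ okd w L1, okd w L2, outd w L1 = outd w L2 & ev w L1 ~~~ ev w L2].
Proof.
have assoc a b c d e : a ++ b ++ c ++ d ++ e = (a ++ b ++ c) ++ d ++ e :> word by rewrite !catA.
have ok1 : okd w L1.
  by rewrite /= okl_cat nxt_cat assoc okl_cat.
have ok2 : okd w L2.
  by rewrite /= {1 2}/w assoc okl_cat nxt_cat -assoc okl_cat.
have n1 : nxt w (size l, g) = l ++ atgt g ++ m ++ asrc h ++ r by rewrite nxt_cat.
have n2 : nxt w (size (l ++ asrc g ++ m), h) = l ++ asrc g ++ m ++ atgt h ++ r.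
  by rewrite /w assoc nxt_cat -assoc.
have n12 : nxt (l ++ atgt g ++ m ++ asrc h ++ r) (size (l ++ atgt g ++ m), h) =
    l ++ atgt g ++ m ++ atgt h ++ r by rewrite assoc nxt_cat -assoc.
have n21 : nxt (l ++ asrc g ++ m ++ atgt h ++ r) (size l, g) =
    l ++ atgt g ++ m ++ atgt h ++ r by rewrite nxt_cat.
split=> //=; first by rewrite n1 n2 n12 n21.
move: ok1 ok2; rewrite /= n1 n2 n12 n21 !andbT => /andP[/ty_lay t1 /ty_lay t2] /andP[/ty_lay t3 /ty_lay t4].
rewrite n1 n2 n12 n21 in t1 t2 t3 t4.
rewrite (e_comp_idl _ t2) (e_comp_idl _ t4); apply: swap_lay.
Qed.

Lemma swR_ev w i M : okd w M -> swRc i M ->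
  [/\ okd w (swR i M), outd w (swR i M) = outd w M & ev w (swR i M) ~~~ ev w M].
Proof.
rewrite /swRc /swR => ok; move: (ok); rewrite -{1}[M](cat_take_drop i).
case e: (drop i M) => [|[p g] [|[q h] B]] //; rewrite okd_cat /= => /and4P[okA okg okh okB] le.
have eM : M = take i M ++ [:: (p, g); (q, h)] ++ B by rewrite -[LHS](cat_take_drop i) e.
have [l [r [ew ep]]] := oklP okg.
move: okh; rewrite ew ep nxt_cat => /oklP[l' [r' [e' eq]]].
move: e'; rewrite catA => /eq_cat_le[|]; first by rewrite size_cat -eq -ep.
rewrite -catA => el e2; rewrite e2 in ew.
set m := drop _ _ in e2 ew el.
have [] := swap_ev l g m h r'; rewrite -ew -el -ep -eq => o1 o2 o12 e12.
have <- : (size (l ++ asrc g ++ m) = Nat.add (Nat.sub q (size (atgt g))) (size (asrc g)))%N.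
  by rewrite plusE minusE eq el !size_cat; lia.
rewrite eM in ok; rewrite {3 5}eM.
apply: (ev_subst ok (L2 := [:: _; _])) => //; by symmetry.
Qed.

Lemma swL_ev w i M : okd w M -> swLc i M ->
  [/\ okd w (swL i M), outd w (swL i M) = outd w M & ev w (swL i M) ~~~ ev w M].
Proof.
rewrite /swLc /swL => ok; move: (ok); rewrite -{1}[M](cat_take_drop i).
case e: (drop i M) => [|[p g] [|[q h] B]] //; rewrite okd_cat /= => /and4P[okA okg okh okB] le.
have eM : M = take i M ++ [:: (p, g); (q, h)] ++ B by rewrite -[LHS](cat_take_drop i) e.
have [l [r [ew ep]]] := oklP okg.
move: okh; rewrite ew ep nxt_cat => /oklP[l' [r' [e' eq]]].
move: e'; rewrite [RHS]catA => /esym/eq_cat_le[|]; first by rewrite size_cat -eq -ep.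
rewrite -catA => el e2.
set m := drop _ _ in e2 el.
have ew' : outd w (take i M) = l' ++ asrc h ++ m ++ asrc g ++ r by rewrite ew [in LHS]el -!catA.
have [] := swap_ev l' h m g r; rewrite -ew' -el -ep -eq => o1 o2 o12 e12.
have <- : (size (l' ++ atgt h ++ m) = Nat.add (Nat.sub p (size (asrc h))) (size (atgt h)))%N.
  by rewrite plusE minusE ep el !size_cat; lia.
rewrite eM in ok; rewrite {3 5}eM.
by apply: (ev_subst ok (L2 := [:: _; _])).
Qed.

Lemma D_swR i w w' M : okd w M && swRc i M -> D w w' M = D w w' (swR i M).
Proof. by move=> /andP[ok c]; have [_ _ e] := swR_ev ok c; rewrite diagram.unlock (eq_cls _ _ e). Qed.

Lemma D_swL i w w' M : okd w M && swLc i M -> D w w' M = D w w' (swL i M).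
Proof. by move=> /andP[ok c]; have [_ _ e] := swL_ev ok c; rewrite diagram.unlock (eq_cls _ _ e). Qed.

(** * Linear contexts and rewriting inside a diagram *)

Section Context.
Variables (w w' : word) (A : seq (nat * N)) (p : nat) (v v' : word) (B : seq (nat * N)).
Let l := take p (outd w A).
Let r := drop (p + size v) (outd w A).
Definition ctx_ok := [&& okd w A, (p <= size (outd w A))%N, outd w A == l ++ v ++ r,
  okd (l ++ v' ++ r) B & outd (l ++ v' ++ r) B == w'].
(** The value 0 outside the well-formed case makes [ctx] linear unconditionally, so that linearity
    can be rewritten with freely. *)
Definition ctx (h : mor v v') : mor w w' := if ctx_ok then
  cls w w' (Comp (ev (l ++ v' ++ r) B) (Comp (Tens (Id l) (Tens (val h) (Id r))) (ev w A)))
  else 0.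

Let T3 f : T := Comp (ev (l ++ v' ++ r) B) (Comp (Tens (Id l) (Tens f (Id r))) (ev w A)).
Let ty_T3 f : ctx_ok -> ty f = Some (v, v') -> ty (T3 f) = Some (w, w').
Proof.
move=> /and5P[ok1 _ /eqP o1 ok2 /eqP o2] tf.
apply: ty_Comp (ty_Comp _ (ty_ev ok1)); first by rewrite (ty_ev ok2) o2.
by rewrite /= tf o1.
Qed.

Fact ctx_linear : linear ctx.
Proof.
move=> a g h; rewrite /ctx; case: ifP => [ok|_]; last by rewrite scaler0 addr0.
have tg := ty_val g; have th := ty_val h.
have tag : ty (Scal a (val g)) = Some (v, v') by [].
have e := val_lin a g h.
rewrite -/(T3 _) -/(T3 (val h)) -/(T3 (val g)) -clsZ ?ty_T3 // -clsD ?ty_T3 //; last first.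
  exact: (ty_T3 ok tg).
apply: eq_cls; rewrite {1}/T3 e.
have /and5P[ok1 _ /eqP o1 ok2 /eqP o2] := ok.
have t1 := ty_ev ok1; rewrite o1 in t1; have t2 := ty_ev ok2; rewrite o2 in t2.
have tA : ty (Add (Scal a (val g)) (val h)) = Some (v, v') by apply: ty_Add.
rewrite e_tensDl; last by rewrite /Defs.wt (ty_Tens tA (erefl : ty (Id r) = Some (r, r))).
rewrite e_tensDr; last first.
  by rewrite /Defs.wt /= tg th /= !eqxx.
rewrite e_compDl; last by rewrite /Defs.wt /= t1 tg th /= ?eqxx /= ?eqxx /= ?eqxx.
rewrite e_compDr; last by rewrite /Defs.wt /= t1 t2 tg th /= ?eqxx /= ?eqxx /= ?eqxx.
apply: e_add; last exact: peqvv.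
rewrite e_tensZl; last by rewrite /Defs.wt /= tg.
rewrite e_tensZr; last by rewrite /Defs.wt /= tg.
rewrite e_compZl; last by rewrite /Defs.wt /= t1 tg /= !eqxx.
by apply: e_compZr; rewrite /Defs.wt /= t1 t2 tg /= ?eqxx /= ?eqxx /= ?eqxx.
Qed.
HB.instance Definition _ := GRing.isLinear.Build R (mor v v') (mor w w') _ ctx ctx_linear.

Lemma ctx_add g h : ctx (g + h) = ctx g + ctx h. Proof. exact: linearD. Qed.
Lemma ctx_sub g h : ctx (g - h) = ctx g - ctx h. Proof. exact: linearB. Qed.
Lemma ctx_opp g : ctx (- g) = - ctx g. Proof. exact: linearN. Qed.
Lemma ctx_scale x g : ctx (x *: g) = x *: ctx g. Proof. exact: linearZ. Qed.
Lemma ctx_0 : ctx 0 = 0. Proof. exact: linear0. Qed.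
Lemma ctx_sum I (rI : seq I) (Q : pred I) F :
  ctx (\sum_(i <- rI | Q i) F i) = \sum_(i <- rI | Q i) ctx (F i).
Proof. exact: linear_sum. Qed.

Lemma ctxE L : [&& ctx_ok, okd v L & outd v L == v'] ->
  ctx (D v v' L) = D w w' (A ++ shift p L ++ B).
Proof.
move=> /and3P[/[dup] ok /and5P[ok1 pl /eqP o1 ok2 /eqP o2] ok3 /eqP o3].
rewrite /ctx ok diagram.unlock; apply: eq_cls.
have tL : ty (ev v L) = Some (v, v') by rewrite (ty_ev ok3) o3.
have [ok4 o4 e4] := pad_ev l r ok3.
have sl : size l = p by rewrite size_takel.
rewrite sl -o1 o3 in ok4 o4 e4.
rewrite (val_cls tL) ev_cat; last by rewrite !okd_cat ok1 ok4 o4.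
rewrite ev_cat; last by rewrite okd_cat ok4 o4.
rewrite o4 e4; apply: tcompA (ty_ev ok1) _ (ty_ev ok2).
by rewrite /= tL o1.
Qed.
End Context.

Definition unshift n (L : seq (nat * N)) := [seq (Nat.sub x.1 n, x.2) | x <- L].

(** Exhibits a diagram as a linear context around [n] of its layers; needed for local relations with
    several terms, such as the dot relation. For relations between two single diagrams [D_rw] is
    enough. *)
Lemma D_at i n p v v' w w' M (A := take i M) (B := drop (Nat.add i n) M)
    (C := take n (drop i M)) (L := unshift p C) :
  [&& all (fun x => p <= x.1)%N C, ctx_ok w w' A p v v' B, okd v L & outd v L == v'] ->
  D w w' M = ctx w w' A p B (D v v' L).
Proof.
move=> /andP[ge ok]; rewrite ctxE //; congr D.
have -> : shift p L = C.
  rewrite /shift /L /unshift -map_comp; elim: (C) ge => //= -[q g] C' IH /andP[pq /IH ->].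
  by rewrite plusE minusE /= subnKC.
by rewrite /A /B /C plusE addnC -drop_drop !cat_take_drop.
Qed.

Lemma D_rw v v' L1 L2 (E : D v v' L1 = D v v' L2) i p w w' M (n := size L1)
    (A := take i M) (B := drop (Nat.add i n) M) :
  [&& ctx_ok w w' A p v v' B, okd v L1, outd v L1 == v', okd v L2 & outd v L2 == v'] ->
  M = A ++ shift p L1 ++ B ->
  D w w' M = D w w' (A ++ shift p L2 ++ B).
Proof.
move=> /and5P[ok o1 o2 o3 o4] ->.
by rewrite -(@ctxE _ _ _ _ v v') ?ok ?o1 // E ctxE ?ok ?o3.
Qed.

End Diagram.

(** * Determinants of Hessenberg-Toeplitz matrices *)

Section HessenbergToeplitz.
Variable K : comPzRingType.
Variable h : nat -> K.
Hypothesis h0 : h 0 = -1.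

(* [h] lists the diagonals from the superdiagonal downwards. *)
Definition toeplitz q : 'M[K]_q := \matrix_(i, j) if (j <= i.+1)%N then h (i.+1 - j) else 0.
(** With the first column left free, the shape is reproduced when the matrix is expanded along its
    first row, so the induction closes. *)
Let bordered q (u : nat -> K) : 'M[K]_q.+1 :=
  \matrix_(i, j) if j == 0 :> nat then u i else
    if (j <= i.+1)%N then h (i.+1 - j) else 0.

Let det_bordered q u : \det (bordered q u) = \sum_(i < q.+1) u i * \det (toeplitz (q - i)).
Proof.
elim: q u => [|q IH] u.
  by rewrite big_ord1 det_mx11 mxE /= subn0 det_mx00 mulr1.
rewrite (expand_det_row _ ord0) big_ord_recl big_ord_recl big1 ?addr0; last first.
  by move=> i _; rewrite mxE /= /bump /= ?add1n ?ltnS /= mul0r.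
rewrite [RHS]big_ord_recl; congr (_ + _).
  rewrite mxE /= subn0; congr (_ * _).
  rewrite /cofactor expr0 mul1r; congr (\det _); apply/matrixP => i j.
  by rewrite !mxE /= /bump /= ?add1n ltnS subSS.
(* The entry [h 0 = -1] cancels the sign of the cofactor. *)
rewrite mxE /= subnn h0 /cofactor /= expr1 !mulN1r opprK.
have -> : row' ord0 (col' (lift ord0 ord0) (bordered q.+1 u)) = bordered q (u \o S).
  by apply/matrixP => i [[|j] lj]; rewrite !mxE.
exact: IH.
Qed.

Lemma det_toeplitz q :
  \det (toeplitz q.+1) = \sum_(i < q.+1) h i.+1 * \det (toeplitz (q - i)).
Proof.
rewrite -(det_bordered q (h \o S)); congr (\det _); by apply/matrixP => i [[|j] lj]; rewrite !mxE.
Qed.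

(** In terms of generating series: the series of [h] times the series of the determinants is -1. *)
Lemma det_toeplitz_conv q :
  \sum_(i < q.+1) h i * \det (toeplitz (q - i)) = - (q == 0)%:R.
Proof.
rewrite big_ord_recl h0 subn0 mulN1r.
case: q => [|q]; first by rewrite big_ord0 det_mx00 addr0.
by rewrite det_toeplitz oppr0 addNr.
Qed.
End HessenbergToeplitz.

(** * The commutative ring of endomorphisms of the unit *)

Section ScalarRing.
Variables (R : comPzRingType) (P : presentation R).
Local Notation T := (tm R (gen P)).
Local Notation ty := (@Defs.ty R (gen P) (@gen_ty R P)).
Local Notation "f ~~~ g" := (peqv f g) (at level 70).

(** A separate name, to carry a product besides the module structure common to all Hom spaces. *)
Definition bubbles := mor P w1 w1.
HB.instance Definition _ := GRing.Lmodule.on bubbles.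
Local Notation cls11 := (@cls R P w1 w1).

Definition mulb (f g : bubbles) : bubbles := cls11 (Comp (val f) (val g)).
Definition oneb : bubbles := cls11 (Id w1).

(** The Eckmann-Hilton argument: both composites equal the tensor product. *)
Lemma scalar_comp_comm (f g : T) : ty f = Some (w1, w1) -> ty g = Some (w1, w1) ->
  Comp f g ~~~ Comp g f.
Proof.
move=> tf tg; have e := tens_rl tf tg; rewrite -(tens_lr tf tg) in e.
have [wf wg] := (ty_wt tf, ty_wt tg).
have el h : wt (@gen_ty R P) h -> Tens (Id w1) h ~~~ h by apply: e_tens_idl.
have er h : wt (@gen_ty R P) h -> Tens h (Id w1) ~~~ h by apply: e_tens_idr.
by rewrite !el // !er // in e.
Qed.

Let tyc (f g : T) : ty f = Some (w1, w1) -> ty g = Some (w1, w1) ->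
  ty (Comp f g) = Some (w1, w1).
Proof. by move=> tf tg; apply: ty_Comp tf tg. Qed.

Lemma cls_comp (f g : T) : ty f = Some (w1, w1) -> ty g = Some (w1, w1) ->
  cls11 (Comp f g) = mulb (cls11 f) (cls11 g).
Proof. by move=> tf tg; apply: eq_cls; rewrite !val_cls. Qed.

Fact mulbA : associative mulb.
Proof.
move=> f g h; have [[tf tg] th] := (ty_val f, ty_val g, ty_val h).
rewrite -[f]cls_val -[g]cls_val -[h]cls_val -!cls_comp ?tyc //.
by apply: eq_cls; apply: tcompA th tg tf.
Qed.
Fact mulbC : commutative mulb.
Proof. by move=> f g; apply: eq_cls; apply: scalar_comp_comm; apply: ty_val. Qed.
Fact mul1b : left_id oneb mulb.
Proof.
move=> f; rewrite -[f]cls_val -cls_comp ?ty_val //; apply: eq_cls.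
by apply: e_comp_idl; apply: ty_val.
Qed.
Fact mulbDl : left_distributive mulb +%R.
Proof.
move=> f g h; have [[tf tg] th] := (ty_val f, ty_val g, ty_val h).
have tfg : ty (Add (val f) (val g)) = Some (w1, w1) by apply: ty_Add.
rewrite -{1}[f]cls_val -{1}[g]cls_val -{1}[h]cls_val -clsD // -cls_comp // -clsD ?tyc //.
by apply: eq_cls; apply: e_compDl; rewrite /wt /= tf tg th.
Qed.
HB.instance Definition _ :=
  GRing.Zmodule_isComPzRing.Build bubbles mulbA mulbC mul1b mulbDl.

Lemma cls_tprod (l : seq T) : all (fun f => ty f == Some (w1, w1)) l ->
  ty (tprod l) = Some (w1, w1) /\ cls11 (tprod l) = \prod_(f <- l) (cls11 f : bubbles).
Proof.
elim: l => [|f l IH] /=; first by rewrite big_nil.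
move=> /andP[/eqP tf /IH[tl cl]]; rewrite tf tl; split=> //.
by rewrite big_cons -cl cls_comp.
Qed.

Lemma cls_tdet q (M : 'I_q -> 'I_q -> T) : (forall i j, ty (M i j) = Some (w1, w1)) ->
  ty (tdet M) = Some (w1, w1) /\
  cls11 (tdet M) = \det (\matrix_(i, j) (cls11 (M i j) : bubbles)).
Proof.
move=> tM; rewrite /tdet.
have tp sg : all (fun f => ty f == Some (w1, w1)) [seq M i (fun_of_perm sg i) | i : 'I_q].
  by apply/allP => f /mapP[i _ ->]; apply/eqP.
have ta : all (fun f => ty f == Some (w1, w1))
   [seq Scal ((-1) ^+ odd_perm sg) (tprod [seq M i (fun_of_perm sg i) | i : 'I_q]) | sg : {perm 'I_q}].
  by apply/allP => f /mapP[sg _ ->] /=; rewrite (cls_tprod (tp sg)).1.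
split; first exact: ty_tsum.
rewrite cls_tsum // big_map big_enum /=; apply: eq_bigr => sg _.
have [t1 _] := cls_tprod (tp sg); rewrite clsZ //.
have -> : cls11 (tprod [seq M i (fun_of_perm sg i) | i : 'I_q]) =
  \prod_i (\matrix_(i, j) (cls11 (M i j) : bubbles)) i (fun_of_perm sg i).
  rewrite (cls_tprod (tp sg)).2 big_map big_enum /=.
  by apply: eq_bigr => i _; rewrite mxE.
by case: (odd_perm sg); rewrite ?expr1 ?expr0 ?scaleN1r ?scale1r ?mulN1r ?mul1r.
Qed.

Lemma ty_iter_Comp (x : T) a n : ty x = Some (a, a) -> ty (iter n (Comp x) (Id a)) = Some (a, a).
Proof. by move=> tx; elim: n => //= n ->; rewrite tx eqxx. Qed.

End ScalarRing.

(** * Terms that are scalar multiples of a single diagram *)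

Section Representation.
Variables (R : comPzRingType) (P : presentation R).
Local Notation T := (tm R (gen P)).
Local Notation ty := (@Defs.ty R (gen P) (@gen_ty R P)).
Local Notation wt := (@Defs.wt R (gen P) (@gen_ty R P)).
Local Notation "f ~~~ g" := (peqv f g) (at level 70).
Variables (N : Type) (nty : N -> word * word) (itp : N -> T).
Hypothesis itp_ty : forall g, ty (itp g) = Some (nty g).
Local Notation D := (@diagram R P N nty itp).
Local Notation okd := (okd nty).
Local Notation outd := (outd nty).
Local Notation ev := (ev nty itp).

(** The scalar [r] records signs: those of the dot relation and those introduced by the duality. *)
Definition rep (f : T) (a b : word) (r : R) (L : seq (nat * N)) :=
  [/\ okd a L, outd a L = b & f ~~~ Scal r (ev a L)].

Lemma rep_ty f a b r L : rep f a b r L -> ty f = Some (a, b).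
Proof. by move=> [ok o e]; rewrite (peqv_ty e) /= (ty_ev itp_ty ok) o. Qed.

Lemma rep_cls f a b r L : rep f a b r L -> cls a b f = r *: D a b L.
Proof.
by move=> [ok o e]; rewrite (eq_cls _ _ e) diagram.unlock clsZ // (ty_ev itp_ty ok) o.
Qed.

Lemma rep_rel f g a b r L r' L' : rep f a b r L -> rep g a b r' L' ->
  f ~~~ g -> r *: D a b L = r' *: D a b L'.
Proof. by move=> /rep_cls<- /rep_cls<- /eq_cls->. Qed.

Lemma rep_eqv f g a b r L r' L' : rep f a b r L -> rep g a b r' L' ->
  r *: D a b L = r' *: D a b L' -> f ~~~ g.
Proof.
move=> hf hg; rewrite -(rep_cls hf) -(rep_cls hg); apply: cls_inj.
  exact: rep_ty hf.
exact: rep_ty hg.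
Qed.

Lemma rep_eq f a b r L a' b' r' L' : rep f a b r L ->
  a = a' -> b = b' -> r = r' -> L = L' -> rep f a' b' r' L'.
Proof. by move=> h <- <- <- <-. Qed.

Lemma rep_peqv f g a b r L : rep g a b r L -> f ~~~ g -> rep f a b r L.
Proof. by move=> [ok o e] fg; split=> //; rewrite fg. Qed.

Let wt_ev a L : okd a L -> wt (ev a L).
Proof. by move=> ok; apply: ty_wt (ty_ev itp_ty ok). Qed.

Lemma rep_atom g : rep (itp g) (nty g).1 (nty g).2 1 [:: (0%N, g)].
Proof.
have ok : okd (nty g).1 [:: (0%N, g)].
  by rewrite /= /okl /= add0n leqnn drop0 /asrc take_size eqxx.
have o : outd (nty g).1 [:: (0%N, g)] = (nty g).2.
  by rewrite /= /nxt /= take0 add0n /asrc drop_size cats0.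
have tg : ty (itp g) = Some ((nty g).1, (nty g).2) by rewrite itp_ty; case: nty.
split=> //; rewrite scal1 ?wt_ev //= /nxt /lay /= take0 add0n /asrc drop_size.
rewrite tens_idl; last exact: ty_wt (ty_Tens tg _).
rewrite tens_idr ?(ty_wt tg) // /atgt cats0 /=.
by symmetry; apply: comp_idl tg.
Qed.

Lemma rep_id w : rep (Id w) w w 1 [::].
Proof. by split=> //=; rewrite scal1. Qed.

Lemma rep_scal s f a b r L : rep f a b r L -> rep (Scal s f) a b (s * r) L.
Proof.
move=> [ok o e]; split=> //; rewrite e.
by apply: e_scalM; apply: wt_ev.
Qed.

Lemma rep_comp f g a b c r L r' L' : rep f b c r L -> rep g a b r' L' ->
  rep (Comp f g) a c (r * r') (L' ++ L).
Proof.
move=> [ok o e] [ok' o' e'].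
have oc : okd a (L' ++ L) by rewrite okd_cat ok' o'.
split; rewrite ?outd_cat ?o' // e e'.
have t := ty_ev itp_ty ok; have t' := ty_ev itp_ty ok'; rewrite o' in t'.
transitivity (Scal r (Scal r' (Comp (ev b L) (ev a L')))).
  transitivity (Scal r (Comp (ev b L) (Scal r' (ev a L')))).
    by apply: e_compZl; rewrite /Defs.wt /= t t' eqxx.
  by apply: e_scal; apply: e_compZr; rewrite /Defs.wt /= t t' eqxx.
rewrite (ev_cat itp_ty oc) o'.
by apply: e_scalM; rewrite /Defs.wt /= t t' eqxx.
Qed.

Lemma rep_comp_eq f g a b b' c r L r' L' : rep f b c r L -> rep g a b' r' L' -> b = b' ->
  rep (Comp f g) a c (r * r') (L' ++ L).
Proof. by move=> hf hg e; move: hf; rewrite e => hf; apply: rep_comp hf hg. Qed.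

Lemma rep_tens f g a b c d r L r' L' : rep f a b r L -> rep g c d r' L' ->
  rep (Tens f g) (a ++ c) (b ++ d) (r * r') (L ++ shift (size b) L').
Proof.
move=> [ok o e] [ok' o' e'].
have [] := pad_ev itp_ty [::] c ok; rewrite /= o => ok1 o1 e1.
have [] := pad_ev itp_ty b [::] ok'; rewrite !cats0 o' => ok2 o2 e2.
have sh0 M : shift 0 M = M :> seq (nat * N) by elim: M => //= -[p x] M ->.
rewrite sh0 in ok1 o1 e1.
have ocat : okd (a ++ c) (L ++ shift (size b) L') by rewrite okd_cat ok1 o1.
split=> //; first by rewrite outd_cat o1.
have t := ty_ev itp_ty ok; have t' := ty_ev itp_ty ok'; rewrite o in t; rewrite o' in t'.
rewrite e e' (ev_cat itp_ty ocat) o1 e1 e2.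
rewrite (tens_idl (ty_wt (ty_Tens t (erefl : ty (Id c) = _)))).
rewrite (tens_idr (ty_wt t')) (tens_lr t t').
transitivity (Scal r (Scal r' (Tens (ev a L) (ev c L')))).
  transitivity (Scal r (Tens (ev a L) (Scal r' (ev c L')))).
    by apply: e_tensZl; rewrite /Defs.wt /= t t'.
  by apply: e_scal; apply: e_tensZr; rewrite /Defs.wt /= t t'.
by apply: e_scalM; rewrite /Defs.wt /= t t'.
Qed.

End Representation.

(** [aX r] is the whole power [x^r], and [aT], [aT'] are the composites [t], [t'], so that lists of
    layers have concrete length even for symbolic [r]. [aA] and [aB r] name the entries of an
    inverse, [aZ m] the left bubble of index [-m-2]. *)
Inductive atom := aX of nat | aS | aC | aD | aT | aC' | aD' | aT' | aA | aB of nat | aZ of nat.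
Definition aty (g : atom) : word * word :=
  match g with
  | aX _ => (up, up) | aS => (uu, uu) | aC => (w1, du) | aD => (ud, w1)
  | aT => (ud, du) | aC' => (w1, ud) | aD' => (du, w1) | aT' | aA => (du, ud)
  | aB _ => (w1, ud) | aZ _ => (w1, w1)
  end.

(** The entries [b] are indexed by all naturals and constrained below [n], so that one statement
    covers both the adjoined generators and the sums [btilde]. *)
Definition is_inverse (R : comPzRingType) (P : presentation R) (n : nat)
    (x s c d a : tm R (gen P)) (b : nat -> tm R (gen P)) : Prop :=
  let t := tcr s c d in let dr r := Comp d (Tens (xpow x r) (Id dn)) in
  [/\ peqv (Add (Comp a t) (tsum ud ud [seq Comp (b r) (dr r) | r : 'I_n])) (Id ud),
      peqv (Comp t a) (Id du),
      forall r, (r < n)%N -> peqv (Comp t (b r)) (Zero w1 du),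
      forall r, (r < n)%N -> peqv (Comp (dr r) a) (Zero du w1) &
      forall r r', (r < n)%N -> (r' < n)%N ->
        peqv (Comp (dr r) (b r')) (if r == r' then Id w1 else Zero w1 w1)].

(* Minus the factor of [d x^r] in the right-hand side of (P1). *)
Definition btilde (R : comPzRingType) (G : Type) (n : nat) (x c d c' d' : tm R G) (r : nat) : tm R G :=
  Scal (-1) (tsum w1 ud [seq Tens (Comp (Tens (xpow x i) (Id dn)) c')
    (bubLZ (Posz n) x c d c' d' (- i%:Z - r%:Z - 2)) | i <- iota 0 n.+1]).

Lemma sum_iota (V : nmodType) n (F : nat -> V) : \sum_(i <- iota 0 n) F i = \sum_(i < n) F i.
Proof. by rewrite -[in LHS](subn0 n) -/(index_iota 0 n) big_mkord. Qed.

(** * Diagram calculus for nonnegative charge, over any presentation satisfying (H) and (A) *)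

Section Core.
Variables (R : comPzRingType) (P : presentation R).
Local Notation T := (tm R (gen P)).
Local Notation ty := (@Defs.ty R (gen P) (@gen_ty R P)).
Local Notation "f ~~~ g" := (peqv f g) (at level 70).
Variables (x s c d c' d' a : T) (b z : nat -> T).
Hypotheses (tx : ty x = Some (up, up)) (ts : ty s = Some (uu, uu))
  (tc : ty c = Some (w1, du)) (td : ty d = Some (ud, w1))
  (tc' : ty c' = Some (w1, ud)) (td' : ty d' = Some (du, w1))
  (ta : ty a = Some (du, ud)) (tb : forall r, ty (b r) = Some (w1, ud))
  (tz : forall r, ty (z r) = Some (w1, w1)).

Definition interp (g : atom) : T :=
  match g with
  | aX r => xpow x r | aS => s | aC => c | aD => d | aT => tcr s c d
  | aC' => c' | aD' => d' | aT' => tcr' s c' d' | aA => a | aB r => b r | aZ r => z r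
  end.

Lemma interp_ty g : ty (interp g) = Some (aty g).
Proof.
case: g => //= [r||]; first exact: (ty_iter_Comp r tx).
- by rewrite td ts tc.
- by rewrite td' ts tc'.
Qed.

Local Notation D := (@diagram R P atom aty interp).
Local Notation rep := (rep aty interp).

Let rx r : rep (xpow x r) up up 1 [:: (0%N, aX r)] := rep_atom interp_ty (aX r).
Let rs : rep s uu uu 1 [:: (0%N, aS)] := rep_atom interp_ty aS.
Let rc : rep c w1 du 1 [:: (0%N, aC)] := rep_atom interp_ty aC.
Let rd : rep d ud w1 1 [:: (0%N, aD)] := rep_atom interp_ty aD.
Let rt : rep (tcr s c d) ud du 1 [:: (0%N, aT)] := rep_atom interp_ty aT.
Let rc' : rep c' w1 ud 1 [:: (0%N, aC')] := rep_atom interp_ty aC'.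
Let rd' : rep d' du w1 1 [:: (0%N, aD')] := rep_atom interp_ty aD'.
Let rt' : rep (tcr' s c' d') du ud 1 [:: (0%N, aT')] := rep_atom interp_ty aT'.
Let ra : rep a du ud 1 [:: (0%N, aA)] := rep_atom interp_ty aA.
Let rb r : rep (b r) w1 ud 1 [:: (0%N, aB r)] := rep_atom interp_ty (aB r).
Let rz r : rep (z r) w1 w1 1 [:: (0%N, aZ r)] := rep_atom interp_ty (aZ r).
Let rx1 : rep x up up 1 [:: (0%N, aX 1)].
Proof.
apply: rep_peqv (rx 1) _; symmetry; apply: comp_idr tx.
Qed.

Ltac prep := lazymatch goal with
  | |- rep (Comp _ _) _ _ _ _ => eapply (rep_comp_eq interp_ty); [prep | prep | reflexivity]
  | |- rep (Tens _ _) _ _ _ _ => eapply (rep_tens interp_ty); prep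
  | |- rep (Id _) _ _ _ _ => eapply rep_id
  | |- rep (Scal _ _) _ _ _ _ => eapply (rep_scal interp_ty); prep
  | |- _ => first [apply: rx | apply: rs | apply: rc | apply: rd | apply: rc' | apply: rd'
      | apply: rx1 | apply: ra | apply: rb | apply: rz]
  end.
Ltac represent := eapply rep_eq; [prep | reflexivity | reflexivity | rewrite ?mulr1; reflexivity | reflexivity].

Hypothesis HA : forall u v, HA_rel x s c d u v -> u ~~~ v.

Let repE f g v w r L r' L' : f ~~~ g -> rep f v w r L -> rep g v w r' L' ->
  r = 1 -> r' = 1 -> D v w L = D v w L'.
Proof. by move=> fg hf hg er er'; have := rep_rel interp_ty hf hg fg; rewrite er er' !scale1r. Qed.

Let defT : D ud du [:: (0%N, aT)] = D ud du [:: (0%N, aC); (1%N, aS); (2%N, aD)].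
Proof.
by apply: (repE (peqvv (tcr s c d))); [exact: rt | rewrite /tcr; represent | done | done].
Qed.
Let defT' : D du ud [:: (0%N, aT')] = D du ud [:: (2%N, aC'); (1%N, aS); (0%N, aD')].
Proof. by apply: (repE (peqvv (tcr' s c' d'))); [exact: rt' | rewrite /tcr'; represent | done | done]. Qed.
Let ss1 : D uu uu [:: (0%N, aS); (0%N, aS)] = D uu uu [::].
Proof. by apply: (repE (HA (hH1 _ _ _ _))); [represent | represent | done | done]. Qed.
Let braid : D [:: true; true; true] [:: true; true; true] [:: (0%N, aS); (1%N, aS); (0%N, aS)] =
  D [:: true; true; true] [:: true; true; true] [:: (1%N, aS); (0%N, aS); (1%N, aS)].
Proof. by apply: (repE (HA (hH2 _ _ _ _))); [represent | represent | done | done]. Qed.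
Let zigzagR : D up up [:: (1%N, aC); (0%N, aD)] = D up up [::].
Proof. by apply: (repE (HA (hA1 _ _ _ _))); [represent | represent | done | done]. Qed.
Let zigzagL : D dn dn [:: (0%N, aC); (1%N, aD)] = D dn dn [::].
Proof. by apply: (repE (HA (hA2 _ _ _ _))); [represent | represent | done | done]. Qed.
Let dotS : D uu uu [:: (1%N, aX 1); (0%N, aS)] = D uu uu [:: (0%N, aS); (0%N, aX 1)] - D uu uu [::].
Proof.
have r1 : rep (Comp (Tens x (Id up)) s) uu uu 1 [:: (0%N, aS); (0%N, aX 1)] by represent.
have r2 : rep (Scal (-1) (Comp s (Tens (Id up) x))) uu uu (-1) [:: (1%N, aX 1); (0%N, aS)]
  by represent.
have := eq_cls uu uu (HA (hH3 _ _ _ _)).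
rewrite clsD ?(rep_ty interp_ty r1) ?(rep_ty interp_ty r2) // (rep_cls interp_ty r1).
rewrite (rep_cls interp_ty r2) (rep_cls interp_ty (rep_id _ _ uu)) !scale1r scaleN1r => <-.
by rewrite opprD opprK addrA subrr add0r.
Qed.

(** Below, [i] is the index of the first layer concerned and [p] the number of strands to its left.
    [rl] and [rr] apply a relation between two diagrams; [sL] and [sR] exchange layers [i] and
    [i+1]; [at_] isolates [n] layers as a subdiagram from [v] to [v'], and [lin] distributes the
    surrounding context over a linear combination. [rr], [rsL] and [rsR] act on the right-hand side
    of the goal. *)
Ltac side := [> simpl | by [] ..].
Ltac rl E i p := rewrite (D_rw interp_ty E (i := i) (p := p)); side.
Ltac rr E i p := rewrite [in RHS](D_rw interp_ty E (i := i) (p := p)); side.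
Ltac sL i := rewrite (D_swL interp_ty (i := i)); side.
Ltac sR i := rewrite (D_swR interp_ty (i := i)); side.
Ltac rsL i := rewrite [in RHS](D_swL interp_ty (i := i)); side.
Ltac rsR i := rewrite [in RHS](D_swR interp_ty (i := i)); side.
Ltac at_ i n p v v' :=
  rewrite (D_at interp_ty (i := i) (n := n) (p := p) (v := v) (v' := v')); side.
Ltac lin := rewrite ?(ctx_sub interp_ty, ctx_add interp_ty, ctx_opp interp_ty, ctx_scale interp_ty, ctx_0 interp_ty);
  rewrite ?(ctxE interp_ty); side.
Local Notation u3 := [:: true; true; true].
Local Notation uud := [:: true; true; false].

(** The dot relation conjugated by [s]: insert [s s = 1] at the source and pass the dot through the
    crossing next to it. *)
Let dotS' : D uu uu [:: (0%N, aX 1); (0%N, aS)] = D uu uu [:: (0%N, aS); (1%N, aX 1)] + D uu uu [::].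
Proof.
have e : D uu uu [:: (0%N, aX 1); (0%N, aS)] =
  D uu uu [:: (0%N, aS); (0%N, aS); (0%N, aX 1); (0%N, aS)] by rr ss1 0%N 0%N.
have e2 : D uu uu [:: (0%N, aS); (0%N, aX 1)] = D uu uu [:: (1%N, aX 1); (0%N, aS)] + D uu uu [::].
  by rewrite dotS subrK.
rewrite e; at_ 1%N 2%N 0%N uu uu; rewrite e2; lin.
by congr (_ + _); [rl ss1 2%N 0%N | rl ss1 0%N 0%N].
Qed.

Let dotT : D ud du [:: (0%N, aX 1); (0%N, aT)] = D ud du [:: (0%N, aT); (1%N, aX 1)]
  - D ud du [:: (0%N, aD); (0%N, aC)].
Proof.
rl defT 1%N 0%N; sL 0%N; at_ 1%N 2%N 1%N uu uu; rewrite dotS; lin.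
sR 2%N; rr defT 0%N 0%N; congr (_ - _); by sR 0%N.
Qed.

(** [t] is [s] rotated by the adjunction, and a cap on the left undoes the rotation; [cupT] is the
    same on the other side. *)
Let capT : D uud up [:: (1%N, aT); (0%N, aD)] = D uud up [:: (0%N, aS); (1%N, aD)].
Proof.
rl defT 0%N 1%N; sL 2%N; sL 1%N; by rl zigzagR 0%N 0%N.
Qed.

Let cupT : D up [:: false; true; true] [:: (1%N, aC); (0%N, aT)] =
  D up [:: false; true; true] [:: (0%N, aC); (1%N, aS)].
Proof.
rl defT 1%N 0%N; sL 0%N; sL 1%N; by rl zigzagR 2%N 2%N.
Qed.

Let braidT : D uud [:: false; true; true] [:: (0%N, aS); (1%N, aT); (0%N, aT)] =
  D uud [:: false; true; true] [:: (1%N, aT); (0%N, aT); (1%N, aS)].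
Proof.
(* Two consecutive [t] share their downward strand, so a single cup and a single cap suffice and the
   braid relation for [s] becomes visible. *)
have e : D uud [:: false; true; true] [:: (1%N, aT); (0%N, aT)] =
  D uud [:: false; true; true] [:: (0%N, aC); (1%N, aS); (2%N, aS); (3%N, aD)].
  rl defT 0%N 1%N; sL 2%N; sL 1%N; by rl cupT 0%N 0%N.
rl e 1%N 0%N; rr e 0%N 0%N; sL 0%N.
rl (esym braid) 1%N 1%N.
by rsL 3%N.
Qed.

Let xpowD i j : Comp (xpow x j) (xpow x i) ~~~ xpow x (j + i).
Proof.
elim: j => [|j IH]; first by apply: comp_idl; apply: ty_iter_Comp.
rewrite addSn /= -IH; symmetry; apply: tcompA tx; exact: ty_iter_Comp.
Qed.

Let xD i j : D up up [:: (0%N, aX i); (0%N, aX j)] = D up up [:: (0%N, aX (j + i))].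
Proof. by apply: (repE (xpowD i j)); [represent | represent | done | done]. Qed.
Let x0 : D up up [:: (0%N, aX 0)] = D up up [::].
Proof. by apply: (repE (peqvv (Id up))); [exact: (rx 0) | represent | done | done]. Qed.
Let xS r : D up up [:: (0%N, aX r.+1)] = D up up [:: (0%N, aX 1); (0%N, aX r)].
Proof. by rewrite xD addn1. Qed.
Let xS' r : D up up [:: (0%N, aX r.+1)] = D up up [:: (0%N, aX r); (0%N, aX 1)].
Proof. by rewrite xD add1n. Qed.
Let dotS2 : D uu uu [:: (0%N, aS); (1%N, aX 1)] = D uu uu [:: (0%N, aX 1); (0%N, aS)] - D uu uu [::].
Proof. by rewrite dotS' addrK. Qed.

(** * Dotted curls *)

Section Curl.
Variable n : nat.
Hypothesis curl0 : D up up [:: (1%N, aC'); (0%N, aS); (1%N, aD)] =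
  if n == 0%N then D up up [::] else 0.
Hypothesis bub_lt : forall r, (r < n)%N ->
  D w1 w1 [:: (0%N, aC'); (0%N, aX r); (0%N, aD)] = if r.+1 == n then - D w1 w1 [::] else 0.

(** Moving one dot through the crossing costs a bubble with fewer than [n] dots. Only the one with
    [n-1] dots is nonzero, and its value -1 produces the identity when [r] reaches [n]. *)
Lemma curlE r : (r <= n)%N ->
  D up up [:: (1%N, aC'); (0%N, aS); (1%N, aX r); (1%N, aD)] =
  if r == n then D up up [::] else 0.
Proof.
elim: r => [|r IH] rn; first by rl x0 2%N 1%N; rewrite curl0 eq_sym.
rl (xS r) 2%N 1%N; at_ 1%N 2%N 0%N uu uu; rewrite dotS2; lin.
sL 0%N; at_ 1%N 4%N 0%N up up; rewrite IH 1?ltnW // ltn_eqF //; lin.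
at_ 0%N 3%N 1%N w1 w1; rewrite bub_lt //; case: ifP => _; [lin | lin].
  by rewrite sub0r opprK.
by rewrite subr0.
Qed.

(** The same induction, with [t x = x t - c d]; without dots, [t c'] is the undotted curl,
    rotated. *)
Lemma t_x_c' r : (r <= n)%N ->
  D w1 du [:: (0%N, aC'); (0%N, aX r); (0%N, aT)] = if r == n then D w1 du [:: (0%N, aC)] else 0.
Proof.
elim: r => [|r IH] rn.
  rl x0 1%N 0%N; rl defT 1%N 0%N; sL 0%N; at_ 1%N 3%N 1%N up up.
  by rewrite curl0 eq_sym; case: ifP => _; [lin | lin].
rl (xS' r) 1%N 0%N; at_ 2%N 2%N 0%N ud du; rewrite dotT; lin.
at_ 0%N 3%N 0%N w1 du; rewrite IH 1?ltnW // ltn_eqF //; lin.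
at_ 0%N 3%N 0%N w1 w1; rewrite bub_lt //; case: ifP => _; [lin | lin].
  by rewrite sub0r opprK.
by rewrite subr0.
Qed.

(** Closing [t'] by [d x^r] leaves a curl with [r] dots on the upward strand, followed by [d']. *)
Lemma d_x_t' r : (r <= n)%N ->
  D du w1 [:: (0%N, aT'); (0%N, aX r); (0%N, aD)] = if r == n then D du w1 [:: (0%N, aD')] else 0.
Proof.
move=> rn; rl defT' 0%N 0%N; sR 2%N; sR 3%N; at_ 0%N 4%N 1%N up up.
by rewrite curlE //; case: ifP => _; [lin | lin].
Qed.

Hypothesis z_ge : forall m, (n <= m)%N -> D w1 w1 [:: (0%N, aZ m)] = 0.
Hypothesis z_conv : forall r r', (r < n)%N -> (r' < n)%N ->
  \sum_(i < n.+1) (D w1 w1 [:: (0%N, aC'); (0%N, aX (r' + i)); (0%N, aD)] : bubbles P)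
    * D w1 w1 [:: (0%N, aZ (i + r))] = - (r == r')%:R.

(** For [i < n] already [t x^i c' = 0]; for [i = n] the bubble factor [z (n + r)] vanishes. *)
Lemma t_btilde i r : (i <= n)%N ->
  D w1 du [:: (0%N, aC'); (0%N, aX i); (2%N, aZ (i + r)); (0%N, aT)] = 0.
Proof.
move=> le_in; sL 2%N; at_ 0%N 3%N 0%N w1 du; rewrite t_x_c' //.
case: eqP => [->|_]; [lin | by rewrite (ctx_0 interp_ty)].
by at_ 1%N 1%N 2%N w1 w1; rewrite z_ge ?leq_addr // (ctx_0 interp_ty).
Qed.

Lemma d_btilde r r' : (r < n)%N -> (r' < n)%N ->
  - \sum_(i < n.+1) D w1 w1 [:: (0%N, aC'); (0%N, aX i); (2%N, aZ (i + r)); (0%N, aX r'); (0%N, aD)]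
  = if r == r' then D w1 w1 [::] else 0.
Proof.
move=> rn rn'; have := z_conv rn rn'; move=> /(congr1 -%R); rewrite opprK.
have -> : D w1 w1 [::] = (1 : bubbles P) by rewrite diagram.unlock.
move=> e; transitivity (((r == r')%:R : bubbles P)); last by case: eqP.
rewrite -e; congr (- _); apply: eq_bigr => i _.
sL 2%N; sL 3%N; rl (xD i r') 1%N 0%N.
by rewrite (@D_cat _ _ _ _ _ interp_ty w1 w1 w1 [:: (0%N, aC'); (0%N, aX (r' + i)); (0%N, aD)]) // mulrC.
Qed.
End Curl.

(** * Consequences of an inverse: the second adjunction and [t' = a] *)

Section Inverse.
Variable n : nat.
Hypothesis invl : D ud ud [:: (0%N, aT); (0%N, aA)] +
  \sum_(r < n) D ud ud [:: (0%N, aX r); (0%N, aD); (0%N, aB r)] = D ud ud [::].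
Hypothesis inv_ta : D du du [:: (0%N, aA); (0%N, aT)] = D du du [::].
Hypothesis inv_tb : forall r, (r < n)%N -> D w1 du [:: (0%N, aB r); (0%N, aT)] = 0.
Hypothesis inv_da : forall r, (r < n)%N -> D du w1 [:: (0%N, aA); (0%N, aX r); (0%N, aD)] = 0.
Hypothesis inv_db : forall r r', (r < n)%N -> (r' < n)%N ->
  D w1 w1 [:: (0%N, aB r'); (0%N, aX r); (0%N, aD)] = if r == r' then D w1 w1 [::] else 0.
Local Notation ctx_ok := (ctx_ok aty).
Local Notation okd := (okd aty).
Local Notation outd := (outd aty).

Lemma resolve w w' L : ctx_ok w w' L 0 ud ud [::] ->
  D w w' L = D w w' (L ++ [:: (0%N, aT); (0%N, aA)]) +
    \sum_(r < n) D w w' (L ++ [:: (0%N, aX r); (0%N, aD); (0%N, aB r)]).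
Proof.
move=> ok; transitivity (ctx aty interp w w' L 0 [::] (D ud ud [::])).
  by rewrite (ctxE interp_ty) ?ok //= !cats0.
rewrite -invl (ctx_add interp_ty) (ctx_sum interp_ty) (ctxE interp_ty) ?ok //=.
by congr (_ + _); apply: eq_bigr => r _; rewrite (ctxE interp_ty) ?ok.
Qed.

(** The computable side conditions of [jointly_monic]; [wt] and [wd] are the words left after
    applying [t], respectively [d x^r], to the two leftmost strands. Types do not depend on [r], so
    [r = 0] stands for all of them. *)
Definition jointly w w' wt wd L := [&& ctx_ok w w' L 0 ud ud [::],
  okd w (L ++ [:: (0%N, aT)]), outd w (L ++ [:: (0%N, aT)]) == wt,
  okd wt [:: (0%N, aA)], outd wt [:: (0%N, aA)] == w',
  okd w (L ++ [:: (0%N, aX 0); (0%N, aD)]), outd w (L ++ [:: (0%N, aX 0); (0%N, aD)]) == wd,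
  okd wd [:: (0%N, aB 0)] & outd wd [:: (0%N, aB 0)] == w'].

Lemma jointly_monic w w' wt wd L1 L2 : jointly w w' wt wd L1 -> jointly w w' wt wd L2 ->
  D w wt (L1 ++ [:: (0%N, aT)]) = D w wt (L2 ++ [:: (0%N, aT)]) ->
  (forall r, (r < n)%N -> D w wd (L1 ++ [:: (0%N, aX r); (0%N, aD)]) =
    D w wd (L2 ++ [:: (0%N, aX r); (0%N, aD)])) ->
  D w w' L1 = D w w' L2.
Proof.
have eX L r : okd w (L ++ [:: (0%N, aX r); (0%N, aD)]) = okd w (L ++ [:: (0%N, aX 0); (0%N, aD)])
  by rewrite !okd_cat.
have eXo L r : outd w (L ++ [:: (0%N, aX r); (0%N, aD)]) = outd w (L ++ [:: (0%N, aX 0); (0%N, aD)])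
  by rewrite !outd_cat.
move=> /and5P[ok1 t1 o1 a1 /and5P[b1 x1 y1 w1' v1]] /and5P[ok2 t2 o2 a2 /and5P[b2 x2 y2 w2' v2]].
move=> eT eD; rewrite (resolve ok1) (resolve ok2).
congr (_ + _).
  rewrite ![_ ++ [:: (0%N, aT); (0%N, aA)]](catA _ [:: (0%N, aT)] [:: (0%N, aA)]).
  rewrite (D_cat interp_ty (v := wt) (A := L1 ++ [:: (0%N, aT)])) ?t1 ?o1 ?a1 ?b1 //.
  by rewrite (D_cat interp_ty (v := wt) (A := L2 ++ [:: (0%N, aT)])) ?t2 ?o2 ?a2 ?b1 // eT.
apply: eq_bigr => r _.
rewrite ![_ ++ [:: (0%N, aX r); (0%N, aD); (0%N, aB r)]](catA _ [:: (0%N, aX r); (0%N, aD)] [:: (0%N, aB r)]).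
rewrite (D_cat interp_ty (v := wd) (A := L1 ++ [:: (0%N, aX r); (0%N, aD)]));
  [|by rewrite eX eXo x1 y1 | exact: v1].
rewrite (D_cat interp_ty (v := wd) (A := L2 ++ [:: (0%N, aX r); (0%N, aD)]));
  [|by rewrite eX eXo x2 y2 | exact: v1].
by rewrite eD.
Qed.

Hypothesis c'_pos : (0 < n)%N -> D w1 ud [:: (0%N, aC')] = - D w1 ud [:: (0%N, aB n.-1)].
Hypothesis c'_zero : n = 0%N -> D w1 ud [:: (0%N, aC')] = D w1 ud [:: (0%N, aC); (0%N, aA)].
Hypothesis d'_def : D du w1 [:: (0%N, aD')] = D du w1 [:: (0%N, aA); (0%N, aX n); (0%N, aD)].

Lemma inv_bub r : (r < n)%N ->
  D w1 w1 [:: (0%N, aC'); (0%N, aX r); (0%N, aD)] = if r.+1 == n then - D w1 w1 [::] else 0.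
Proof.
move=> rn; have n0 : (0 < n)%N by apply: leq_ltn_trans rn.
at_ 0%N 1%N 0%N w1 ud; rewrite c'_pos //; lin; rewrite inv_db ?prednK //.
by rewrite -[in RHS](prednK n0) eqSS; case: ifP => _; rewrite ?oppr0.
Qed.

Lemma inv_t_c' : D w1 du [:: (0%N, aC'); (0%N, aT)] = if n == 0%N then D w1 du [:: (0%N, aC)] else 0.
Proof.
at_ 0%N 1%N 0%N w1 ud; case: (posnP n) => n0.
  by rewrite c'_zero //; lin; rl inv_ta 1%N 0%N.
by rewrite c'_pos //; lin; rewrite inv_tb ?prednK // oppr0.
Qed.

(** A zigzag inserted on the through strand turns the curl into [t c'], whose value is known. *)
Lemma inv_curl0 : D up up [:: (1%N, aC'); (0%N, aS); (1%N, aD)] =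
  if n == 0%N then D up up [::] else 0.
Proof.
have e : D w1 du [:: (0%N, aC); (2%N, aC'); (1%N, aS); (2%N, aD)] =
    if n == 0%N then D w1 du [:: (0%N, aC)] else 0.
  rewrite -inv_t_c'; rr defT 1%N 0%N; by rsL 0%N.
rl (esym zigzagR) 0%N 0%N; sR 1%N; sR 2%N; sR 3%N; at_ 0%N 4%N 1%N w1 du.
by rewrite e; case: ifP => _; [lin; rl zigzagR 0%N 0%N | lin].
Qed.

Let curl := curlE inv_curl0 inv_bub.
Let txc := t_x_c' inv_curl0 inv_bub.
Let dxt := d_x_t' inv_curl0 inv_bub.

(** A cup passes across the through strand and back, and is then capped off. Each dot between the
    crossings is moved past the second one; the correction is a curl with [m < n] dots, hence zero.
    With no dot left in between, [s s = 1] leaves the bubble with [m + r] dots. *)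
Lemma double_cross r m : (m + r < n)%N ->
  D up up [:: (1%N, aC'); (0%N, aS); (0%N, aX r); (0%N, aS); (1%N, aX m); (1%N, aD)] =
  if (m + r).+1 == n then - D up up [::] else 0.
Proof.
elim: r m => [|r IH] m mr.
  rl x0 2%N 0%N; rl ss1 1%N 0%N; at_ 0%N 3%N 1%N w1 w1.
  by rewrite addn0 in mr *; rewrite inv_bub //; case: ifP => _; [lin | lin].
rl (xS' r) 2%N 0%N; at_ 3%N 2%N 0%N uu uu; rewrite dotS'; lin.
have mn : (m < n)%N by lia.
rl (xD 1 m) 4%N 1%N; rewrite addn1 IH ?addSnnS // -[RHS]addr0; congr (_ + _).
by sR 2%N; sR 3%N; at_ 0%N 4%N 0%N up up; rewrite curl 1?ltnW // ltn_eqF //; lin.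
Qed.

(** Against [t], the rotated braid relation brings [t] directly onto [c']; against [d x^r], [capT]
    yields a double crossing with all [r] dots between the crossings. Both sides give the same in
    either test. *)
Lemma slide_c' : D up [:: true; false; true] [:: (1%N, aC'); (0%N, aS); (1%N, aT)] =
  D up [:: true; false; true] [:: (0%N, aC')].
Proof.
apply: (jointly_monic (wt := [:: false; true; true]) (wd := up)) => //= [|r rn].
  rl braidT 1%N 0%N; at_ 0%N 2%N 1%N w1 du.
  rewrite [in RHS](D_at interp_ty (i := 0) (n := 2) (p := 0) (v := w1) (v' := du)) //=.
  rewrite inv_t_c'; case: ifP => _; lin; rl cupT 0%N 0%N; by rl ss1 1%N 1%N.
sL 2%N; rl capT 3%N 0%N; rl (esym x0) 4%N 1%N; rewrite double_cross //.
rewrite [in RHS](D_at interp_ty (i := 0) (n := 3) (p := 0) (v := w1) (v' := w1)) //=.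
by rewrite inv_bub //; case: ifP => _; [lin | lin].
Qed.

(** Trades [a], which is known only through [t a = 1] and [d x^r a = 0], for an explicit [t]; this
    is what makes [d'], defined with [a], computable. *)
Lemma rotate_c' : D w1 [:: true; false; false; true] [:: (0%N, aC); (1%N, aC'); (0%N, aA)] =
  D w1 [:: true; false; false; true] [:: (0%N, aC'); (1%N, aC); (2%N, aT)].
Proof.
apply: (jointly_monic (wt := [:: false; true; false; true]) (wd := du)) => //= [|r rn].
  rl inv_ta 2%N 0%N; rsL 2%N; rr cupT 1%N 0%N; rsL 0%N; by rr slide_c' 1%N 1%N.
at_ 2%N 3%N 0%N du w1; rewrite inv_da //; lin.
rsL 2%N; rsL 3%N; rsL 1%N; rr zigzagR 2%N 0%N.
by rewrite txc 1?ltnW // ltn_eqF.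
Qed.

(** The [n] dots contained in [d'] are exactly as many as needed: after the rotation there remains
    [t x^n c' = c]. *)
Lemma zigzag'_cup : D w1 du [:: (0%N, aC); (1%N, aC'); (0%N, aD')] = D w1 du [:: (0%N, aC)].
Proof.
at_ 2%N 1%N 0%N du w1; rewrite d'_def; lin; rl rotate_c' 0%N 0%N.
by sL 2%N; sL 3%N; sL 1%N; rl zigzagR 2%N 0%N; rewrite txc // eqxx.
Qed.

Lemma zigzag' : D dn dn [:: (1%N, aC'); (0%N, aD')] = D dn dn [::].
Proof.
rl (esym zigzagL) 0%N 0%N; sL 1%N; sL 2%N; rl zigzag'_cup 0%N 0%N; exact: zigzagL.
Qed.

Lemma t_t' : D du du [:: (0%N, aT'); (0%N, aT)] = D du du [::].
Proof.
rl defT' 0%N 0%N; sR 2%N; rl slide_c' 0%N 1%N; by rl zigzag' 0%N 0%N.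
Qed.

Lemma t'_eq_a : D du ud [:: (0%N, aT')] = D du ud [:: (0%N, aA)].
Proof.
apply: (jointly_monic (wt := du) (wd := w1)) => //= [|r rn].
  by rewrite t_t' inv_ta.
by rewrite dxt 1?ltnW // ltn_eqF // inv_da.
Qed.

(** At charge zero [d' = d a], and the crossing next to the cup [c] is a rotated [t]; then [a t = 1]
    leaves a zigzag. *)
Lemma curl_left : n = 0%N -> D up up [:: (0%N, aC); (1%N, aS); (0%N, aD')] = D up up [::].
Proof.
move=> n0; rl (esym cupT) 0%N 0%N; at_ 2%N 1%N 0%N du w1; rewrite d'_def n0; lin.
rl x0 3%N 0%N; have e := invl; rewrite big1 ?addr0 in e; last first.
  by move=> [r rn]; exfalso; rewrite n0 in rn.
rl e 1%N 0%N; exact: zigzagR.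
Qed.

Hypothesis z_ge : forall m, (n <= m)%N -> D w1 w1 [:: (0%N, aZ m)] = 0.
Hypothesis z_conv : forall r r', (r < n)%N -> (r' < n)%N ->
  \sum_(i < n.+1) (D w1 w1 [:: (0%N, aC'); (0%N, aX (r' + i)); (0%N, aD)] : bubbles P)
    * D w1 w1 [:: (0%N, aZ (i + r))] = - (r == r')%:R.

(** Resolve the right-hand side by [a t + sum_q b_q d x^q = 1]: [t] kills it and [d x^q] sends it to
    the Kronecker delta of [q] and [r], so only [b_r] survives. *)
Lemma b_eq_btilde r : (r < n)%N -> D w1 ud [:: (0%N, aB r)] =
  - \sum_(i < n.+1) D w1 ud [:: (0%N, aC'); (0%N, aX i); (2%N, aZ (i + r))].
Proof.
move=> rn; have expand (i : 'I_n.+1) :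
    D w1 ud [:: (0%N, aC'); (0%N, aX i); (2%N, aZ (i + r))] =
    \sum_(q < n) ctx aty interp w1 ud [::] 0 [:: (0%N, aB q)] (D w1 w1
      [:: (0%N, aC'); (0%N, aX i); (2%N, aZ (i + r)); (0%N, aX q); (0%N, aD)]).
  rewrite resolve //=; at_ 0%N 4%N 0%N w1 du.
  rewrite (t_btilde inv_curl0 inv_bub z_ge) -1?ltnS // (ctx_0 interp_ty) add0r.
  by apply: eq_bigr => q _; at_ 0%N 5%N 0%N w1 w1.
rewrite (eq_bigr _ (fun i _ => expand i)) exchange_big /= -sumrN.
under eq_bigr => q _.
  rewrite -(ctx_sum interp_ty) -(ctx_opp interp_ty) (d_btilde z_conv) //.
  over.
rewrite (bigD1 (Ordinal rn)) //= eqxx big1 ?addr0; first by lin.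
by move=> q; rewrite -val_eqE /= eq_sym => /negbTE->; rewrite (ctx_0 interp_ty).
Qed.
End Inverse.

(** * Bubbles of negative index, and the passage between (I) and (P1)-(P4) *)

Section Terms.
Variable n : nat.
Hypothesis zE : forall m, z m = bubLZ (Posz n) x c d c' d' (- m%:Z - 2).

Let rep_bubR m : rep (bubR x d c' m) w1 w1 1 [:: (0%N, aC'); (0%N, aX m); (0%N, aD)].
Proof. by rewrite /bubR; represent. Qed.

Let bub m : bubbles P := D w1 w1 [:: (0%N, aC'); (0%N, aX m); (0%N, aD)].
Let h p := bub (n.-1 + p).

Section Scalars.
Hypothesis bub_lt : forall r, (r < n)%N ->
  D w1 w1 [:: (0%N, aC'); (0%N, aX r); (0%N, aD)] = if r.+1 == n then - D w1 w1 [::] else 0.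

(** Right bubbles vanish below [n-1] dots, which makes the defining matrix Hessenberg; the shift by
    [n-1] in [h] places the value -1 at index 0, on the superdiagonal. *)
Lemma z_det m : D w1 w1 [:: (0%N, aZ m)] =
  if (m < n)%N then \det (toeplitz h (n.-1 - m)) else 0.
Proof.
have := rep_cls interp_ty (rz m); rewrite scale1r => <-; rewrite zE /bubLZ.
case e : (- m%:Z - 2) => [k|k]; first by lia.
rewrite -e; case: ltP => [neg|pos].
  by rewrite cls0 ifF //; lia.
have mn : (m < n)%N by lia.
rewrite mn; have -> : absz (- m%:Z - 2 + n%:Z + 1) = (n.-1 - m)%N by lia.
rewrite (proj2 (cls_tdet (fun i j => rep_ty interp_ty (rep_bubR _)))).
suff e' : \matrix_(i, j) (cls w1 w1 (bubR x d c' (absz (i%:Z - j%:Z + n%:Z))) : bubbles P) =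
    toeplitz h (n.-1 - m) by rewrite -e'.
apply/matrixP => i j; rewrite !mxE.
rewrite (rep_cls interp_ty (rep_bubR _)) scale1r.
have := ltn_ord i; have := ltn_ord j; move=> lj li.
(* As [j < n], the index is positive and [absz] does not change it. *)
have -> : absz (i%:Z - j%:Z + n%:Z) = (n + i - j)%N by lia.
case: ifP => [ji|/negbT ji]; first by rewrite /h /bub; congr (D _ _ [:: _; (_, aX _); _]); lia.
by rewrite bub_lt ?ifF //; lia.
Qed.

Lemma z_ge m : (n <= m)%N -> D w1 w1 [:: (0%N, aZ m)] = 0.
Proof. by move=> nm; rewrite z_det ltnNge nm. Qed.

(** Terms with [r' + i < n-1] vanish by the bubble relations, those with [i + r >= n] by [z_det].
    What is left is empty if [r' < r], and otherwise the convolution of order [r' - r] in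
    [det_toeplitz_conv]. *)
Lemma z_conv r r' : (r < n)%N -> (r' < n)%N ->
  \sum_(i < n.+1) bub (r' + i) * (D w1 w1 [:: (0%N, aZ (i + r))] : bubbles P) =
  - (r == r')%:R.
Proof.
move=> rn rn'; rewrite -(big_mkord predT (fun i => bub (r' + i) *
  (D w1 w1 [:: (0%N, aZ (i + r))] : bubbles P))).
have h0 : h 0 = -1.
  rewrite /h /bub addn0 bub_lt ?prednK ?eqxx ?diagram.unlock //; lia.
rewrite (@big_cat_nat _ _ _ (n.-1 - r')) //=; last by lia.
rewrite [X in X + _]big_nat_cond big1 ?add0r; last first.
  move=> i /andP[/andP[_ li] _]; rewrite /bub bub_lt ?ifF ?mul0r //; lia.
case: (leqP r r') => rr; last first.
  rewrite big_nat_cond big1 ?gtn_eqF ?oppr0 // => i /andP[/andP[li _] _].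
  by rewrite z_det ifF ?mulr0 //; lia.
rewrite (@big_cat_nat _ _ _ (n - r)) //=; try lia.
rewrite [X in _ + X]big_nat_cond [X in _ + X]big1 ?addr0; last first.
  by move=> i /andP[/andP[li _] _]; rewrite z_det ifF ?mulr0 //; lia.
rewrite -{1}[(n.-1 - r')%N]add0n big_addn.
have -> : (n - r - (n.-1 - r') = (r' - r).+1)%N by lia.
rewrite big_mkord.
have -> : (r == r') = (r' - r == 0)%N by lia.
rewrite -(det_toeplitz_conv h0); apply: eq_bigr => i _; have := ltn_ord i => li.
rewrite z_det ifT; last by lia.
congr (_ * \det (toeplitz _ _)); last by lia.
by rewrite /h /bub; congr (D _ _ [:: _; (_, aX _); _]); lia.
Qed.
End Scalars.

Let clsE f v w L : rep f v w 1 L -> cls v w f = D v w L.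
Proof. by move=> hf; rewrite (rep_cls interp_ty hf) scale1r. Qed.

Let zsum i j : bubLZ (Posz n) x c d c' d' (- i%:Z - j%:Z - 2) = z (i + j).
Proof. by rewrite zE; congr (bubLZ _ _ _ _ _ _ _); lia. Qed.

(** Follows from the scalar axioms, by writing the zero morphism as 0 times itself. *)
Let cls_tens0 v w v' w' f : ty f = Some (v', w') ->
  cls (v ++ v') (w ++ w') (Tens (Zero v w) f) = 0.
Proof.
move=> tf; have e : Tens (Zero v w) f ~~~ Scal 0 (Tens (Zero v w) f).
  transitivity (Tens (Scal 0 (Zero v w)) f).
    by apply: e_tens; [apply: e_sym; apply: e_scal0|apply: e_refl].
  by apply: e_tensZl; rewrite /wt /= tf.
by rewrite (eq_cls _ _ e) clsZ /= ?tf // scale0r.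
Qed.

Lemma btildeE r : ty (btilde n x c d c' d' r) = Some (w1, ud) /\
  cls w1 ud (btilde n x c d c' d' r) =
  - \sum_(i < n.+1) D w1 ud [:: (0%N, aC'); (0%N, aX i); (2%N, aZ (i + r))].
Proof.
have rij i : rep (Tens (Comp (Tens (xpow x i) (Id dn)) c')
    (bubLZ (Posz n) x c d c' d' (- i%:Z - r%:Z - 2))) w1 ud 1
    [:: (0%N, aC'); (0%N, aX i); (2%N, aZ (i + r))] by rewrite zsum; represent.
rewrite /btilde; set l := [seq _ | i <- iota 0 n.+1].
have tl : all (fun f => ty f == Some (w1, ud)) l.
  by apply/allP => f /mapP[i _ ->]; rewrite (rep_ty interp_ty (rij i)).
split; first by rewrite -(ty_tsum tl).
rewrite clsZ ?ty_tsum // scaleN1r cls_tsum // big_map sum_iota; congr (- _).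
by apply: eq_bigr => i _; rewrite (clsE (rij i)).
Qed.

Let P1term i j := [:: (0%N, aX j); (0%N, aD); (0%N, aC'); (0%N, aX i); (2%N, aZ (i + j))].

Let P1_rhs (l := [seq Tens (Comp (Tens (xpow x i) (Id dn)) (Comp c' (Comp d (Tens (xpow x j) (Id dn)))))
    (bubLZ (Posz n) x c d c' d' (- i%:Z - j%:Z - 2)) | i <- prange (Posz n), j <- prange (Posz n)]) :
  ty (Add (Id ud) (tsum ud ud l)) = Some (ud, ud) /\
  cls ud ud (Add (Id ud) (tsum ud ud l)) =
  D ud ud [::] + \sum_(i < n.+1) \sum_(j < n.+1) D ud ud (P1term i j).
Proof.
have rij i j : rep (Tens (Comp (Tens (xpow x i) (Id dn)) (Comp c' (Comp d (Tens (xpow x j) (Id dn)))))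
    (bubLZ (Posz n) x c d c' d' (- i%:Z - j%:Z - 2))) ud ud 1 (P1term i j).
  by rewrite zsum; represent.
have tl : all (fun f => ty f == Some (ud, ud)) l.
  by apply/allP => f /allpairsP[[i j] [_ _ ->]]; rewrite (rep_ty interp_ty (rij i j)).
have ts' := ty_tsum tl; split; first exact: ty_Add.
rewrite clsD // cls_tsum // (clsE (rep_id _ _ _)); congr (_ + _).
rewrite big_allpairs_dep /= sum_iota; apply: eq_bigr => i _.
by rewrite sum_iota; apply: eq_bigr => j _; rewrite (clsE (rij i j)).
Qed.

(** For charge [n >= 0] all right bubbles occurring here belong to determinants of negative size,
    hence are zero: (P2) reads [t t' = 1]. *)
Let P2_rhs (l := [seq Tens (bubRZ (Posz n) x c d c' d' (- i%:Z - j%:Z - 2))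
    (Comp (Tens (Id dn) (xpow x j)) (Comp c (Comp d' (Tens (Id dn) (xpow x i)))))
    | i <- prange (Posz n), j <- prange (Posz n)]) :
  ty (Add (Id du) (tsum du du l)) = Some (du, du) /\
  cls du du (Add (Id du) (tsum du du l)) = D du du [::].
Proof.
have zR i j : bubRZ (Posz n) x c d c' d' (- i%:Z - j%:Z - 2) = Zero w1 w1.
  rewrite /bubRZ; case e : (- i%:Z - j%:Z - 2) => [k|k]; first by lia.
  by rewrite -e ifT //; lia.
have rij i j : ty (Comp (Tens (Id dn) (xpow x j)) (Comp c (Comp d' (Tens (Id dn) (xpow x i)))))
   = Some (du, du).
  apply: (rep_ty interp_ty (r := 1) (L := [:: (1%N, aX i); (0%N, aD'); (0%N, aC); (1%N, aX j)])).
  represent.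
have tl : all (fun f => ty f == Some (du, du)) l.
  by apply/allP => f /allpairsP[[i j] [_ _ ->]]; rewrite zR (ty_Tens (erefl : ty (Zero w1 w1) = _) (rij i j)).
have ts' := ty_tsum tl; split; first exact: ty_Add.
rewrite clsD // cls_tsum // (clsE (rep_id _ _ _)) -[RHS]addr0; congr (_ + _).
rewrite big_allpairs_dep /= big1 // => i _; rewrite big1 // => j _.
by rewrite zR (@cls_tens0 w1 w1 _ _ _ (rij i j)).
Qed.

Let dr r := Comp d (Tens (xpow x r) (Id dn)).
Let rep_dr r : rep (dr r) ud w1 1 [:: (0%N, aX r); (0%N, aD)].
Proof. by rewrite /dr; represent. Qed.

Let rat : rep (Comp a (tcr s c d)) ud ud 1 [:: (0%N, aT); (0%N, aA)].
Proof.
by eapply rep_eq; [eapply (rep_comp interp_ty); [exact: ra|exact: rt] | ..]; rewrite ?mulr1.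
Qed.
Let rta : rep (Comp (tcr s c d) a) du du 1 [:: (0%N, aA); (0%N, aT)].
Proof.
by eapply rep_eq; [eapply (rep_comp interp_ty); [exact: rt|exact: ra] | ..]; rewrite ?mulr1.
Qed.
Let rtb r : rep (Comp (tcr s c d) (b r)) w1 du 1 [:: (0%N, aB r); (0%N, aT)].
Proof.
by eapply rep_eq; [eapply (rep_comp interp_ty); [exact: rt|exact: rb] | ..]; rewrite ?mulr1.
Qed.
Let rda r : rep (Comp (dr r) a) du w1 1 [:: (0%N, aA); (0%N, aX r); (0%N, aD)].
Proof.
by eapply rep_eq; [eapply (rep_comp interp_ty); [exact: rep_dr|exact: ra] | ..]; rewrite ?mulr1.
Qed.
Let rdb r r' : rep (Comp (dr r) (b r')) w1 w1 1 [:: (0%N, aB r'); (0%N, aX r); (0%N, aD)].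
Proof.
by eapply rep_eq; [eapply (rep_comp interp_ty); [exact: rep_dr|exact: rb] | ..]; rewrite ?mulr1.
Qed.
Let rbd r : rep (Comp (b r) (dr r)) ud ud 1 [:: (0%N, aX r); (0%N, aD); (0%N, aB r)].
Proof.
by eapply rep_eq; [eapply (rep_comp interp_ty); [exact: rb|exact: rep_dr] | ..]; rewrite ?mulr1.
Qed.

(** [prange] runs over [n+1] indices while there are only [n] morphisms [d x^r]; for the surplus
    index [j = n] the bubble [z (i + n)] vanishes. *)
Let sum_P1term : (forall r, (r < n)%N ->
    D w1 w1 [:: (0%N, aC'); (0%N, aX r); (0%N, aD)] = if r.+1 == n then - D w1 w1 [::] else 0) ->
  \sum_(i < n.+1) \sum_(j < n.+1) D ud ud (P1term i j) =
  \sum_(r < n) \sum_(i < n.+1) D ud ud (P1term i r).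
Proof.
move=> bubl; rewrite exchange_big big_ord_recr /= [X in _ + X]big1 ?addr0 //.
move=> i _; rewrite /P1term; at_ 4%N 1%N 2%N w1 w1.
by rewrite (z_ge bubl) ?leq_addl // (ctx_0 interp_ty).
Qed.

Let comp_dr_b r : D w1 ud [:: (0%N, aB r)] =
    - \sum_(i < n.+1) D w1 ud [:: (0%N, aC'); (0%N, aX i); (2%N, aZ (i + r))] ->
  D ud ud [:: (0%N, aX r); (0%N, aD); (0%N, aB r)] = - \sum_(i < n.+1) D ud ud (P1term i r).
Proof.
move=> bt; at_ 2%N 1%N 0%N w1 ud; rewrite bt (ctx_opp interp_ty) (ctx_sum interp_ty).
by congr (- _); apply: eq_bigr => i _; rewrite (ctxE interp_ty).
Qed.

Let rP3 : rep (Comp (Tens (Id up) d) (Comp (Tens s (Id dn)) (Tens (Id up) c'))) up up 1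
  [:: (1%N, aC'); (0%N, aS); (1%N, aD)].
Proof. by represent. Qed.

Lemma is_inverse_diagrams : is_inverse n x s c d a b ->
  [/\ D ud ud [:: (0%N, aT); (0%N, aA)] +
        \sum_(r < n) D ud ud [:: (0%N, aX r); (0%N, aD); (0%N, aB r)] = D ud ud [::],
      D du du [:: (0%N, aA); (0%N, aT)] = D du du [::],
      forall r, (r < n)%N -> D w1 du [:: (0%N, aB r); (0%N, aT)] = 0,
      forall r, (r < n)%N -> D du w1 [:: (0%N, aA); (0%N, aX r); (0%N, aD)] = 0 &
      forall r r', (r < n)%N -> (r' < n)%N ->
        D w1 w1 [:: (0%N, aB r'); (0%N, aX r); (0%N, aD)] = if r == r' then D w1 w1 [::] else 0].
Proof.
move=> [i1 i2 i3 i4 i5].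
have invl : D ud ud [:: (0%N, aT); (0%N, aA)] +
  \sum_(r < n) D ud ud [:: (0%N, aX r); (0%N, aD); (0%N, aB r)] = D ud ud [::].
  have := eq_cls ud ud i1; set l := [seq _ | r : 'I_n].
  have tl : all (fun f => ty f == Some (ud, ud)) l.
    by apply/allP => f /mapP[r _ ->]; rewrite (rep_ty interp_ty (rbd r)).
  rewrite clsD ?ty_tsum ?(rep_ty interp_ty rat) // cls_tsum // (clsE rat) (clsE (rep_id _ _ _)) => <-.
  by congr (_ + _); rewrite big_map big_enum /=; apply: eq_bigr => r _; rewrite (clsE (rbd r)).
have inv_ta : D du du [:: (0%N, aA); (0%N, aT)] = D du du [::].
  by rewrite -(clsE rta) (eq_cls _ _ i2) (clsE (rep_id _ _ _)).
have inv_tb r : (r < n)%N -> D w1 du [:: (0%N, aB r); (0%N, aT)] = 0.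
  by move=> rn; rewrite -(clsE (rtb r)) (eq_cls _ _ (i3 r rn)) cls0.
have inv_da r : (r < n)%N -> D du w1 [:: (0%N, aA); (0%N, aX r); (0%N, aD)] = 0.
  by move=> rn; rewrite -(clsE (rda r)) (eq_cls _ _ (i4 r rn)) cls0.
have inv_db r r' : (r < n)%N -> (r' < n)%N ->
    D w1 w1 [:: (0%N, aB r'); (0%N, aX r); (0%N, aD)] = if r == r' then D w1 w1 [::] else 0.
  move=> rn rn'; rewrite -(clsE (rdb r r')) (eq_cls _ _ (i5 r r' rn rn')).
  by case: ifP => _; rewrite ?cls0 // (clsE (rep_id _ _ _)).
by split.
Qed.

Let rtt' : rep (Comp (tcr' s c' d') (tcr s c d)) ud ud 1 [:: (0%N, aT); (0%N, aT')].
Proof.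
by eapply rep_eq; [eapply (rep_comp interp_ty); [exact: rt'|exact: rt] | ..]; rewrite ?mulr1.
Qed.
Let rt't : rep (Comp (tcr s c d) (tcr' s c' d')) du du 1 [:: (0%N, aT'); (0%N, aT)].
Proof.
by eapply rep_eq; [eapply (rep_comp interp_ty); [exact: rt|exact: rt'] | ..]; rewrite ?mulr1.
Qed.

(** Besides existence this gives [t' = a] and [b = btilde], which later say that a composite of the
    two functors fixes the generators adjoined by (I). *)
Lemma is_inverse_P : is_inverse n x s c d a b ->
  c' ~~~ (if n is m.+1 then Scal (-1) (b m) else Comp a c) -> d' ~~~ Comp (dr n) a ->
  [/\ forall u v, P_rel (Posz n) x s c d c' d' u v -> u ~~~ v, tcr' s c' d' ~~~ a &
      forall r, (r < n)%N -> b r ~~~ btilde n x c d c' d' r].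
Proof.
move=> inv ec' ed'.
have [invl inv_ta inv_tb inv_da inv_db] := is_inverse_diagrams inv.
have c'_pos : (0 < n)%N -> D w1 ud [:: (0%N, aC')] = - D w1 ud [:: (0%N, aB n.-1)].
  move=> n0; rewrite -(clsE rc') -(clsE (rb _)) (eq_cls _ _ ec').
  by case: (n) n0 => // m _; rewrite clsZ // scaleN1r.
have c'_zero : n = 0%N -> D w1 ud [:: (0%N, aC')] = D w1 ud [:: (0%N, aC); (0%N, aA)].
  move=> n0; rewrite -(clsE rc') (eq_cls _ _ ec') n0; apply: clsE; represent.
have d'_def : D du w1 [:: (0%N, aD')] = D du w1 [:: (0%N, aA); (0%N, aX n); (0%N, aD)].
  by rewrite -(clsE rd') (eq_cls _ _ ed') (clsE (rda n)).
have bubl := inv_bub inv_db c'_pos.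
have curl0 := inv_curl0 inv_ta inv_tb c'_pos c'_zero.
have ta' := t'_eq_a invl inv_ta inv_tb inv_da inv_db c'_pos c'_zero d'_def.
have bt r : (r < n)%N -> D w1 ud [:: (0%N, aB r)] =
    - \sum_(i < n.+1) D w1 ud [:: (0%N, aC'); (0%N, aX i); (2%N, aZ (i + r))].
  by apply: b_eq_btilde => //; [exact: z_ge | exact: z_conv].
have e_t' : tcr' s c' d' ~~~ a by apply: (rep_eqv interp_ty rt' ra); rewrite ta'.
split=> //; last first.
  move=> r rn; have [tbt cbt] := btildeE r.
  by apply: (cls_inj (tb r) tbt); rewrite cbt (clsE (rb r)) bt.
move=> u v [| | k0 | r k0 rn | k0 | r k0 rn].
- have [tr cr] := P1_rhs; have tl : ty (Comp (tcr' s c' d') (tcr s c d)) = Some (ud, ud).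
    by rewrite (peqv_ty (Comp_peqv e_t' (peqvv _))) (rep_ty interp_ty rat).
  apply: (cls_inj tl tr); rewrite cr (eq_cls _ _ (Comp_peqv e_t' (peqvv _))) (clsE rat).
  (* [a t] differs from 1 by the sum of the [b_r d x^r], and each of these is minus the sum of the
     terms of (P1) with [j = r]. *)
  rewrite -invl -addrA -[LHS]addr0; congr (_ + _).
  rewrite sum_P1term // -big_split big1 //= => r _.
  by rewrite comp_dr_b ?bt // addNr.
- have [tr cr] := P2_rhs.
  have e : Comp (tcr s c d) (tcr' s c' d') ~~~ Comp (tcr s c d) a by rewrite e_t'.
  have tl : ty (Comp (tcr s c d) (tcr' s c' d')) = Some (du, du).
    by rewrite (peqv_ty e) (rep_ty interp_ty rta).
  by apply: (cls_inj tl tr); rewrite cr (eq_cls _ _ e) (clsE rta) inv_ta.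
- apply: (@cls_inj R P up up); rewrite ?(rep_ty interp_ty rP3) //; first by case: ifP.
  rewrite (clsE rP3) curl0; case: eqP => [->|n0] /=; first by rewrite (clsE (rep_id _ _ _)).
  by rewrite ifF ?cls0 //; apply/eqP => -[].
- have rn' : (r < n)%N by lia.
  apply: (@cls_inj R P w1 w1); rewrite ?(rep_ty interp_ty (rep_bubR r)) //; first by case: ifP.
  rewrite (clsE (rep_bubR r)) bubl // (_ : (r%:Z == n%:Z - 1) = (r.+1 == n)); last by lia.
  by case: ifP => _; rewrite ?cls0 // clsZ // scaleN1r (clsE (rep_id _ _ _)).
- have n0 : n = 0%N by lia.
  have r4 : rep (Comp (Tens d' (Id up)) (Comp (Tens (Id dn) s) (Tens c (Id up)))) up up 1
    [:: (0%N, aC); (1%N, aS); (0%N, aD')] by represent.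
  rewrite n0 eqxx; apply: (@cls_inj R P up up); rewrite ?(rep_ty interp_ty r4) //.
  by rewrite (clsE r4) (clsE (rep_id _ _ _)); apply: curl_left invl d'_def n0.
- by move: rn; lia.
Qed.

Section P_relations.
Hypothesis relP : forall u v, P_rel (Posz n) x s c d c' d' u v -> u ~~~ v.
Let curl0 : D up up [:: (1%N, aC'); (0%N, aS); (1%N, aD)] = if n == 0%N then D up up [::] else 0.
Proof.
rewrite -(clsE rP3) (eq_cls _ _ (relP (pP3a _ _ _ _ _ _ _))) //.
case: (n) => [|m]; first by rewrite eqxx (clsE (rep_id _ _ _)).
by have -> : (m.+1%:Z == 0) = false by []; rewrite cls0.
Qed.

Let bubl r : (r < n)%N ->
    D w1 w1 [:: (0%N, aC'); (0%N, aX r); (0%N, aD)] = if r.+1 == n then - D w1 w1 [::] else 0.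
Proof.
move=> rn; rewrite -(clsE (rep_bubR r)) (eq_cls _ _ (relP (@pP3b _ _ _ _ _ _ _ _ _ r _ _))) //.
rewrite (_ : (r%:Z == n%:Z - 1) = (r.+1 == n)); last by lia.
by case: ifP => _; rewrite ?cls0 // clsZ // scaleN1r (clsE (rep_id _ _ _)).
Qed.

(** (P1) and (P2) give the products of [t] with [t']; the remaining matrix entries come from the
    curl relations and the bubble convolution. The formulas for [c'] and [d'] show that the other
    composite functor fixes [AC'] and [AD']. *)
Lemma P_is_inverse : a ~~~ tcr' s c' d' -> (forall r, (r < n)%N -> b r ~~~ btilde n x c d c' d' r) ->
  [/\ is_inverse n x s c d a b, c' ~~~ (if n is m.+1 then Scal (-1) (b m) else Comp a c) &
      d' ~~~ Comp (dr n) a].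
Proof.
move=> ea eb.
have aE : D du ud [:: (0%N, aA)] = D du ud [:: (0%N, aT')].
  by rewrite -(clsE ra) -(clsE rt') (eq_cls _ _ ea).
have bE r : (r < n)%N -> D w1 ud [:: (0%N, aB r)] =
    - \sum_(i < n.+1) D w1 ud [:: (0%N, aC'); (0%N, aX i); (2%N, aZ (i + r))].
  by move=> rn; rewrite -(clsE (rb r)) (eq_cls _ _ (eb r rn)) (proj2 (btildeE r)).
have tt' : D ud ud [:: (0%N, aT); (0%N, aT')] =
    D ud ud [::] + \sum_(r < n) \sum_(i < n.+1) D ud ud (P1term i r).
  by rewrite -(clsE rtt') (eq_cls _ _ (relP (pP1 _ _ _ _ _ _ _))) (proj2 P1_rhs) sum_P1term.
have t't : D du du [:: (0%N, aT'); (0%N, aT)] = D du du [::].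
  by rewrite -(clsE rt't) (eq_cls _ _ (relP (pP2 _ _ _ _ _ _ _))) (proj2 P2_rhs).
have dxt r : (r <= n)%N -> D du w1 [:: (0%N, aA); (0%N, aX r); (0%N, aD)] =
    if r == n then D du w1 [:: (0%N, aD')] else 0.
  by move=> rn; rl aE 0%N 0%N; rewrite (d_x_t' curl0 bubl).
split; first split.
- set l := [seq _ | r : 'I_n].
  have tl : all (fun f => ty f == Some (ud, ud)) l.
    by apply/allP => f /mapP[r _ ->]; rewrite (rep_ty interp_ty (rbd r)).
  apply: (@cls_inj R P ud ud) => //; first by rewrite (ty_Add (rep_ty interp_ty rat)) ?ty_tsum.
  rewrite clsD ?ty_tsum ?(rep_ty interp_ty rat) // cls_tsum // (clsE rat) (clsE (rep_id _ _ _)).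
  rl aE 1%N 0%N; rewrite tt' -[RHS]addr0 -addrA; congr (_ + _).
  rewrite big_map big_enum /= -big_split big1 //= => r _.
  by rewrite (clsE (rbd r)) comp_dr_b ?bE // subrr.
- apply: (rep_eqv interp_ty rta (rep_id _ _ _)); congr (_ *: _).
  by rl aE 0%N 0%N.
- move=> r rn; apply: (@cls_inj R P w1 du); rewrite ?(rep_ty interp_ty (rtb r)) //.
  rewrite (clsE (rtb r)) cls0; at_ 0%N 1%N 0%N w1 ud; rewrite bE // (ctx_opp interp_ty) (ctx_sum interp_ty).
  rewrite big1 ?oppr0 // => i _; rewrite (ctxE interp_ty) //=.
  by rewrite (t_btilde curl0 bubl (z_ge bubl)) // -ltnS.
- move=> r rn; apply: (@cls_inj R P du w1); rewrite ?(rep_ty interp_ty (rda r)) //.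
  by rewrite (clsE (rda r)) cls0 dxt 1?ltnW // ltn_eqF.
- move=> r r' rn rn'; apply: (@cls_inj R P w1 w1); rewrite ?(rep_ty interp_ty (rdb r r')) //.
    by case: ifP.
  rewrite (clsE (rdb r r')); at_ 0%N 1%N 0%N w1 ud; rewrite bE // (ctx_opp interp_ty) (ctx_sum interp_ty).
  have := d_btilde (z_conv bubl) rn' rn; rewrite [r' == r]eq_sym => e.
  transitivity (if r == r' then D w1 w1 [::] else 0); last first.
    by case: ifP => _; rewrite ?cls0 // (clsE (rep_id _ _ _)).
  by rewrite -e; congr (- _); apply: eq_bigr => i _; rewrite (ctxE interp_ty).
(* For [n = 0], [c' = t' t c' = t' c]. Otherwise only the summand [i = 0] of [btilde] at [n-1]
   survives, its bubble being the empty determinant 1. *)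
- case en : (n) => [|m].
    have rac : rep (Comp a c) w1 ud 1 [:: (0%N, aC); (0%N, aA)] by represent.
    apply: (rep_eqv interp_ty rc' rac); congr (_ *: _); rr aE 1%N 0%N.
    have := t_x_c' curl0 bubl (leqnn n); rewrite eqxx.
    have -> : aX n = aX 0 by rewrite en.
    rewrite (D_rw interp_ty x0 (i := 1) (p := 0)) //= => e.
    have tt0 : D ud ud [:: (0%N, aT); (0%N, aT')] = D ud ud [::].
      by rewrite tt' big1 ?addr0 // => -[r rn]; exfalso; rewrite en in rn.
    rr (esym e) 0%N 0%N; by rr tt0 1%N 0%N.
  have mn : (m < n)%N by rewrite en.
  apply: (@cls_inj R P w1 ud) => //; first by rewrite /= tb.
  rewrite clsZ // (clsE rc') (clsE (rb m)) bE // scaleN1r opprK big_ord_recl big1 ?addr0 => [|i _].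
    rewrite /= add0n.
    have e : D w1 w1 [:: (0%N, aZ m)] = D w1 w1 [::].
      by rewrite z_det // mn en /= subnn det_mx00 diagram.unlock.
    rr x0 1%N 0%N; by rr e 1%N 2%N.
  rewrite /= /bump /=; at_ 2%N 1%N 2%N w1 w1.
  by rewrite (z_ge bubl) ?(ctx_0 interp_ty) //; lia.
- apply: (rep_eqv interp_ty rd' (rda n)); congr (_ *: _).
  by rewrite dxt // eqxx.
Qed.


(** [t t' = 1] together with [d x^r t' = 0] forces [t' = a]. Then [d' = d x^n t'] is determined, and
    resolving [c'] as [a t c' + sum_r b_r d x^r c'] leaves [a c] if [n = 0] and [- b_(n-1)]
    otherwise. *)
Lemma P_unique : is_inverse n x s c d a b ->
  [/\ tcr' s c' d' ~~~ a, c' ~~~ (if n is m.+1 then Scal (-1) (b m) else Comp a c) &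
      d' ~~~ Comp (dr n) a].
Proof.
move=> /is_inverse_diagrams[invl inv_ta inv_tb inv_da inv_db].
have t't : D du du [:: (0%N, aT'); (0%N, aT)] = D du du [::].
  by rewrite -(clsE rt't) (eq_cls _ _ (relP (pP2 _ _ _ _ _ _ _))) (proj2 P2_rhs).
have et' : D du ud [:: (0%N, aT')] = D du ud [:: (0%N, aA)].
  apply: (jointly_monic invl (wt := du) (wd := w1)) => //= [|r rn].
    by rewrite t't inv_ta.
  by rewrite (d_x_t' curl0 bubl) 1?ltnW // ltn_eqF // inv_da.
split.
- by apply: (rep_eqv interp_ty rt' ra); congr (_ *: _).
- have e : D w1 ud [:: (0%N, aC')] = D w1 ud [:: (0%N, aC'); (0%N, aT); (0%N, aA)] +
    \sum_(r < n) D w1 ud [:: (0%N, aC'); (0%N, aX r); (0%N, aD); (0%N, aB r)].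
    exact: (resolve invl).
  have tc0 : D w1 du [:: (0%N, aC'); (0%N, aT)] = if n == 0%N then D w1 du [:: (0%N, aC)] else 0.
    rl (esym x0) 1%N 0%N; by rewrite (t_x_c' curl0 bubl) // eq_sym.
  have tca : D w1 ud [:: (0%N, aC'); (0%N, aT); (0%N, aA)] =
      if n == 0%N then D w1 ud [:: (0%N, aC); (0%N, aA)] else 0.
    at_ 0%N 2%N 0%N w1 du; rewrite tc0; by case: ifP => _; [lin | lin].
  have dc r : (r < n)%N -> D w1 ud [:: (0%N, aC'); (0%N, aX r); (0%N, aD); (0%N, aB r)] =
      if r.+1 == n then - D w1 ud [:: (0%N, aB r)] else 0.
    move=> rn; at_ 0%N 3%N 0%N w1 w1; rewrite bubl //; by case: ifP => _; [lin | lin].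
  case en : (n) => [|m].
    have rac : rep (Comp a c) w1 ud 1 [:: (0%N, aC); (0%N, aA)] by represent.
    apply: (rep_eqv interp_ty rc' rac); congr (_ *: _).
    by rewrite e tca en eqxx big_ord0 addr0.
  have mn : (m < n)%N by rewrite en.
  apply: (@cls_inj R P w1 ud) => //; first by rewrite /= tb.
  rewrite clsZ // (clsE rc') (clsE (rb m)) scaleN1r e tca {1}en /= add0r.
  rewrite (bigD1 (Ordinal mn)) //= dc // -en eqxx big1 ?addr0 // => -[r rn] /=.
  by rewrite -val_eqE /= => nrm; rewrite dc // en eqSS (negbTE nrm).
- have rn : rep (Comp (dr n) a) du w1 1 [:: (0%N, aA); (0%N, aX n); (0%N, aD)] by exact: rda.
  apply: (rep_eqv interp_ty rd' rn); congr (_ *: _); rr (esym et') 0%N 0%N.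
  by rewrite (d_x_t' curl0 bubl) // eqxx.
Qed.
End P_relations.
End Terms.
End Core.

(** * Typing of the composites and of both sides of the relations *)

Section Typing.
Variables (R : comPzRingType) (G : Type) (gty : G -> word * word).
Local Notation T := (tm R G).
Local Notation ty := (@Defs.ty R G gty).

(* Typing does not depend on relations, so this makes the typing lemmas above available
   before a presentation has been built. *)
Definition free_presentation : presentation R :=
  @Presentation R G gty (fun _ _ => False) (fun _ _ F => False_ind _ F).

Variables (x s c d c' d' : T) (k : int).
Hypotheses (tx : ty x = Some (up, up)) (ts : ty s = Some (uu, uu))
  (tc : ty c = Some (w1, du)) (td : ty d = Some (ud, w1)).

Lemma ty_xpow r : ty (xpow x r) = Some (up, up).
Proof. exact: (@ty_iter_Comp R free_presentation). Qed.

Lemma ty_tcr : ty (tcr s c d) = Some (ud, du).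
Proof. by rewrite /= ts tc td. Qed.

Lemma HA_rel_ty u v : HA_rel x s c d u v -> ty u = ty v.
Proof. by case; rewrite /= ?tx ?ts ?tc ?td. Qed.

Hypotheses (tc' : ty c' = Some (w1, ud)) (td' : ty d' = Some (du, w1)).

Lemma ty_tcr' : ty (tcr' s c' d') = Some (du, ud).
Proof. by rewrite /= ts tc' td'. Qed.

Lemma ty_bubL r : ty (bubL x c d' r) = Some (w1, w1).
Proof. by rewrite /= ty_xpow tc td'. Qed.

Lemma ty_bubR r : ty (bubR x d c' r) = Some (w1, w1).
Proof. by rewrite /= ty_xpow tc' td. Qed.

Lemma ty_tdet q (M : 'I_q -> 'I_q -> T) : (forall i j, ty (M i j) = Some (w1, w1)) ->
  ty (tdet M) = Some (w1, w1).
Proof. by move=> tM; apply: (proj1 (@cls_tdet R free_presentation q M tM)). Qed.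

Lemma ty_bubLZ r : ty (bubLZ k x c d c' d' r) = Some (w1, w1).
Proof.
rewrite /bubLZ; case: r => r; first exact: ty_bubL.
by case: ifP => // _; apply: ty_tdet => i j; apply: ty_bubR.
Qed.

Lemma ty_bubRZ r : ty (bubRZ k x c d c' d' r) = Some (w1, w1).
Proof.
rewrite /bubRZ; case: r => r; first exact: ty_bubR.
by case: ifP => // _; apply: ty_tdet => i j; apply: ty_bubL.
Qed.

Lemma ty_sum a b (l : seq T) : all (fun f => ty f == Some (a, b)) l ->
  ty (tsum a b l) = Some (a, b).
Proof. exact: (@ty_tsum R free_presentation). Qed.

Lemma ty_P1term i j : ty (Tens (Comp (Tens (xpow x i) (Id dn)) (Comp c' (Comp d (Tens (xpow x j) (Id dn)))))
  (bubLZ k x c d c' d' (- i%:Z - j%:Z - 2))) = Some (ud, ud).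
Proof. by rewrite /= !ty_xpow tc' td ty_bubLZ. Qed.

Lemma ty_P2term i j : ty (Tens (bubRZ k x c d c' d' (- i%:Z - j%:Z - 2))
  (Comp (Tens (Id dn) (xpow x j)) (Comp c (Comp d' (Tens (Id dn) (xpow x i)))))) = Some (du, du).
Proof. by rewrite /= !ty_xpow tc td' ty_bubRZ. Qed.

Lemma P_rel_ty u v : P_rel k x s c d c' d' u v -> ty u = ty v.
Proof.
case.
- rewrite (ty_Comp (P := free_presentation) ty_tcr' ty_tcr).
  rewrite (ty_Add (P := free_presentation) (a := ud) (b := ud)) //; apply: ty_sum.
  by apply/allP => f /allpairsP[[i j] [_ _ ->]]; rewrite ty_P1term.
- rewrite (ty_Comp (P := free_presentation) ty_tcr ty_tcr').
  rewrite (ty_Add (P := free_presentation) (a := du) (b := du)) //; apply: ty_sum.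
  by apply/allP => f /allpairsP[[i j] [_ _ ->]]; rewrite ty_P2term.
- by move=> _; rewrite /= td ts tc' /=; case: ifP.
- by move=> r _ _; rewrite ty_bubR; case: ifP.
- by move=> _; rewrite /= td' ts tc /=; case: ifP.
- by move=> r _ _; rewrite ty_bubL; case: ifP.
Qed.

End Typing.

Lemma ty_btilde (R : comPzRingType) (G : Type) (gty : G -> word * word)
    (x c d c' d' : tm R G) n r :
  ty gty x = Some (up, up) -> ty gty c = Some (w1, du) -> ty gty d = Some (ud, w1) ->
  ty gty c' = Some (w1, ud) -> ty gty d' = Some (du, w1) ->
  ty gty (btilde n x c d c' d' r) = Some (w1, ud).
Proof.
move=> tx tc td tc' td'; rewrite /btilde; set l := [seq _ | i <- _].
suff tl : all (fun f => ty gty f == Some (w1, ud)) l by rewrite -(ty_sum tl).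
by apply/allP => f /mapP[i _ ->]; rewrite /= ty_xpow // tc' ty_bubLZ.
Qed.

(** * Strict linear functors given on generators *)

Section Functor.
Variables (R : comPzRingType) (P1 P2 : presentation R).
Variable phi : gen P1 -> tm R (gen P2).
Local Notation ty1 := (@Defs.ty R (gen P1) (@gen_ty R P1)).
Local Notation ty2 := (@Defs.ty R (gen P2) (@gen_ty R P2)).
Hypothesis phi_ty : forall g, ty2 (phi g) = Some (gen_ty g).
Local Notation F := (fmap phi).

Lemma ty_fmap f : ty2 (F f) = ty1 f.
Proof. by elim: f => //= [f -> g ->|f -> g ->|f -> g ->]. Qed.

Lemma wt_fmap f : wt (@gen_ty R P2) (F f) = wt (@gen_ty R P1) f.
Proof. by rewrite /wt ty_fmap. Qed.

Lemma fmap_peqv : (forall f g, rel_of f g -> peqv (F f) (F g)) ->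
  forall f g, peqv f g -> peqv (F f) (F g).
Proof.
move=> Hrel f g; elim=> {f g} /=.
- by move=> f; apply: e_refl.
- by move=> f g _; apply: e_sym.
- by move=> f g h _ fg _; apply: e_trans fg.
- exact: Hrel.
- by move=> f f' g g' _ ff _ gg; apply: e_comp.
- by move=> f f' g g' _ ff _ gg; apply: e_tens.
- by move=> f f' g g' _ ff _ gg; apply: e_add.
- by move=> r f f' _ ff; apply: e_scal.
- by move=> f g h; rewrite -wt_fmap; apply: e_comp_assoc.
- by move=> f a b; rewrite -ty_fmap; apply: e_comp_idl.
- by move=> f a b; rewrite -ty_fmap; apply: e_comp_idr.
- by move=> f g h; rewrite -!wt_fmap; apply: e_tens_assoc.
- by move=> f; rewrite -wt_fmap; apply: e_tens_idl.
- by move=> f; rewrite -wt_fmap; apply: e_tens_idr.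
- by move=> v w; apply: e_tens_id.
- by move=> f g f' g'; rewrite -!wt_fmap; apply: e_interchange.
- by move=> f g h; rewrite -wt_fmap; apply: e_add_assoc.
- by move=> f g; rewrite -wt_fmap; apply: e_add_comm.
- by move=> f a b; rewrite -ty_fmap; apply: e_add0.
- by move=> f; rewrite -wt_fmap; apply: e_scal1.
- by move=> f a b; rewrite -ty_fmap; apply: e_scal0.
- by move=> a b f; rewrite -wt_fmap; apply: e_scalM.
- by move=> a b f; rewrite -wt_fmap; apply: e_scalDl.
- by move=> a f g; rewrite -wt_fmap; apply: e_scalDr.
- by move=> f g h; rewrite -wt_fmap; apply: e_compDl.
- by move=> f g h; rewrite -wt_fmap; apply: e_compDr.
- by move=> a f g; rewrite -wt_fmap; apply: e_compZl.
- by move=> a f g; rewrite -wt_fmap; apply: e_compZr.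
- by move=> f g h; rewrite -wt_fmap; apply: e_tensDl.
- by move=> f g h; rewrite -wt_fmap; apply: e_tensDr.
- by move=> a f g; rewrite -wt_fmap; apply: e_tensZl.
- by move=> a f g; rewrite -wt_fmap; apply: e_tensZr.
Qed.

Lemma fmap_gen_peqv (psi : gen P2 -> tm R (gen P1)) :
  (forall g, peqv (fmap psi (phi g)) (Gen g)) -> forall f, peqv (fmap psi (F f)) f.
Proof.
move=> Hg; elim=> //= [f Hf g Hg'|f Hf g Hg'|f Hf g Hg'|r f Hf]; first [exact: peqvv |
 exact: e_comp | exact: e_tens | exact: e_add | exact: e_scal].
Qed.
End Functor.

(** * Images of bubbles and relations under a functor *)

Section FunctorImages.
Variables (R : comPzRingType) (G1 G2 : Type) (phi : G1 -> tm R G2).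
Local Notation F := (fmap phi).

Lemma fmap_tsum a b l : F (tsum a b l) = tsum a b (map F l).
Proof. by elim: l => //= f l ->. Qed.

Lemma fmap_tprod l : F (tprod l) = tprod (map F l).
Proof. by elim: l => //= f l ->. Qed.

Lemma fmap_tdet q (M : 'I_q -> 'I_q -> tm R G1) : F (tdet M) = tdet (fun i j => F (M i j)).
Proof.
rewrite /tdet fmap_tsum -map_comp; congr tsum; apply: eq_map => sg /=.
by rewrite fmap_tprod -map_comp.
Qed.

Variables (x s c d c' d' : tm R G1) (k : int).

Lemma fmap_xpow r : F (xpow x r) = xpow (F x) r.
Proof. by elim: r => //= r ->. Qed.

Lemma fmap_bubL r : F (bubL x c d' r) = bubL (F x) (F c) (F d') r.
Proof. by rewrite /= fmap_xpow. Qed.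

Lemma fmap_bubR r : F (bubR x d c' r) = bubR (F x) (F d) (F c') r.
Proof. by rewrite /= fmap_xpow. Qed.

Lemma fmap_bubLZ r :
  F (bubLZ k x c d c' d' r) = bubLZ k (F x) (F c) (F d) (F c') (F d') r.
Proof.
rewrite /bubLZ; case: r => r; first exact: fmap_bubL.
by case: ifP => // _; rewrite fmap_tdet; congr tdet; do 2!apply: funext => ?; apply: fmap_bubR.
Qed.

Lemma fmap_bubRZ r :
  F (bubRZ k x c d c' d' r) = bubRZ k (F x) (F c) (F d) (F c') (F d') r.
Proof.
rewrite /bubRZ; case: r => r; first exact: fmap_bubR.
case: ifP => // _ /=; rewrite fmap_tdet; congr (Scal _ (tdet _)).
by do 2!apply: funext => ?; rewrite -fmap_bubL.
Qed.

Lemma fmap_HA_rel u v : HA_rel x s c d u v -> HA_rel (F x) (F s) (F c) (F d) (F u) (F v).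
Proof. by case; constructor. Qed.

Lemma fmap_P_rel u v : P_rel k x s c d c' d' u v ->
  P_rel k (F x) (F s) (F c) (F d) (F c') (F d') (F u) (F v).
Proof.
case.
- cbn [fmap]; rewrite fmap_tsum map_allpairs.
  under eq_allpairs => i j do (cbn [fmap]; rewrite !fmap_xpow fmap_bubLZ).
  exact: pP1.
- cbn [fmap]; rewrite fmap_tsum map_allpairs.
  under eq_allpairs => i j do (cbn [fmap]; rewrite !fmap_xpow fmap_bubRZ).
  exact: pP2.
- by move=> k0; rewrite (fun_if F); apply: pP3a.
- by move=> r k0 rk; rewrite (fun_if F) fmap_bubR; apply: pP3b.
- by move=> k0; rewrite (fun_if F); apply: pP4a.
- by move=> r k0 rk; rewrite (fun_if F) fmap_bubL; apply: pP4b.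
Qed.

End FunctorImages.
Lemma fmap_btilde (R : comPzRingType) (G1 G2 : Type) (phi : G1 -> tm R G2)
    (x c d c' d' : tm R G1) n r (F := fmap phi) :
  F (btilde n x c d c' d' r) = btilde n (F x) (F c) (F d) (F c') (F d') r.
Proof.
rewrite /F /btilde; cbn [fmap]; rewrite fmap_tsum -map_comp; congr (Scal _ (tsum _ _ _)).
by apply: eq_map => i; rewrite /comp; cbn [fmap]; rewrite fmap_xpow fmap_bubLZ.
Qed.

(** * The two presentations of the Heisenberg category *)

Section Presentations.
Variables (R : comPzRingType) (k : int).
Local Notation tyh := (@tyH R k).

Lemma ty_hdr r : tyh (hdr R k r) = Some (ud, w1).
Proof. by rewrite /tyH /= ty_xpow. Qed.

Lemma ty_hcr r : tyh (hcr R k r) = Some (w1, du).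
Proof. by rewrite /tyH /= ty_xpow. Qed.

Lemma inv_rel_ty u v : @inv_rel R k u v -> tyh u = tyh v.
Proof.
rewrite /tyH; case=> [k0|k0|r k0|r k0|r r' k0|k0|k0|r k0|r k0|r r' k0] //.
- apply: (ty_Add (P := free_presentation R (@hgty k))) => //; apply: ty_sum.
  by apply/allP => f /mapP[r _ ->]; rewrite /= k0 ty_xpow.
- by rewrite /= k0.
- by rewrite /= ty_xpow.
- by rewrite /= k0 ty_xpow //=; case: ifP.
- apply: (ty_Add (P := free_presentation R (@hgty k))) => //; apply: ty_sum.
  by apply/allP => f /mapP[r _ ->]; rewrite /= leNgt k0 /= ty_xpow.
- by rewrite /= ty_xpow.
- by rewrite /= leNgt k0.
- by rewrite /= leNgt k0 /= ty_xpow //=; case: ifP.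
Qed.

Lemma heis_rel_ty (u v : tm R (hgen `|k|)) : heis_rel u v -> ty (@hgty k) u = ty (@hgty k) v.
Proof. by case=> [|/inv_rel_ty //]; apply: HA_rel_ty. Qed.

Lemma alt_rel_ty (u v : tm R agen) : alt_rel k u v -> ty agty u = ty agty v.
Proof. by case; [apply: HA_rel_ty|apply: P_rel_ty]. Qed.

Definition heis := @Presentation R (hgen `|k|) (@hgty k) (@heis_rel R k) heis_rel_ty.
Definition alt := @Presentation R agen agty (@alt_rel R k) alt_rel_ty.
End Presentations.

(** * The theorem for nonnegative charge *)

Section Nonnegative.
Variables (R : comPzRingType) (n : nat).
Local Notation k := (Posz n).
Local Notation HT := (tm R (hgen n)).
Local Notation AT := (tm R agen).
Local Notation heqv := (@peqv R (heis R k)).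
Local Notation aeqv := (@peqv R (alt R k)).

(** Extended by zero beyond [n], to fit the indexing by naturals in [is_inverse]. *)
Definition hB (r : nat) : HT := oapp (fun i : 'I_n => Gen (HB i)) (Zero w1 ud) (insub r).

Lemma hBE (r : 'I_n) : hB r = Gen (HB r).
Proof. by rewrite /hB valK. Qed.

Lemma ty_hB r : ty (@hgty k) (hB r) = Some (w1, ud).
Proof. by rewrite /hB; case: insubP. Qed.

Lemma heis_is_inverse : @is_inverse R (heis R k) n (hX R k) (hS R k) (hC R k) (hD R k) (Gen HA) hB.
Proof.
have rel (u v : HT) : @inv_rel R k u v -> heqv u v by move=> uv; apply: e_rel; right.
split.
- apply: e_trans (rel _ _ (@iP1 R k isT)).
  suff -> : [seq Comp (hB r) (Comp (hD R k) (Tens (xpow (hX R k) r) (Id dn))) | r : 'I_n] =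
      [seq Comp (Gen (HB r)) (hdr R k r) | r : 'I_n] by apply: e_refl.
  by apply: eq_map => r; rewrite hBE.
- exact: (rel _ _ (@iP2 R k isT)).
- by move=> r rn; rewrite -[r]/(val (Ordinal rn)) hBE; apply: (rel _ _ (@iP3 R k _ isT)).
- by move=> r rn; rewrite -[r]/(val (Ordinal rn)); apply: (rel _ _ (@iP4 R k _ isT)).
- move=> r r' rn rn'; rewrite -[r]/(val (Ordinal rn)) -[r']/(val (Ordinal rn')) hBE.
  exact: (rel _ _ (@iP5 R k _ _ isT)).
Qed.

Definition pos_c' : HT := if n is m.+1 then Scal (-1) (hB m) else Comp (Gen HA) (hC R k).
Definition pos_d' : HT := Comp (hdr R k n) (Gen HA).

Lemma ty_pos_c' : ty (@hgty k) pos_c' = Some (w1, ud).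
Proof. by rewrite /pos_c'; case: n hB ty_hB => [|m] //= b tb; rewrite tb. Qed.

Lemma ty_pos_d' : ty (@hgty k) pos_d' = Some (du, w1).
Proof. by rewrite /pos_d' /= ty_xpow. Qed.

Lemma heis_HA (u v : HT) : HA_rel (hX R k) (hS R k) (hC R k) (hD R k) u v -> heqv u v.
Proof. by move=> uv; apply: e_rel; left. Qed.

Lemma alt_HA (u v : AT) : HA_rel (Gen AX) (Gen AS) (Gen Defs.AC) (Gen AD) u v -> aeqv u v.
Proof. by move=> uv; apply: e_rel; left. Qed.

Lemma alt_P (u v : AT) :
  P_rel k (Gen AX) (Gen AS) (Gen Defs.AC) (Gen AD) (Gen AC') (Gen AD') u v -> aeqv u v.
Proof. by move=> uv; apply: e_rel; right. Qed.

Let pos_P := is_inverse_P (P := heis R k) (x := hX R k) (s := hS R k) (c := hC R k)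
  (d := hD R k) (a := Gen HA) (b := hB) erefl erefl erefl erefl ty_pos_c' ty_pos_d' erefl ty_hB
  (fun r => ty_bubLZ (gty := @hgty k) (x := hX R k) (c := hC R k) (d := hD R k) k
    erefl erefl erefl ty_pos_c' ty_pos_d' (- r%:Z - 2))
  heis_HA (fun _ => erefl) heis_is_inverse (e_refl _ _ _) (e_refl _ _ _).

Lemma pos_unique (c'' d'' : HT) : tyH (k := k) c'' = Some (w1, ud) -> tyH (k := k) d'' = Some (du, w1) ->
  satisfies_P (k := k) c'' d'' -> eqvH (k := k) c'' pos_c' /\ eqvH (k := k) d'' pos_d'.
Proof.
move=> tc' td' relP.
by have [] := P_unique (P := heis R k) (x := hX R k) (s := hS R k) (c := hC R k)
  (d := hD R k) (a := Gen HA) (b := hB) (z := fun _ => Id w1) erefl erefl erefl erefl tc' td'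
  erefl ty_hB (fun _ => erefl) heis_HA relP heis_is_inverse.
Qed.

(** The inverse functor: [HA] and [HB] go to the entries of the inverse that can be read off (P1)
    and (P2). *)
Definition altG (g : hgen n) : AT :=
  match g with
  | HX => Gen AX | HS => Gen AS | HC => Gen Defs.AC | HD => Gen AD
  | HA => tcr' (Gen AS) (Gen AC') (Gen AD')
  | HB r => btilde n (Gen AX) (Gen Defs.AC) (Gen AD) (Gen AC') (Gen AD') r
  end.

Lemma ty_altG (g : hgen n) : ty agty (altG g) = Some (@hgty k g).
Proof. by case: g => // r; apply: ty_btilde. Qed.

Let alt_b := btilde n (Gen AX : AT) (Gen Defs.AC) (Gen AD) (Gen AC') (Gen AD').

Let alt_is_inverse := P_is_inverse (P := alt R k) (x := Gen AX) (s := Gen AS) (c := Gen Defs.AC)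
  (d := Gen AD) (c' := Gen AC') (d' := Gen AD') (a := tcr' (Gen AS) (Gen AC') (Gen AD')) (b := alt_b)
  erefl erefl erefl erefl erefl erefl erefl (fun r => ty_btilde (gty := agty) (x := Gen AX) (c := Gen Defs.AC) (d := Gen AD)
    (c' := Gen AC') (d' := Gen AD') n r erefl erefl erefl erefl erefl)
  (fun r => ty_bubLZ (gty := agty) (x := Gen AX) (c := Gen Defs.AC) (d := Gen AD)
    (c' := Gen AC') (d' := Gen AD') k erefl erefl erefl erefl erefl (- r%:Z - 2))
  alt_HA (fun _ => erefl) alt_P (e_refl _ _ _) (fun r _ => e_refl _ _ _).

Local Notation F := (fmap (altF (k := k) pos_c' pos_d')).
Local Notation Gf := (fmap altG).

Lemma altG_peqv (u v : HT) : heqv u v -> aeqv (Gf u) (Gf v).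
Proof.
have [[i1 i2 i3 i4 i5] _ _] := alt_is_inverse.
apply: (@fmap_peqv R (heis R k) (alt R k) altG ty_altG) => {}u {}v [HA|].
  by apply: alt_HA; have := fmap_HA_rel altG HA.
have Gx r : Gf (xpow (hX R k) r) = xpow (Gen AX) r by rewrite fmap_xpow.
case=> //.
- move=> _; apply: e_trans i1; cbn [fmap]; rewrite fmap_tsum -map_comp.
  rewrite (eq_map (g := fun r : 'I_n => Comp (alt_b r) (Comp (Gen AD) (Tens (xpow (Gen AX) r) (Id dn))))); first exact: e_refl.
  by move=> r; rewrite /comp /hdr; cbn [fmap]; rewrite Gx.
- by move=> r _; apply: i3.
- by move=> r _; rewrite /hdr; cbn [fmap]; rewrite Gx; apply: i4.
- move=> r r' _; rewrite /hdr; cbn [fmap]; rewrite Gx (fun_if Gf).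
  exact: i5.
Qed.

(** It suffices to check generators, and the adjoined ones are covered by [t' = a] and
    [b = btilde]. *)
Lemma FG_peqv (u : HT) : heqv (F (Gf u)) u.
Proof.
have [_ et eb] := pos_P.
apply: (@fmap_gen_peqv R (heis R k) (alt R k) altG (altF (k := k) pos_c' pos_d')) => -[|||||r]; try exact: peqvv.
  exact: et.
rewrite [altG _]/= fmap_btilde -hBE; apply: e_sym; exact: eb.
Qed.

Lemma ty_altF g : ty (@hgty k) (altF (k := k) pos_c' pos_d' g) = Some (agty g).
Proof. by case: g => //; [exact: ty_pos_c'|exact: ty_pos_d']. Qed.

Lemma altF_peqv (u v : AT) : aeqv u v -> heqv (F u) (F v).
Proof.
apply: (@fmap_peqv R (alt R k) (heis R k) (altF (k := k) pos_c' pos_d') ty_altF) => {}u {}v [HA|HP].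
  exact: heis_HA (fmap_HA_rel (altF (k := k) pos_c' pos_d') HA).
have [relP _ _] := pos_P.
exact: relP (fmap_P_rel (altF (k := k) pos_c' pos_d') HP).
Qed.

Lemma GF_peqv (u : AT) : aeqv (Gf (F u)) u.
Proof.
have [_ ec' ed'] := alt_is_inverse.
apply: (@fmap_gen_peqv R (alt R k) (heis R k) (altF (k := k) pos_c' pos_d') altG) => -[]; try exact: peqvv.
  apply: e_sym; apply: e_trans ec' _; rewrite [altF _ _ _]/= /pos_c'.
  have GB r : (r < n)%N -> Gf (hB r) = alt_b r.
    by move=> rn; rewrite -[r]/(val (Ordinal rn)) hBE.
  (* [n] also occurs in the type of the terms, so the case analysis is made on a separate [q]. *)
  have eG q : (q <= n)%N -> Gf (if q is m.+1 then Scal (-1) (hB m) else Comp (Gen HA) (hC R k)) =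
      if q is m.+1 then Scal (-1) (alt_b m) else Comp (tcr' (Gen AS) (Gen AC') (Gen AD')) (Gen Defs.AC).
    by case: q => // m mn; cbn [fmap]; rewrite GB.
  by rewrite (eG n (leqnn n)); apply: e_refl.
apply: e_sym; apply: e_trans ed' _; rewrite [altF _ _ _]/= /pos_d' /hdr; cbn [fmap].
by rewrite fmap_xpow; apply: e_refl.
Qed.

Lemma pos_iso : altF_iso (k := k) pos_c' pos_d'.
Proof.
split.
- exact: altF_peqv.
- move=> u a b tu; rewrite -tu.
  exact: (@ty_fmap R (alt R k) (heis R k) (altF (k := k) pos_c' pos_d') ty_altF u).
- move=> f a b tf; exists (Gf f); last exact: FG_peqv.
  rewrite -tf; exact: (@ty_fmap R (heis R k) (alt R k) altG ty_altG f).
- move=> u v a b _ _ /altG_peqv e.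
  exact: e_trans (e_sym (GF_peqv u)) (e_trans e (GF_peqv v)).
Qed.

Lemma pos_satisfies_P : satisfies_P (k := k) pos_c' pos_d'.
Proof. by have [] := pos_P. Qed.

End Nonnegative.

(** * Duality: functors reversing both composition and tensor product *)

Fixpoint dmap (R : comPzRingType) (G1 G2 : Type) (phi : G1 -> tm R G2) (f : tm R G1) : tm R G2 :=
  match f with
  | Gen g => phi g
  | Id w => Id (rev w)
  | Comp f g => Comp (dmap phi g) (dmap phi f)
  | Tens f g => Tens (dmap phi g) (dmap phi f)
  | Zero a b => Zero (rev b) (rev a)
  | Add f g => Add (dmap phi f) (dmap phi g)
  | Scal a f => Scal a (dmap phi f)
  end.

Definition dual_ty (p : word * word) : word * word := (rev p.2, rev p.1).

Section Dual.
Variables (R : comPzRingType) (P1 P2 : presentation R).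
Variable phi : gen P1 -> tm R (gen P2).
Local Notation ty1 := (@Defs.ty R (gen P1) (@gen_ty R P1)).
Local Notation ty2 := (@Defs.ty R (gen P2) (@gen_ty R P2)).
Hypothesis phi_ty : forall g, ty2 (phi g) = Some (dual_ty (gen_ty g)).
Local Notation F := (dmap phi).

Let rev_eq (v w : word) : (rev v == rev w) = (v == w).
Proof. by rewrite (inj_eq (can_inj revK)). Qed.

Lemma ty_dmap f : ty2 (F f) = omap dual_ty (ty1 f).
Proof.
elim: f => //= [f -> g ->|f -> g ->|f -> g ->].
- case: (ty1 f) => [[a b]|]; case: (ty1 g) => [[c d]|] //=.
  by rewrite rev_eq eq_sym; case: ifP.
- by case: (ty1 f) => [[a b]|]; case: (ty1 g) => [[c d]|] //=; rewrite /dual_ty /= !rev_cat.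
- case: (ty1 f) => [[a b]|]; case: (ty1 g) => [[c d]|] //=.
  by rewrite /dual_ty /= !xpair_eqE !rev_eq andbC; case: ifP.
Qed.

Lemma wt_dmap f : wt (@gen_ty R P2) (F f) = wt (@gen_ty R P1) f.
Proof. by rewrite /wt ty_dmap; case: (ty1 f). Qed.

Let tyF f a b : ty1 f = Some (a, b) -> ty2 (F f) = Some (rev b, rev a).
Proof. by rewrite ty_dmap => ->. Qed.

(** The axioms are closed under reversal: left and right unit, distributive and scalar laws are
    exchanged, associativity and interchange return to themselves. *)
Lemma dmap_peqv : (forall f g, rel_of f g -> peqv (F f) (F g)) ->
  forall f g, peqv f g -> peqv (F f) (F g).
Proof.
move=> Hrel f g; elim=> {f g} /=.
- by move=> f; apply: e_refl.
- by move=> f g _; apply: e_sym.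
- by move=> f g h _ fg _; apply: e_trans fg.
- exact: Hrel.
- by move=> f f' g g' _ ff _ gg; apply: e_comp.
- by move=> f f' g g' _ ff _ gg; apply: e_tens.
- by move=> f f' g g' _ ff _ gg; apply: e_add.
- by move=> r f f' _ ff; apply: e_scal.
- move=> f g h ok; apply: e_sym; apply: e_comp_assoc.
  rewrite -[Comp _ _]/(F (Comp (Comp f g) h)) wt_dmap.
  by rewrite /wt -(peqv_ty (P := P1) (e_comp_assoc _ ok)); exact: ok.
- by move=> f a b /tyF; apply: e_comp_idr.
- by move=> f a b /tyF; apply: e_comp_idl.
- by move=> f g h wf wg wh; apply: e_sym; apply: e_tens_assoc; rewrite wt_dmap.
- by move=> f; rewrite -wt_dmap; apply: e_tens_idr.
- by move=> f; rewrite -wt_dmap; apply: e_tens_idl.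
- by move=> v w; rewrite rev_cat; apply: e_tens_id.
- move=> f g f' g' w1 w2; apply: e_interchange.
    by rewrite -[Comp _ _]/(F (Comp g g')) wt_dmap.
  by rewrite -[Comp _ _]/(F (Comp f f')) wt_dmap.
- by move=> f g h; rewrite -wt_dmap; apply: e_add_assoc.
- by move=> f g; rewrite -wt_dmap; apply: e_add_comm.
- by move=> f a b /tyF; apply: e_add0.
- by move=> f; rewrite -wt_dmap; apply: e_scal1.
- by move=> f a b /tyF; apply: e_scal0.
- by move=> a b f; rewrite -wt_dmap; apply: e_scalM.
- by move=> a b f; rewrite -wt_dmap; apply: e_scalDl.
- by move=> a f g; rewrite -wt_dmap; apply: e_scalDr.
- by move=> f g h; rewrite -wt_dmap; apply: e_compDr.
- by move=> f g h; rewrite -wt_dmap; apply: e_compDl.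
- by move=> a f g; rewrite -wt_dmap; apply: e_compZr.
- by move=> a f g; rewrite -wt_dmap; apply: e_compZl.
- by move=> f g h; rewrite -wt_dmap; apply: e_tensDr.
- by move=> f g h; rewrite -wt_dmap; apply: e_tensDl.
- by move=> a f g; rewrite -wt_dmap; apply: e_tensZr.
- by move=> a f g; rewrite -wt_dmap; apply: e_tensZl.
Qed.
End Dual.

Section DualComposites.
Variables (R : comPzRingType) (P : presentation R).

Lemma dmap_dmap_peqv (G : Type) (phi : gen P -> tm R G) (psi : G -> tm R (gen P)) :
  (forall g, peqv (dmap psi (phi g)) (Gen g)) -> forall f, peqv (dmap psi (dmap phi f)) f.
Proof.
move=> Hg; elim=> [g|w|f Hf g Hg'|f Hf g Hg'|a b|f Hf g Hg'|r f Hf] /=; first exact: Hg.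
all: rewrite ?revK; first [exact: peqvv | exact: e_comp | exact: e_tens | exact: e_add | exact: e_scal].
Qed.

Lemma dmap_fmap_peqv (G1 G2 G3 : Type) (phi : G1 -> tm R G2) (psi : G2 -> tm R (gen P))
    (phi' : G1 -> tm R G3) (psi' : G3 -> tm R (gen P)) :
  (forall g, peqv (dmap psi (phi g)) (fmap psi' (phi' g))) ->
  forall f, peqv (dmap psi (fmap phi f)) (fmap psi' (dmap phi' f)).
Proof.
move=> Hg; elim=> [g|w|f Hf g Hg'|f Hf g Hg'|a b|f Hf g Hg'|r f Hf] /=; first exact: Hg.
all: first [exact: peqvv | exact: e_comp | exact: e_tens | exact: e_add | exact: e_scal].
Qed.

Lemma dmap_tsum (G1 G2 : Type) (phi : G1 -> tm R G2) a b l :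
  dmap phi (tsum a b l) = tsum (rev b) (rev a) (map (dmap phi) l).
Proof. by elim: l => //= f l ->. Qed.

Lemma tsum_map_peqv (I : Type) (f g : I -> tm R (gen P)) a b (l : seq I) :
  (forall i, peqv (f i) (g i)) -> peqv (tsum a b (map f l)) (tsum a b (map g l)).
Proof. by move=> fg; elim: l => [|i l IH] /=; [exact: peqvv|exact: e_add (fg i) IH]. Qed.

Lemma tsum_allpairs_peqv (I J : Type) (f g : I -> J -> tm R (gen P)) a b (l : seq I) (m : seq J) :
  (forall i j, peqv (f i j) (g i j)) ->
  peqv (tsum a b [seq f i j | i <- l, j <- m]) (tsum a b [seq g i j | i <- l, j <- m]).
Proof.
move=> fg; have := @tsum_map_peqv _ (fun p => f p.1 p.2) (fun p => g p.1 p.2) a b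
  [seq (i, j) | i <- l, j <- m] (fun p => fg _ _).
by rewrite !map_allpairs.
Qed.

Lemma neg_neg (f : tm R (gen P)) : wt (@gen_ty R P) f -> peqv (Scal (-1) (Scal (-1) f)) f.
Proof.
move=> wf; transitivity (Scal (-1 * -1) f); first exact: e_scalM.
by rewrite mulN1r opprK; apply: e_scal1.
Qed.

Lemma neg_zero a b : peqv (Scal (-1) (Zero a b : tm R (gen P))) (Zero a b).
Proof.
have z0 : peqv (Zero a b : tm R (gen P)) (Scal 0 (Zero a b)) by apply: e_sym; apply: e_scal0.
transitivity (Scal (-1) (Scal 0 (Zero a b) : tm R (gen P))); first exact: e_scal.
transitivity (Scal (-1 * 0) (Zero a b) : tm R (gen P)); first exact: e_scalM.
by rewrite mulr0; apply: e_scal0.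
Qed.

Lemma comp_neg_neg (f g : tm R (gen P)) : wt (@gen_ty R P) (Comp f g) ->
  peqv (Comp (Scal (-1) f) (Scal (-1) g)) (Comp f g).
Proof.
move=> w; transitivity (Scal (-1) (Comp f (Scal (-1) g))); first by apply: e_compZl.
transitivity (Scal (-1) (Scal (-1) (Comp f g))); last exact: neg_neg.
by apply: e_scal; apply: e_compZr.
Qed.

Lemma tens_neg_neg (f g : tm R (gen P)) p q : ty (@gen_ty R P) f = Some p ->
  ty (@gen_ty R P) g = Some q -> peqv (Tens (Scal (-1) f) (Scal (-1) g)) (Tens f g).
Proof.
case: p q => [? ?] [? ?] tf tg.
transitivity (Scal (-1) (Tens f (Scal (-1) g))).
  by apply: e_tensZl; rewrite /wt /= tf tg.
transitivity (Scal (-1) (Scal (-1) (Tens f g))).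
  by apply: e_scal; apply: e_tensZr; rewrite /wt /= tf tg.
by apply: neg_neg; rewrite /wt /= tf tg.
Qed.

(** Reversal turns the factors around; commutativity of the endomorphisms of the unit restores their
    order, so determinants are preserved. *)
Lemma cls_dmap_tprod (G : Type) (phi : G -> tm R (gen P)) (l : seq (tm R G)) :
  all (fun f => ty (@gen_ty R P) (dmap phi f) == Some (w1, w1)) l ->
  ty (@gen_ty R P) (dmap phi (tprod l)) = Some (w1, w1) /\
  cls w1 w1 (dmap phi (tprod l)) = \prod_(f <- l) (cls w1 w1 (dmap phi f) : bubbles P).
Proof.
elim: l => [|f l IH] /=; first by rewrite big_nil.
move=> /andP[/eqP tf /IH[tl cl]]; rewrite tf tl; split=> //.
by rewrite big_cons -cl cls_comp // mulrC.
Qed.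

Lemma dmap_tdet (G : Type) (phi : G -> tm R (gen P)) q (M : 'I_q -> 'I_q -> tm R G)
    (N : 'I_q -> 'I_q -> tm R (gen P)) :
  (forall i j, ty (@gen_ty R P) (N i j) = Some (w1, w1)) ->
  (forall i j, peqv (dmap phi (M i j)) (N i j)) -> peqv (dmap phi (tdet M)) (tdet N).
Proof.
move=> tN MN; have tM i j : ty (@gen_ty R P) (dmap phi (M i j)) = Some (w1, w1).
  by rewrite (peqv_ty (MN i j)).
rewrite {1}/tdet dmap_tsum -map_comp; apply: tsum_map_peqv => sg /=; apply: e_scal.
have tMs : all (fun f => ty (@gen_ty R P) (dmap phi f) == Some (w1, w1))
    [seq M i (fun_of_perm sg i) | i : 'I_q].
  by apply/allP => f /mapP[i _ ->]; apply/eqP.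
have tNs : all (fun f => ty (@gen_ty R P) f == Some (w1, w1)) [seq N i (fun_of_perm sg i) | i : 'I_q].
  by apply/allP => f /mapP[i _ ->]; apply/eqP.
have [t1 c1] := cls_dmap_tprod tMs; have [t2 c2] := cls_tprod tNs.
apply: (cls_inj t1 t2); rewrite c1 c2 !big_map; apply: eq_bigr => i _.
exact: eq_cls.
Qed.
End DualComposites.

(** * Behaviour of the relations under duality *)

Section DualRelations.
Variables (R : comPzRingType) (P : presentation R) (G : Type) (phi : G -> tm R (gen P)).
Local Notation T := (tm R (gen P)).
Local Notation ty := (@Defs.ty R (gen P) (@gen_ty R P)).
Local Notation "f ~~~ g" := (peqv f g) (at level 70).
Local Notation F := (dmap phi).
Variables (X S C D C' D' : tm R G) (x s c d c' d' : T).
Hypotheses (tx : ty x = Some (up, up)) (ts : ty s = Some (uu, uu))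
  (tc : ty c = Some (w1, du)) (td : ty d = Some (ud, w1))
  (tc' : ty c' = Some (w1, ud)) (td' : ty d' = Some (du, w1)).
Hypotheses (dX : F X ~~~ x) (dS : F S ~~~ Scal (-1) s) (dC : F C ~~~ d) (dD : F D ~~~ c).

Let I := interp x s c d c' d' (Zero du ud) (fun _ => Zero w1 ud) (fun _ => Id w1).
Let tyI g : ty (I g) = Some (aty g).
Proof. exact: interp_ty. Qed.
Local Notation rep := (rep aty I).

Let rX r : rep (xpow x r) up up 1 [:: (0%N, aX r)] := rep_atom tyI (aX r).
Let rs : rep s uu uu 1 [:: (0%N, aS)] := rep_atom tyI aS.
Let rc : rep c w1 du 1 [:: (0%N, aC)] := rep_atom tyI aC.
Let rd : rep d ud w1 1 [:: (0%N, aD)] := rep_atom tyI aD.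
Let rc' : rep c' w1 ud 1 [:: (0%N, aC')] := rep_atom tyI aC'.
Let rd' : rep d' du w1 1 [:: (0%N, aD')] := rep_atom tyI aD'.
Let rFS : rep (F S) uu uu (-1) [:: (0%N, aS)].
Proof. by have := rep_scal tyI (-1) rs; rewrite mulr1 => h; apply: rep_peqv h dS. Qed.
Let rFC : rep (F C) ud w1 1 [:: (0%N, aD)] := rep_peqv rd dC.
Let rFD : rep (F D) w1 du 1 [:: (0%N, aC)] := rep_peqv rc dD.
Let rX1 : rep x up up 1 [:: (0%N, aX 1)].
Proof. apply: rep_peqv (rX 1) _; symmetry; apply: comp_idr tx. Qed.
Let rFX : rep (F X) up up 1 [:: (0%N, aX 1)] := rep_peqv rX1 dX.

Let tyx r : ty (xpow x r) = Some (up, up). Proof. exact: ty_xpow. Qed.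

Lemma dmap_xpow r : F (xpow X r) ~~~ xpow x r.
Proof.
elim: r => [|r IH]; first exact: peqvv.
(* Reversal puts the new factor [x] on the wrong side of [x^r]; the inner induction moves it
   across. *)
rewrite /= -/(xpow _ _) IH dX -/(xpow x r) {IH}; elim: r => [|r IH].
  by rewrite /= (comp_idl tx) (comp_idr tx).
rewrite {1}/xpow [iter _ _ _]/= -/(xpow x r) -(tcompA tx (tyx r) tx) IH.
exact: peqvv.
Qed.

Let rFX_ r : rep (F (xpow X r)) up up 1 [:: (0%N, aX r)] := rep_peqv (rX r) (dmap_xpow r).

Ltac prep := lazymatch goal with
  | |- rep (Comp _ _) _ _ _ _ => eapply (rep_comp_eq tyI); [prep | prep | reflexivity]
  | |- rep (Tens _ _) _ _ _ _ => eapply (rep_tens tyI); prep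
  | |- rep (Id _) _ _ _ _ => eapply rep_id
  | |- rep (Scal _ _) _ _ _ _ => eapply (rep_scal tyI); prep
  | |- _ => first [eassumption | apply: rX | apply: rs | apply: rc | apply: rd | apply: rc' | apply: rd'
      | apply: rX1 | apply: rFX_ | apply: rFS | apply: rFC | apply: rFD | apply: rFX]
  end.
Ltac represent := eapply rep_eq;
  [prep | reflexivity | reflexivity | rewrite ?(mulr1, mul1r, mulrN1, opprK); reflexivity | reflexivity].

Let rep_same f g v w r L : rep f v w r L -> rep g v w r L -> f ~~~ g.
Proof. by move=> hf hg; apply: (rep_eqv tyI hf hg). Qed.

(** Reversal exchanges the two terms of the dot relation, and the sign of [s] repairs this. It
    cancels in [s s = 1] and appears as -1 on both sides of the braid relation; each zigzag identity
    goes to itself. *)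
Lemma HA_dual : (forall u v, HA_rel x s c d u v -> u ~~~ v) ->
  forall u v, HA_rel X S C D u v -> F u ~~~ F v.
Proof.
move=> HA u v; case.
- transitivity (Comp s s); last exact: (HA _ _ (hH1 _ _ _ _)).
  by apply: (rep_same (v := uu) (w := uu) (r := 1) (L := [:: (0%N, aS); (0%N, aS)])); rewrite /dmap -/dmap; represent.
- pose u3 := [:: true; true; true].
  transitivity (Scal (-1) (Comp (Tens (Id up) s) (Comp (Tens s (Id up)) (Tens (Id up) s)))).
    by apply: (rep_same (v := u3) (w := u3) (r := -1)
      (L := [:: (1%N, aS); (0%N, aS); (1%N, aS)])); rewrite /dmap -/dmap; represent.
  transitivity (Scal (-1) (Comp (Tens s (Id up)) (Comp (Tens (Id up) s) (Tens s (Id up))))).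
    by apply: e_scal; apply: e_sym; apply: (HA _ _ (hH2 _ _ _ _)).
  by apply: (rep_same (v := u3) (w := u3) (r := -1)
      (L := [:: (0%N, aS); (1%N, aS); (0%N, aS)])); rewrite /dmap -/dmap; represent.
- have r1 : rep (Comp (Tens x (Id up)) s) uu uu 1 [:: (0%N, aS); (0%N, aX 1)] by represent.
  have r2 : rep (Comp s (Tens (Id up) x)) uu uu 1 [:: (1%N, aX 1); (0%N, aS)] by represent.
  have r1' : rep (Scal (-1) (F (Comp S (Tens (Id up) X)))) uu uu 1 [:: (0%N, aS); (0%N, aX 1)].
    by rewrite /dmap -/dmap; represent.
  have r2' : rep (F (Comp (Tens X (Id up)) S)) uu uu (-1) [:: (1%N, aX 1); (0%N, aS)].
    by rewrite /dmap -/dmap; represent.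
  transitivity (Add (Comp (Tens x (Id up)) s) (Scal (-1) (Comp s (Tens (Id up) x))));
    last exact: (HA _ _ (hH3 _ _ _ _)).
  have r2n : rep (Scal (-1) (Comp s (Tens (Id up) x))) uu uu (-1) [:: (1%N, aX 1); (0%N, aS)].
    by represent.
  transitivity (Add (Scal (-1) (Comp s (Tens (Id up) x))) (Comp (Tens x (Id up)) s)).
    by apply: e_add; [apply: rep_same r2' r2n | apply: rep_same r1' r1].
  apply: e_add_comm; apply: ty_wt; apply: ty_Add.
    exact: (rep_ty tyI r2n).
  exact: (rep_ty tyI r1).
- transitivity (Comp (Tens d (Id up)) (Tens (Id up) c)); last exact: (HA _ _ (hA1 _ _ _ _)).
  by apply: (rep_same (v := up) (w := up) (r := 1) (L := [:: (1%N, aC); (0%N, aD)]));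
    rewrite /dmap -/dmap; represent.
- transitivity (Comp (Tens (Id dn) d) (Tens c (Id dn))); last exact: (HA _ _ (hA2 _ _ _ _)).
  by apply: (rep_same (v := dn) (w := dn) (r := 1) (L := [:: (0%N, aC); (1%N, aD)]));
    rewrite /dmap -/dmap; represent.
Qed.

Lemma dmap_tcr : F (tcr S C D) ~~~ Scal (-1) (tcr s c d).
Proof.
by apply: (rep_same (v := ud) (w := du) (r := -1) (L := [:: (0%N, aC); (1%N, aS); (2%N, aD)]));
  rewrite /tcr /dmap -/dmap; represent.
Qed.

Hypotheses (dC' : F C' ~~~ Scal (-1) d') (dD' : F D' ~~~ Scal (-1) c').
Let rFC' : rep (F C') du w1 (-1) [:: (0%N, aD')].
Proof. by have := rep_scal tyI (-1) rd'; rewrite mulr1 => h; apply: rep_peqv h dC'. Qed.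
Let rFD' : rep (F D') w1 ud (-1) [:: (0%N, aC')].
Proof. by have := rep_scal tyI (-1) rc'; rewrite mulr1 => h; apply: rep_peqv h dD'. Qed.

Lemma dmap_tcr' : F (tcr' S C' D') ~~~ Scal (-1) (tcr' s c' d').
Proof.
by apply: (rep_same (v := du) (w := ud) (r := -1) (L := [:: (2%N, aC'); (1%N, aS); (0%N, aD')]));
  rewrite /tcr' /dmap -/dmap; represent.
Qed.

Lemma dmap_bubL r : F (bubL X C D' r) ~~~ Scal (-1) (bubR x d c' r).
Proof.
by apply: (rep_same (v := w1) (w := w1) (r := -1) (L := [:: (0%N, aC'); (0%N, aX r); (0%N, aD)]));
  rewrite /bubL /bubR /dmap -/dmap; represent.
Qed.

Lemma dmap_bubR r : F (bubR X D C' r) ~~~ Scal (-1) (bubL x c d' r).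
Proof.
by apply: (rep_same (v := w1) (w := w1) (r := -1) (L := [:: (0%N, aC); (1%N, aX r); (0%N, aD')]));
  rewrite /bubL /bubR /dmap -/dmap; represent.
Qed.

Variables (k k2 : int).
Hypothesis k2E : k2 = - k.

(** Right bubbles go to minus left bubbles, so the determinant defining a left bubble goes to that
    of the negated left bubbles; this is minus the right bubble by definition of the latter. *)
Lemma dmap_bubLZ r : F (bubLZ k X C D C' D' r) ~~~ Scal (-1) (bubRZ k2 x c d c' d' r).
Proof.
rewrite /bubLZ /bubRZ k2E; case: r => r; first exact: dmap_bubL.
rewrite !opprK; case: ifP => _; first by symmetry; apply: neg_zero.
have tB i : ty (Scal (-1) (bubL x c d' i)) = Some (w1, w1) by rewrite -[LHS]/(ty (bubL x c d' i)) ty_bubL.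
transitivity (tdet (fun i j : 'I_(absz (Negz r + k + 1)) =>
    Scal (-1) (bubL x c d' (absz (i%:Z - j%:Z + k))))); last first.
  symmetry; apply: neg_neg; apply: ty_wt; exact: ty_tdet.
by apply: dmap_tdet => // i j; apply: dmap_bubR.
Qed.

Lemma dmap_bubRZ r : F (bubRZ k X C D C' D' r) ~~~ Scal (-1) (bubLZ k2 x c d c' d' r).
Proof.
rewrite /bubLZ /bubRZ k2E; case: r => r; first exact: dmap_bubR.
case: ifP => _; first by symmetry; apply: neg_zero.
rewrite [F _]/=; apply: e_scal; apply: dmap_tdet => [i j|i j]; first exact: ty_bubR.
transitivity (Scal (-1) (Scal (-1) (bubR x d c' (absz ((i%:Z - j%:Z - k)%R))))).
  by apply: e_scal; apply: dmap_bubL.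
apply: neg_neg; apply: ty_wt; exact: ty_bubR.
Qed.

(** Exchanges (P1) with (P2) and (P3) with (P4). Signs cancel in pairs, between [t] and [t'] and
    between a bubble and the factor [c'] or [d'] beside it; the sign of a single bubble accounts for
    the opposite values in (P3) and (P4). *)
Lemma P_dual : (forall u v, P_rel k2 x s c d c' d' u v -> u ~~~ v) ->
  forall u v, P_rel k X S C D C' D' u v -> F u ~~~ F v.
Proof.
move=> relP u v; have pr : prange k2 = prange k by rewrite /prange k2E abszN.
case.
- transitivity (Comp (tcr s c d) (tcr' s c' d')).
    transitivity (Comp (Scal (-1) (tcr s c d)) (Scal (-1) (tcr' s c' d'))).
      exact: (e_comp dmap_tcr dmap_tcr').
    apply: comp_neg_neg; apply: ty_wt; exact: ty_Comp (ty_tcr ts tc td) (ty_tcr' ts tc' td').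
  transitivity (Add (Id du) (F (tsum ud ud
       [seq Tens (Comp (Tens (xpow X i) (Id dn)) (Comp C' (Comp D (Tens (xpow X j) (Id dn)))))
                 (bubLZ k X C D C' D' (- i%:Z - j%:Z - 2))
       | i <- prange k, j <- prange k]))); last exact: peqvv.
  rewrite (relP _ _ (pP2 _ _ _ _ _ _ _)) pr dmap_tsum map_allpairs.
  apply: e_add; first exact: peqvv.
  apply: tsum_allpairs_peqv => i j; cbn [dmap]; symmetry.
  have rt : rep (Comp (Comp (Comp (Tens (Id dn) (F (xpow X j))) (F D)) (F C'))
      (Tens (Id dn) (F (xpow X i)))) du du (-1)
    [:: (1%N, aX i); (0%N, aD'); (0%N, aC); (1%N, aX j)] by represent.
  have rt' : rep (Scal (-1) (Comp (Tens (Id dn) (xpow x j)) (Comp c (Comp d' (Tens (Id dn) (xpow x i))))))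
    du du (-1) [:: (1%N, aX i); (0%N, aD'); (0%N, aC); (1%N, aX j)] by represent.
  apply: e_trans (e_tens (dmap_bubLZ _) (rep_same rt rt')) _.
  by apply: tens_neg_neg; [exact: ty_bubRZ | exact: (rep_ty tyI rt')].
- transitivity (Comp (tcr' s c' d') (tcr s c d)).
    transitivity (Comp (Scal (-1) (tcr' s c' d')) (Scal (-1) (tcr s c d))).
      exact: (e_comp dmap_tcr' dmap_tcr).
    apply: comp_neg_neg; apply: ty_wt; exact: ty_Comp (ty_tcr' ts tc' td') (ty_tcr ts tc td).
  transitivity (Add (Id ud) (F (tsum du du
       [seq Tens (bubRZ k X C D C' D' (- i%:Z - j%:Z - 2))
                 (Comp (Tens (Id dn) (xpow X j)) (Comp C (Comp D' (Tens (Id dn) (xpow X i)))))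
       | i <- prange k, j <- prange k]))); last exact: peqvv.
  rewrite (relP _ _ (pP1 _ _ _ _ _ _ _)) pr dmap_tsum map_allpairs.
  apply: e_add; first exact: peqvv.
  apply: tsum_allpairs_peqv => i j; cbn [dmap]; symmetry.
  have rt : rep (Comp (Comp (Comp (Tens (F (xpow X i)) (Id dn)) (F D')) (F C))
      (Tens (F (xpow X j)) (Id dn))) ud ud (-1)
    [:: (0%N, aX j); (0%N, aD); (0%N, aC'); (0%N, aX i)] by represent.
  have rt' : rep (Scal (-1) (Comp (Tens (xpow x i) (Id dn)) (Comp c' (Comp d (Tens (xpow x j) (Id dn))))))
    ud ud (-1) [:: (0%N, aX j); (0%N, aD); (0%N, aC'); (0%N, aX i)] by represent.
  apply: e_trans (e_tens (rep_same rt rt') (dmap_bubRZ _)) _.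
  by apply: tens_neg_neg; [exact: (rep_ty tyI rt') | exact: ty_bubLZ].
- move=> k0; transitivity (Comp (Tens d' (Id up)) (Comp (Tens (Id dn) s) (Tens c (Id up)))).
    by apply: (rep_same (v := up) (w := up) (r := 1) (L := [:: (0%N, aC); (1%N, aS); (0%N, aD')]));
      rewrite /dmap -/dmap; represent.
  rewrite (relP _ _ (pP4a _ _ _ _ _ _ _)) ?k2E ?oppr_le0 // oppr_eq0.
  by case: ifP.
- move=> r k0 rk; rewrite dmap_bubR (relP _ _ (@pP4b _ _ _ _ _ _ _ _ _ r _ _)) ?k2E ?oppr_le0 ?opprK //.
  by case: ifP => _; [exact: peqvv | exact: neg_zero].
- move=> k0; transitivity (Comp (Tens (Id up) d) (Comp (Tens s (Id dn)) (Tens (Id up) c'))).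
    by apply: (rep_same (v := up) (w := up) (r := 1) (L := [:: (1%N, aC'); (0%N, aS); (1%N, aD)]));
      rewrite /dmap -/dmap; represent.
  rewrite (relP _ _ (pP3a _ _ _ _ _ _ _)) ?k2E ?oppr_ge0 // oppr_eq0.
  by case: ifP.
- move=> r k0 rk; rewrite dmap_bubL (relP _ _ (@pP3b _ _ _ _ _ _ _ _ _ r _ _)) ?k2E ?oppr_ge0 //.
  by case: ifP => _; [exact: neg_neg | exact: neg_zero].
Qed.
End DualRelations.

(** * The theorem for negative charge, by duality *)

Section Negative.
Variables (R : comPzRingType) (n : nat).
Local Notation kp := (Posz n.+1).
Local Notation kn := (Negz n).
Local Notation HT := (tm R (hgen n.+1)).
Local Notation AT := (tm R agen).
Local Notation Hp := (heis R kp).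
Local Notation Hn := (heis R kn).
Local Notation Ap := (alt R kp).
Local Notation An := (alt R kn).
Local Notation pc' := (pos_c' R n.+1).
Local Notation pd' := (pos_d' R n.+1).

(** The generators depend on the absolute value of the charge only, so one assignment serves in both
    directions. [HA] takes the sign of [t], while [d x^r] and [x^r c] are exchanged without sign,
    whence none on [HB]. *)
Definition hdual (g : hgen n.+1) : HT :=
  match g with
  | HX => Gen HX | HS => Scal (-1) (Gen HS) | HC => Gen HD | HD => Gen HC
  | HA => Scal (-1) (Gen HA) | HB r => Gen (HB r)
  end.

Definition adual (g : agen) : AT :=
  match g with
  | AX => Gen AX | AS => Scal (-1) (Gen AS) | Defs.AC => Gen AD | AD => Gen Defs.AC
  | AC' => Scal (-1) (Gen AD') | AD' => Scal (-1) (Gen AC')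
  end.

Local Notation dH := (dmap hdual).
Local Notation dA := (dmap adual).

Lemma ty_hdual_n (g : hgen n.+1) : ty (@hgty kp) (hdual g) = Some (dual_ty (@hgty kn g)).
Proof. by case: g. Qed.
Lemma ty_hdual_p (g : hgen n.+1) : ty (@hgty kn) (hdual g) = Some (dual_ty (@hgty kp g)).
Proof. by case: g. Qed.
Lemma ty_adual g : ty agty (adual g) = Some (dual_ty (agty g)).
Proof. by case: g. Qed.

Let HAp (u v : HT) : HA_rel (hX R kp) (hS R kp) (hC R kp) (hD R kp) u v -> peqv (P := Hp) u v.
Proof. by move=> uv; apply: e_rel; left. Qed.
Let HAn (u v : HT) : HA_rel (hX R kn) (hS R kn) (hC R kn) (hD R kn) u v -> peqv (P := Hn) u v.
Proof. by move=> uv; apply: e_rel; left. Qed.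

Let t : HT := ht R kp.
Let dr (r : nat) : HT := hdr R kp r.
Let cr (r : nat) : HT := hcr R kp r.

Let sum_peqv (P : presentation R) (f g : 'I_n.+1 -> tm R (gen P)) a b :
  (forall i, peqv (f i) (g i)) -> peqv (tsum a b [seq f i | i : 'I_n.+1]) (tsum a b [seq g i | i : 'I_n.+1]).
Proof. exact: tsum_map_peqv. Qed.

Let compNl (P : presentation R) (f g : tm R (gen P)) : wt (@gen_ty R P) (Comp f g) ->
  peqv (Comp (Scal (-1) f) g) (Scal (-1) (Comp f g)).
Proof. exact: e_compZl. Qed.
Let compNr (P : presentation R) (f g : tm R (gen P)) : wt (@gen_ty R P) (Comp f g) ->
  peqv (Comp f (Scal (-1) g)) (Scal (-1) (Comp f g)).
Proof. exact: e_compZr. Qed.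

(** Duality transposes: the inverse of a row becomes the inverse of a column, so the two mixed
    families of relations [iP3] and [iP4] change places. *)
Lemma inv_dual_n (u v : HT) : inv_rel (k := kn) u v -> peqv (P := Hp) (dH u) (dH v).
Proof.
have dt : peqv (P := Hp) (dH t) (Scal (-1) t).
  exact: (dmap_tcr (P := Hp) (phi := hdual) (S := hS R kn) (C := hC R kn) (D := hD R kn)
    (x := hX R kp) (s := hS R kp) (c := hC R kp)
    (d := hD R kp) (c' := Zero w1 ud) (d' := Zero du w1) erefl erefl erefl erefl erefl erefl
    (e_refl _ _ _) (e_refl _ _ _) (e_refl _ _ _)).
have dx r : peqv (P := Hp) (dH (xpow (hX R kp) r)) (xpow (hX R kp) r).
  exact: (dmap_xpow (P := Hp) (phi := hdual) (X := hX R kp) (x := hX R kp) erefl (e_refl _ _ _)).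
have dcr r : peqv (P := Hp) (dH (cr r)) (dr r).
  rewrite /cr /dr /hcr /hdr /=; apply: e_comp; first exact: e_refl.
  apply: e_tens; [exact: dx | exact: e_refl].
have rel (f g : HT) : inv_rel (k := kp) f g -> peqv (P := Hp) f g.
  by move=> fg; apply: e_rel; right.
have tdr r : ty (@hgty kp) (dr r) = Some (ud, w1) by apply: ty_hdr.
case=> // [k0|k0|r k0|r k0|r r' k0].
- transitivity (Add (Comp (Gen HA) t) (tsum ud ud [seq Comp (Gen (HB r)) (dr r) | r : 'I_n.+1]) : tm R (gen Hp));
    last exact: (rel _ _ (@iP1 R kp isT)).
  cbn [dmap]; rewrite dmap_tsum -map_comp; apply: e_add.
    transitivity (Comp (Scal (-1) (Gen HA)) (Scal (-1) t) : tm R (gen Hp)).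
      by apply: e_comp; [exact: e_refl | exact: dt].
    exact: comp_neg_neg.
  apply: sum_peqv => r; apply: e_comp; [exact: e_refl | exact: dcr].
- transitivity (Comp t (Gen HA) : tm R (gen Hp)); last exact: (rel _ _ (@iP2 R kp isT)).
  transitivity (Comp (Scal (-1) t) (Scal (-1) (Gen HA)) : tm R (gen Hp)).
    by apply: e_comp; [exact: dt | exact: e_refl].
  exact: comp_neg_neg.
- transitivity (Scal (-1) (Comp (dr r) (Gen HA)) : tm R (gen Hp)).
    transitivity (Comp (dr r) (Scal (-1) (Gen HA)) : tm R (gen Hp)).
      by apply: e_comp; [exact: dcr | exact: e_refl].
    by apply: compNr; apply: (ty_wt (P := Hp) (ty_Comp (P := Hp) (g := Gen HA) (a := du) (tdr r) erefl)).
  transitivity (Scal (-1) (Zero du w1) : tm R (gen Hp)); last exact: neg_zero.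
  by apply: e_scal; apply: (rel _ _ (@iP4 R kp r isT)).
- transitivity (Scal (-1) (Comp t (Gen (HB r))) : tm R (gen Hp)).
    transitivity (Comp (Scal (-1) t) (Gen (HB r)) : tm R (gen Hp)).
      by apply: e_comp; [exact: dt | exact: e_refl].
    exact: compNl.
  transitivity (Scal (-1) (Zero w1 du) : tm R (gen Hp)); last exact: neg_zero.
  by apply: e_scal; apply: (rel _ _ (@iP3 R kp r isT)).
- transitivity (Comp (dr r') (Gen (HB r)) : tm R (gen Hp)).
    by apply: e_comp; [exact: dcr | exact: e_refl].
  apply: e_trans (rel _ _ (@iP5 R kp r' r isT)) _.
  by rewrite eq_sym; case: ifP => _; apply: e_refl.
Qed.

Lemma inv_dual_p (u v : HT) : inv_rel (k := kp) u v -> peqv (P := Hn) (dH u) (dH v).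
Proof.
have dt : peqv (P := Hn) (dH t) (Scal (-1) t).
  exact: (dmap_tcr (P := Hn) (phi := hdual) (S := hS R kp) (C := hC R kp) (D := hD R kp)
    (x := hX R kn) (s := hS R kn) (c := hC R kn)
    (d := hD R kn) (c' := Zero w1 ud) (d' := Zero du w1) erefl erefl erefl erefl erefl erefl
    (e_refl _ _ _) (e_refl _ _ _) (e_refl _ _ _)).
have dx r : peqv (P := Hn) (dH (xpow (hX R kn) r)) (xpow (hX R kn) r).
  exact: (dmap_xpow (P := Hn) (phi := hdual) (X := hX R kn) (x := hX R kn) erefl (e_refl _ _ _)).
have ddr r : peqv (P := Hn) (dH (dr r)) (cr r).
  rewrite /cr /dr /hcr /hdr /=; apply: e_comp; last exact: e_refl.
  apply: e_tens; [exact: e_refl | exact: dx].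
have rel (f g : HT) : inv_rel (k := kn) f g -> peqv (P := Hn) f g.
  by move=> fg; apply: e_rel; right.
have tcr r : ty (@hgty kn) (cr r) = Some (w1, du) by apply: ty_hcr.
case=> // [k0|k0|r k0|r k0|r r' k0].
- transitivity (Add (Comp t (Gen HA)) (tsum du du [seq Comp (cr r) (Gen (HB r)) | r : 'I_n.+1]) : tm R (gen Hn));
    last exact: (rel _ _ (@iN1 R kn isT)).
  cbn [dmap]; rewrite dmap_tsum -map_comp; apply: e_add.
    transitivity (Comp (Scal (-1) t) (Scal (-1) (Gen HA)) : tm R (gen Hn)).
      by apply: e_comp; [exact: dt | exact: e_refl].
    exact: comp_neg_neg.
  apply: sum_peqv => r; apply: e_comp; [exact: ddr | exact: e_refl].
- transitivity (Comp (Gen HA) t : tm R (gen Hn)); last exact: (rel _ _ (@iN2 R kn isT)).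
  transitivity (Comp (Scal (-1) (Gen HA)) (Scal (-1) t) : tm R (gen Hn)).
    by apply: e_comp; [exact: e_refl | exact: dt].
  exact: comp_neg_neg.
- transitivity (Scal (-1) (Comp (Gen (HB r)) t) : tm R (gen Hn)).
    transitivity (Comp (Gen (HB r)) (Scal (-1) t) : tm R (gen Hn)).
      by apply: e_comp; [exact: e_refl | exact: dt].
    exact: compNr.
  transitivity (Scal (-1) (Zero ud w1) : tm R (gen Hn)); last exact: neg_zero.
  by apply: e_scal; apply: (rel _ _ (@iN4 R kn r isT)).
- transitivity (Scal (-1) (Comp (Gen HA) (cr r)) : tm R (gen Hn)).
    transitivity (Comp (Scal (-1) (Gen HA)) (cr r) : tm R (gen Hn)).
      by apply: e_comp; [exact: e_refl | exact: ddr].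
    by apply: compNl; apply: (ty_wt (P := Hn) (ty_Comp (P := Hn) (f := Gen HA) (c := ud) erefl (tcr r))).
  transitivity (Scal (-1) (Zero w1 ud) : tm R (gen Hn)); last exact: neg_zero.
  by apply: e_scal; apply: (rel _ _ (@iN3 R kn r isT)).
- transitivity (Comp (Gen (HB r')) (cr r) : tm R (gen Hn)).
    by apply: e_comp; [exact: e_refl | exact: ddr].
  apply: e_trans (rel _ _ (@iN5 R kn r' r isT)) _.
  by rewrite eq_sym; case: ifP => _; apply: e_refl.
Qed.

Lemma dH_np (u v : HT) : peqv (P := Hn) u v -> peqv (P := Hp) (dH u) (dH v).
Proof.
apply: (@dmap_peqv R Hn Hp hdual ty_hdual_n) => {}u {}v [HA|]; last exact: inv_dual_n.
exact: (HA_dual (P := Hp) (phi := hdual) (X := hX R kn) (S := hS R kn) (C := hC R kn) (D := hD R kn)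
    (x := hX R kp) (s := hS R kp) (c := hC R kp)
    (d := hD R kp) (c' := Zero w1 ud) (d' := Zero du w1) erefl erefl erefl erefl erefl erefl
    (e_refl _ _ _) (e_refl _ _ _) (e_refl _ _ _) (e_refl _ _ _) HAp HA).
Qed.

Lemma dH_pn (u v : HT) : peqv (P := Hp) u v -> peqv (P := Hn) (dH u) (dH v).
Proof.
apply: (@dmap_peqv R Hp Hn hdual ty_hdual_p) => {}u {}v [HA|]; last exact: inv_dual_p.
exact: (HA_dual (P := Hn) (phi := hdual) (X := hX R kp) (S := hS R kp) (C := hC R kp) (D := hD R kp)
    (x := hX R kn) (s := hS R kn) (c := hC R kn)
    (d := hD R kn) (c' := Zero w1 ud) (d' := Zero du w1) erefl erefl erefl erefl erefl erefl
    (e_refl _ _ _) (e_refl _ _ _) (e_refl _ _ _) (e_refl _ _ _) HAn HA).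
Qed.

Lemma dH_invol_p u : peqv (P := Hp) (dH (dH u)) u.
Proof.
apply: (@dmap_dmap_peqv R Hp _ hdual hdual) => -[|||||r] /=;
  first [exact: e_refl | exact: neg_neg].
Qed.

Lemma dH_invol_n u : peqv (P := Hn) (dH (dH u)) u.
Proof.
apply: (@dmap_dmap_peqv R Hn _ hdual hdual) => -[|||||r] /=;
  first [exact: e_refl | exact: neg_neg].
Qed.

Lemma dA_pn (u v : AT) : peqv (P := Ap) u v -> peqv (P := An) (dA u) (dA v).
Proof.
apply: (@dmap_peqv R Ap An adual ty_adual) => {}u {}v [HA|HP].
  exact: (HA_dual (P := An) (phi := adual) (X := Gen AX) (S := Gen AS) (C := Gen Defs.AC) (D := Gen AD)
    (x := Gen AX) (s := Gen AS) (c := Gen Defs.AC)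
    (d := Gen AD) (c' := Gen AC') (d' := Gen AD') erefl erefl erefl erefl erefl erefl
    (e_refl _ _ _) (e_refl _ _ _) (e_refl _ _ _) (e_refl _ _ _) (fun _ _ h => e_rel _ (or_introl h)) HA).
exact: (P_dual (P := An) (phi := adual) (C' := Gen AC') (D' := Gen AD') (X := Gen AX) (S := Gen AS) (C := Gen Defs.AC) (D := Gen AD)
    (x := Gen AX) (s := Gen AS) (c := Gen Defs.AC)
    (d := Gen AD) (c' := Gen AC') (d' := Gen AD') erefl erefl erefl erefl erefl erefl
    (e_refl _ _ _) (e_refl _ _ _) (e_refl _ _ _) (e_refl _ _ _) (e_refl _ _ _) (e_refl _ _ _)
    (k := kp) (k2 := kn) erefl (fun _ _ h => e_rel _ (or_intror h)) HP).
Qed.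

Lemma dA_invol k u : peqv (P := alt R k) (dA (dA u)) u.
Proof.
by apply: (@dmap_dmap_peqv R (alt R k) _ adual adual) => -[] /=;
  first [exact: e_refl | exact: neg_neg].
Qed.

(** Chosen so that the duality sends it back to minus [pd'], as [P_dual] requires. *)
Definition neg_c' : HT := Scal (-1) (dH pd').
Definition neg_d' : HT := Scal (-1) (dH pc').

Lemma ty_neg_c' : ty (@hgty kn) neg_c' = Some (w1, ud).
Proof.
by rewrite -[LHS]/(ty (@hgty kn) (dH pd')) (@ty_dmap R Hp Hn hdual ty_hdual_p) (ty_pos_d' R n.+1).
Qed.

Lemma ty_neg_d' : ty (@hgty kn) neg_d' = Some (du, w1).
Proof.
by rewrite -[LHS]/(ty (@hgty kn) (dH pc')) (@ty_dmap R Hp Hn hdual ty_hdual_p) (ty_pos_c' R n.+1).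
Qed.

(** The duality is an involution up to equivalence, so it is enough to verify the dual relations,
    which hold at the positive charge. *)
Lemma neg_satisfies_P : satisfies_P (k := kn) neg_c' neg_d'.
Proof.
move=> u v uv; apply: e_trans (e_sym (dH_invol_n u)) (e_trans _ (dH_invol_n v)); apply: dH_pn.
apply: (P_dual (P := Hp) (phi := hdual) (X := hX R kn) (S := hS R kn) (C := hC R kn) (D := hD R kn)
    (x := hX R kp) (s := hS R kp) (c := hC R kp)
    (d := hD R kp) (c' := pc') (d' := pd') erefl erefl erefl erefl (ty_pos_c' R n.+1) (ty_pos_d' R n.+1)
    (e_refl _ _ _) (e_refl _ _ _) (e_refl _ _ _) (e_refl _ _ _) _ _ (k := kn) (k2 := kp) erefl _ uv).
- exact: (e_scal (-1) (dH_invol_p pd')).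
- exact: (e_scal (-1) (dH_invol_p pc')).
- exact: (@pos_satisfies_P R n.+1).
Qed.

Lemma neg_unique (c'' d'' : HT) : tyH (k := kn) c'' = Some (w1, ud) ->
  tyH (k := kn) d'' = Some (du, w1) -> satisfies_P (k := kn) c'' d'' ->
  eqvH (k := kn) c'' neg_c' /\ eqvH (k := kn) d'' neg_d'.
Proof.
move=> tc' td' relP; pose cp : HT := Scal (-1) (dH d''); pose dp : HT := Scal (-1) (dH c'').
have tcp : tyH (k := kp) cp = Some (w1, ud).
  by rewrite -[LHS]/(ty (@hgty kp) (dH d'')) (@ty_dmap R Hn Hp hdual ty_hdual_n) -/(tyH _) td'.
have tdp : tyH (k := kp) dp = Some (du, w1).
  by rewrite -[LHS]/(ty (@hgty kp) (dH c'')) (@ty_dmap R Hn Hp hdual ty_hdual_n) -/(tyH _) tc'.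
have relPp : satisfies_P (k := kp) cp dp.
  move=> u v uv; apply: e_trans (e_sym (dH_invol_p u)) (e_trans _ (dH_invol_p v)); apply: dH_np.
  apply: (P_dual (P := Hn) (phi := hdual) (X := hX R kp) (S := hS R kp) (C := hC R kp) (D := hD R kp)
    (x := hX R kn) (s := hS R kn) (c := hC R kn)
    (d := hD R kn) (c' := c'') (d' := d'') erefl erefl erefl erefl tc' td'
    (e_refl _ _ _) (e_refl _ _ _) (e_refl _ _ _) (e_refl _ _ _) _ _ (k := kp) (k2 := kn) erefl relP uv).
  - exact: (e_scal (-1) (dH_invol_n d'')).
  - exact: (e_scal (-1) (dH_invol_n c'')).
have [ec ed] := pos_unique tcp tdp relPp.
have neg f g : wt (@hgty kn) f -> peqv (P := Hn) (dH (Scal (-1) (dH f))) g ->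
    peqv (P := Hn) f (Scal (-1) g).
  move=> wf e; apply: e_trans (e_sym (neg_neg (P := Hn) wf)) _; apply: e_scal.
  by apply: e_trans e; apply: e_scal; apply: e_sym; apply: dH_invol_n.
split; apply: neg; [exact: (ty_wt (P := Hn) tc') | exact: dH_pn ed | exact: (ty_wt (P := Hn) td') |
  exact: dH_pn ec].
Qed.

Local Notation Fp := (fmap (altF (k := kp) pc' pd')).
Local Notation Fn := (fmap (altF (k := kn) neg_c' neg_d')).

Lemma ty_altF_n g : ty (@hgty kn) (altF (k := kn) neg_c' neg_d' g) = Some (agty g).
Proof. by case: g => //; [exact: ty_neg_c'|exact: ty_neg_d']. Qed.

(** The functor at negative charge is conjugate, by the dualities on both sides, to the one at
    positive charge; surjectivity and injectivity on Hom spaces are transported along this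
    square. *)
Lemma dH_Fn u : peqv (P := Hp) (dH (Fn u)) (Fp (dA u)).
Proof.
apply: (@dmap_fmap_peqv R Hp _ _ _ (altF (k := kn) neg_c' neg_d') hdual adual
  (altF (k := kp) pc' pd')) => -[]; try exact: e_refl.
  exact: (e_scal (-1) (dH_invol_p pd')).
exact: (e_scal (-1) (dH_invol_p pc')).
Qed.

Lemma neg_iso : altF_iso (k := kn) neg_c' neg_d'.
Proof.
split.
- apply: (@fmap_peqv R An Hn (altF (k := kn) neg_c' neg_d') ty_altF_n) => u v [HA|HP].
    exact: HAn (fmap_HA_rel (altF (k := kn) neg_c' neg_d') HA).
  exact: neg_satisfies_P (fmap_P_rel (altF (k := kn) neg_c' neg_d') HP).
- move=> u a b tu; rewrite -tu.
  exact: (@ty_fmap R An Hn (altF (k := kn) neg_c' neg_d') ty_altF_n u).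
- move=> f a b tf; have [_ _ surj _] := pos_iso R n.+1.
  have tdf : tyH (k := kp) (dH f) = Some (rev b, rev a).
    by rewrite /tyH (@ty_dmap R Hn Hp hdual ty_hdual_n) -/(tyH _) tf.
  have [u tu eu] := surj _ _ _ tdf; exists (dA u).
    by rewrite /tyA (@ty_dmap R Ap An adual ty_adual) -/(tyA _) tu /dual_ty /= !revK.
  apply: e_trans (e_sym (dH_invol_n _)) (e_trans _ (dH_invol_n f)); apply: dH_pn.
  apply: e_trans (dH_Fn _) (e_trans _ eu); apply: altF_peqv; exact: dA_invol.
- move=> u v a b tu tv /dH_np e; have [_ _ _ inj] := pos_iso R n.+1.
  have td w : tyA w = Some (a, b) -> tyA (dA w) = Some (rev b, rev a).
    by move=> tw; rewrite /tyA (@ty_dmap R Ap An adual ty_adual) -/(tyA _) tw.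
  have : eqvA kp (dA u) (dA v).
    apply: (inj _ _ _ _ (td _ tu) (td _ tv)).
    exact: e_trans (e_sym (dH_Fn u)) (e_trans e (dH_Fn v)).
  move=> /dA_pn e'; exact: e_trans (e_sym (dA_invol _ u)) (e_trans e' (dA_invol _ v)).
Qed.
End Negative.

Theorem theorem1p2 (R : comPzRingType) (k : int) :
  exists c' d' : tm R (hgen `|k|),
    [/\ tyH c' = Some (w1, ud), tyH d' = Some (du, w1),
        satisfies_P c' d',
        (forall c'' d'' : tm R (hgen `|k|),
            tyH c'' = Some (w1, ud) -> tyH d'' = Some (du, w1) ->
            satisfies_P c'' d'' -> eqvH c'' c' /\ eqvH d'' d')
      & altF_iso c' d'].
Proof.
case: k => n.
  exists (pos_c' R n), (pos_d' R n); split.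
  - exact: ty_pos_c'.
  - exact: ty_pos_d'.
  - exact: pos_satisfies_P.
  - exact: pos_unique.
  - exact: pos_iso.
exists (neg_c' R n), (neg_d' R n); split.
- exact: ty_neg_c'.
- exact: ty_neg_d'.
- exact: neg_satisfies_P.
- exact: neg_unique.
- exact: neg_iso.
Qed.
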